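(* Let $p>3$ be a prime. If $p\equiv1\pmod3$ and $p=x^2+3y^2$ with $x,y\in\mathbb Z$, then $$\sum_{k=0}^{p-2}\frac{\binom{2k}k^2\binom{3k}k}{108^k(k+1)^3}\equiv9-2x^2+p+\frac{117p^2}{16x^2}\pmod{p^3}.$$ If $p\equiv2\pmod3$, then $$\sum_{k=0}^{p-2}\frac{\binom{2k}k^2\binom{3k}k}{108^k(k+1)^3}\equiv9-\frac{115}2\binom{(p-1)/2}{(p-5)/6}^2\Big(1+p\Big(2+\frac43q_p(2)-\frac32q_p(3)\Big)+p^2\Big(1+\frac83q_p(2)+\frac29q_p(2)^2-3q_p(3)-2q_p(2)q_p(3)+\frac{15}8q_p(3)^2+\frac34U_{p-3}\Big)\Big)+\frac14p^2\binom{(p-1)/2}{(p-5)/6}^{-2}\pmod{p^3}.$$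
   Context: Congruences modulo $p^3$ are between rational numbers whose denominators are not divisible by $p$. For $a$ not divisible by $p$, $q_p(a)=(a^{p-1}-1)/p$. The sequence $\{U_n\}$ is given by $U_{2n-1}=0$, $U_0=1$, $U_{2n}=-2\sum_{k=1}^n\binom{2n}{2k}U_{2n-2k}$ for $n=1,2,3,\ldots$. *)

(* Defs.v *)
From mathcomp Require Import all_boot all_order all_algebra.

Set Implicit Arguments.
Unset Strict Implicit.
Unset Printing Implicit Defensive.

Import GRing.Theory.
Local Open Scope ring_scope.

(* Congruence modulo p ^ n between rational numbers whose reduced
   denominators are not divisible by p (this is part of the relation). *)
Definition rat_congr (p n : nat) (a b : rat) : Prop :=
  [/\ ~~ (p%:Z %| denq a)%Z, ~~ (p%:Z %| denq b)%Z
    & ((p ^ n)%N%:Z %| numq (a - b))%Z].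

Definition fermat_quotient (p a : nat) : rat := (a%:R ^+ p.-1 - 1) / p%:R.

(* [:: U_0; U_2; ...; U_(2n)] *)
Fixpoint U_even_seq (n : nat) : seq int :=
  if n is m.+1 then
    let s := U_even_seq m in
    rcons s (- 2 * \sum_(1 <= k < n.+1) 'C(n.*2, k.*2)%:Z * s`_(n - k))
  else [:: 1].

Definition U (n : nat) : int := if odd n then 0 else (U_even_seq n./2)`_(n./2).

Lemma size_U_even_seq n : size (U_even_seq n) = n.+1.
Proof. by elim: n => //= n IHn; rewrite size_rcons IHn. Qed.

Lemma nth_U_even_seq n i : (i <= n)%N -> (U_even_seq n)`_i = U i.*2.
Proof.
rewrite /U odd_double doubleK; elim: n => [|n IHn]; first by case: i.
rewrite leq_eqVlt => /predU1P[-> //|lt_in].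
by rewrite /= nth_rcons size_U_even_seq lt_in IHn.
Qed.

Lemma U0 : U 0 = 1.
Proof. by []. Qed.

Lemma U_odd n : (0 < n)%N -> U (2 * n - 1) = 0.
Proof. by case: n => // n _; rewrite /U mul2n doubleS subn1 /= odd_double. Qed.

Lemma U_even n : (0 < n)%N ->
  U (2 * n) = - 2 * \sum_(1 <= k < n.+1) 'C(2 * n, 2 * k)%:Z * U (2 * n - 2 * k).
Proof.
case: n => // n _; rewrite {1}/U mul2n odd_double doubleK [U_even_seq _]/=.
rewrite nth_rcons size_U_even_seq ltnn eqxx; congr (_ * _).
apply: eq_big_nat => k /andP[k_gt0 _].
rewrite mul2n -doubleB nth_U_even_seq //.
by rewrite leq_subLR -add1n leq_add2r.
Qed.

(* Main.v *)
(* Write F(a) for the 3F2(1/2, -a, a+1; 1, 1; 1) truncated at p. The sum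
   telescopes to 9 - F(-1/3)/2 - (115/8) F(1/3) modulo p^3. The function F satisfies
   F(-1-a) = F(a) and (a+1)^2 F(a+1) = a^2 F(a-1) modulo p^3, so F(-1/3) and F(1/3)
   are reached by steps of 2 from F(-p/3) and F(1-p/3), and one of F(-1/3), F(1/3) is a
   squared binomial coefficient times a truncated exponential of harmonic sums while
   their product is -2 p^2. For p = 2 mod 3 the harmonic sums are expressed through
   q_p(2), q_p(3) and U_(p-3). For p = 1 mod 3 a Jacobi sum over Z/p^3 built
   from Teichmuller representatives is a combination of binomial coefficients, its
   square is F(-1/3), and its trace is 2x up to sign; hence 4 x^2 F = (F + p)^2. *)

Require Import Defs.
From mathcomp Require Import all_boot all_order all_algebra all_field.
From mathcomp Require Import zify ring.

Set Implicit Arguments.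
Unset Strict Implicit.
Unset Printing Implicit Defensive.

Import Order.TTheory GRing.Theory Num.Theory.
Local Open Scope ring_scope.

(** * Congruences modulo powers of [p] in the rationals *)

(** The recursion between [F (a + 1)] and [F (a - 1)] is an exact identity with an explicit
    truncation error, divisible by [p ^ 3] as long as [a] is not 0 or -1 modulo [p]. Chains of steps
    must therefore stay between these residues and start near 0 or 1. The start -p/3 is chosen
    because an even integer added to it gives exactly -1/3 or 1/3. Near 0, F (- p t) is quadratic in
    t modulo p^3. Its quadratic coefficient is an alternating binomial sum modulo [p]; its linear
    one follows from t = 1, since F (- p) = F (p - 1) is reached from F (0) = 1. The other start 1 -
    p/3 lies one step across the residue 0, where the truncation error is computed instead of
    dropped. For p = 1 mod 3 no harmonic sum is ever evaluated: F (-1/3) and the square of the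
    Jacobi sum turn out to have the same constant and the same exponents in harmonic sums. Precision
    p^3 suffices for the Jacobi sum because its norm is an integer between 0 and 6 p^2, hence
    determined by its residue. *)

Section PAdicCongruence.
Variables (p : nat) (p_pr : prime p).
Local Notation P := (p%:R : rat).

(** Any denominator prime to [p] is allowed, not only the reduced one, so that closure under sums
    and products is immediate; [pint_denq] relates this to [denq]. *)
Definition pint (x : rat) : Prop :=
  exists2 d : nat, ~~ (p %| d)%N & exists n : int, x * d%:R = n%:~R.

Definition eqm (n : nat) (x y : rat) : Prop :=
  exists2 z, pint z & x = y + P ^+ n * z.

Lemma pneq0 : P != 0.
Proof. by rewrite pnatr_eq0 -lt0n prime_gt0. Qed.

Lemma pint_int (n : int) : pint n%:~R.
Proof. by exists 1%N; [rewrite dvdn1 neq_ltn prime_gt1 ?orbT | exists n; rewrite mulr1]. Qed.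

Lemma pint_nat (n : nat) : pint n%:R.
Proof. exact: (pint_int n). Qed.

Lemma pint0 : pint 0. Proof. exact: (pint_nat 0). Qed.
Lemma pint1 : pint 1. Proof. exact: (pint_nat 1). Qed.

Lemma pintD x y : pint x -> pint y -> pint (x + y).
Proof.
move=> [d pd [n xE]] [e pe [m yE]]; exists (d * e)%N.
  by rewrite Euclid_dvdM // negb_or pd.
exists (n * e%:Z + m * d%:Z).
by rewrite natrM rmorphD !rmorphM /= -xE -yE -!pmulrn; ring.
Qed.

Lemma pintM x y : pint x -> pint y -> pint (x * y).
Proof.
move=> [d pd [n xE]] [e pe [m yE]]; exists (d * e)%N.
  by rewrite Euclid_dvdM // negb_or pd.
by exists (n * m); rewrite natrM rmorphM /= -xE -yE; ring.
Qed.

Lemma pintN x : pint x -> pint (- x).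
Proof. by move=> hx; rewrite -mulN1r; apply: pintM => //; exact: (pint_int (-1)). Qed.

Lemma pintB x y : pint x -> pint y -> pint (x - y).
Proof. by move=> hx hy; apply: pintD => //; apply: pintN. Qed.

Lemma pintX x n : pint x -> pint (x ^+ n).
Proof.
move=> hx; elim: n => [|n IHn]; first by rewrite expr0; exact: pint1.
by rewrite exprS; apply: pintM.
Qed.

Lemma pint_sum (I : Type) (r : seq I) (Q : pred I) F :
  (forall i, Q i -> pint (F i)) -> pint (\sum_(i <- r | Q i) F i).
Proof. by move=> h; apply: big_ind => //; [exact: pint0 | exact: pintD]. Qed.

Lemma pint_prod (I : Type) (r : seq I) (Q : pred I) F :
  (forall i, Q i -> pint (F i)) -> pint (\prod_(i <- r | Q i) F i).
Proof. by move=> h; apply: big_ind => //; [exact: pint1 | exact: pintM]. Qed.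

Lemma pint_natV n : ~~ (p %| n)%N -> pint (n%:R^-1).
Proof.
move=> pn; exists n => //; exists 1; rewrite mulVf //.
by rewrite pnatr_eq0; apply: contraNneq pn => ->.
Qed.

Lemma pint_denq x : pint x <-> ~~ (p%:Z %| denq x)%Z.
Proof.
split=> [[d pd [n xE]]|px].
  apply: contra pd => pden.
  have E : numq x * d%:Z = n * denq x.
    apply: (@intr_inj rat); rewrite !rmorphM /= -xE -(divq_num_den x) /=.
    rewrite divq_num_den -pmulrn numqE; ring.
  have : (denq x %| numq x * d%:Z)%Z by rewrite E dvdz_mull.
  rewrite Gauss_dvdzr; last by rewrite /coprimez gcdzC; have := coprime_num_den x; rewrite /coprime => /eqP; rewrite /gcdz => ->.
  by move/(dvdz_trans pden).
exists `|denq x|%N; first by move: px; rewrite dvdzE.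
exists (numq x); rewrite numqE; congr (_ * _).
by rewrite pmulrn abszE ger0_norm ?denq_ge0.
Qed.

Lemma eqm_refl n x : eqm n x x.
Proof. by exists 0; [exact: pint0 | rewrite mulr0 addr0]. Qed.

Lemma eqm_sym n x y : eqm n x y -> eqm n y x.
Proof. by case=> z hz ->; exists (- z); [exact: pintN | ring]. Qed.

Lemma eqm_trans n y x z : eqm n x y -> eqm n y z -> eqm n x z.
Proof. by case=> u hu -> [v hv ->]; exists (u + v); [exact: pintD | ring]. Qed.

Lemma eqmD n x y x' y' : eqm n x x' -> eqm n y y' -> eqm n (x + y) (x' + y').
Proof. by case=> u hu -> [v hv ->]; exists (u + v); [exact: pintD | ring]. Qed.

Lemma eqmN n x x' : eqm n x x' -> eqm n (- x) (- x').
Proof. by case=> u hu ->; exists (- u); [exact: pintN | ring]. Qed.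

Lemma eqmB n x y x' y' : eqm n x x' -> eqm n y y' -> eqm n (x - y) (x' - y').
Proof. by move=> h h'; apply: eqmD => //; apply: eqmN. Qed.

Lemma eqm_mull n c x y : pint c -> eqm n x y -> eqm n (c * x) (c * y).
Proof. by move=> hc [u hu ->]; exists (c * u); [exact: pintM | ring]. Qed.

Lemma eqm_mulr n c x y : pint c -> eqm n x y -> eqm n (x * c) (y * c).
Proof. by move=> hc [u hu ->]; exists (u * c); [exact: pintM | ring]. Qed.

Lemma eqm_pint n x y : eqm n x y -> pint y -> pint x.
Proof. by case=> u hu -> hy; apply/pintD/pintM => //; apply/pintX/pint_nat. Qed.

Lemma eqmM n x y x' y' : pint x' -> pint y' ->
  eqm n x x' -> eqm n y y' -> eqm n (x * y) (x' * y').
Proof.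
move=> hx' hy' hx hy; apply: eqm_trans (eqm_mulr hy' hx).
by apply: eqm_mull hy; apply: eqm_pint hx hx'.
Qed.

Lemma eqmX n x y k : pint y -> eqm n x y -> eqm n (x ^+ k) (y ^+ k).
Proof.
move=> hy h; elim: k => [|k IHk]; first exact: eqm_refl.
by rewrite !exprS; apply: eqmM => //; apply: pintX.
Qed.

Lemma eqm_sum n (I : Type) (r : seq I) (Q : pred I) F G :
  (forall i, Q i -> eqm n (F i) (G i)) ->
  eqm n (\sum_(i <- r | Q i) F i) (\sum_(i <- r | Q i) G i).
Proof.
by move=> h; apply: (big_ind2 (eqm n)) => //; [exact: eqm_refl | move=> *; apply: eqmD].
Qed.

Lemma eqm_prod n (I : Type) (r : seq I) (Q : pred I) F G :
  (forall i, Q i -> pint (G i)) -> (forall i, Q i -> eqm n (F i) (G i)) ->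
  eqm n (\prod_(i <- r | Q i) F i) (\prod_(i <- r | Q i) G i).
Proof.
move=> hG h.
suff [] : eqm n (\prod_(i <- r | Q i) F i) (\prod_(i <- r | Q i) G i)
        /\ pint (\prod_(i <- r | Q i) G i) by [].
apply: (big_ind2 (fun x y => eqm n x y /\ pint y)).
- by split; [exact: eqm_refl | exact: pint1].
- by move=> x1 x2 y1 y2 [? ?] [? ?]; split; [apply: eqmM | apply: pintM].
- by move=> i Qi; split; [apply: h | apply: hG].
Qed.

Lemma eqm_weak n m x y : (m <= n)%N -> eqm n x y -> eqm m x y.
Proof.
move=> le_mn [z hz ->]; exists (P ^+ (n - m) * z).
  by apply: pintM => //; apply/pintX/pint_nat.
by rewrite mulrA -exprD subnKC.
Qed.

Lemma eqm_mulp n k x y : eqm n x y -> eqm (k + n) (P ^+ k * x) (P ^+ k * y).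
Proof. by case=> z hz ->; exists z => //; rewrite exprD; ring. Qed.

Lemma eqm_int n (a b : int) : (p%:Z ^+ n %| a - b)%Z -> eqm n a%:~R b%:~R.
Proof.
case/dvdzP=> q E; exists q%:~R; first exact: pint_int.
have -> : a = b + q * p%:Z ^+ n by rewrite -E addrC subrK.
by rewrite rmorphD rmorphM rmorphXn /= -pmulrn; ring.
Qed.

Lemma rat_congr_eqm n x y : pint y -> eqm n x y -> rat_congr p n x y.
Proof.
move=> hy hxy; have hx := eqm_pint hxy hy.
split; [exact/pint_denq | exact/pint_denq |].
case: hxy => z [d pd [m zE]] ->; rewrite [y + _]addrC addrK.
set t := _ * z.
have E : numq t * d%:Z = (p ^ n)%N%:Z * m * denq t.
  apply: (@intr_inj rat); rewrite !rmorphM /= -zE numqE -!pmulrn natrX /t; ring.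
have : ((p ^ n)%N%:Z %| numq t * d%:Z)%Z by rewrite E -mulrA dvdz_mulr.
by rewrite Gauss_dvdzl // coprimezE /= coprimeXl // prime_coprime.
Qed.

Definition punit x := [/\ x != 0, pint x & pint x^-1].

Lemma punit_pint x : punit x -> pint x. Proof. by case. Qed.
Lemma punitV_pint x : punit x -> pint x^-1. Proof. by case. Qed.
Lemma punit_neq0 x : punit x -> x != 0. Proof. by case. Qed.

Lemma punit_nat n : ~~ (p %| n)%N -> punit n%:R.
Proof.
move=> pn; split; [|exact: pint_nat | exact: pint_natV].
by rewrite pnatr_eq0; apply: contraNneq pn => ->.
Qed.

Lemma punit1 : punit 1.
Proof. by apply: (@punit_nat 1); rewrite dvdn1 neq_ltn prime_gt1 ?orbT. Qed.

Lemma punitM x y : punit x -> punit y -> punit (x * y).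
Proof.
by move=> [? ? ?] [? ? ?]; split; [rewrite mulf_neq0 | apply: pintM | rewrite invfM; apply: pintM].
Qed.

Lemma punitV x : punit x -> punit x^-1.
Proof. by case=> ? ? ?; split; rewrite ?invr_eq0 ?invrK. Qed.

Lemma punitN x : punit x -> punit (- x).
Proof. by case=> ? ? ?; split; rewrite ?oppr_eq0 ?invrN //; apply: pintN. Qed.

Lemma punitX x n : punit x -> punit (x ^+ n).
Proof. by case=> ? ? ?; split; rewrite ?expf_neq0 // -?exprVn; apply: pintX. Qed.

(** Over the common denominator [d * e] the numerator is [N], congruent to [m * d] modulo [p]; and
    [m] is prime to [p] because [m * l = e * f] for the fractions representing [y] and its
    inverse. *)
Lemma punit_eqm x y : eqm 1 x y -> punit y -> punit x.
Proof.
move=> [z [d pd [n zE]] ->] [y0 [e pe [m yE]] [f pf [l yVE]]]; rewrite expr1 in zE *.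
have de : d%:R != 0 :> rat by rewrite pnatr_eq0; apply: contraNneq pd => ->.
have ee : e%:R != 0 :> rat by rewrite pnatr_eq0; apply: contraNneq pe => ->.
have fe : f%:R != 0 :> rat by rewrite pnatr_eq0; apply: contraNneq pf => ->.
pose N := m * d%:Z + p%:Z * n * e%:Z.
have NE : (y + P * z) * (d * e)%N%:R = N%:~R.
  by rewrite /N rmorphD !rmorphM /= -zE -yE -!pmulrn; ring.
have pN : ~~ (p %| `|N|)%N.
  have pm : ~~ (p%:Z %| m)%Z.
    have lm : m * l = (e * f)%N%:Z.
      apply: (@intr_inj rat); rewrite PoszM !rmorphM /= -yE -yVE -!pmulrn; field.
      exact: y0.
    apply/negP => pm; have : (p%:Z %| (e * f)%N%:Z)%Z by rewrite -lm dvdz_mulr.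
    by rewrite dvdzE /= Euclid_dvdM // (negPf pe) (negPf pf).
  apply/negP => pN; have {}pN : (p%:Z %| N)%Z by rewrite dvdzE.
  have : (p%:Z %| m * d%:Z)%Z.
    have -> : m * d%:Z = N - p%:Z * (n * e%:Z) by rewrite /N; ring.
    by rewrite rpredB // dvdz_mulr.
  by rewrite dvdzE abszM Euclid_dvdM // (negPf pd) orbF; apply/negP; move: pm; rewrite dvdzE.
have N0 : N%:~R != 0 :> rat.
  by rewrite intr_eq0; apply: contraNneq pN => ->.
have x0 : y + P * z != 0.
  by apply: contra N0 => /eqP x0; rewrite -NE x0 mul0r.
split=> //.
  by apply: pintD; [exists e => //; exists m | apply: pintM; [exact: pint_nat | exists d => //; exists n]].
exists `|N|%N => //; exists ((-1) ^+ (N < 0)%R * (d * e)%N%:Z).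
have -> : `|N|%N%:R = (-1) ^+ (N < 0)%R * N%:~R :> rat.
  by rewrite pmulrn abszE normrEsign rmorphM rmorphXn /= rmorphN1.
rewrite rmorphM rmorphXn /= rmorphN1 -NE -pmulrn; field.
exact: x0.
Qed.

Lemma eqmV n x y : (0 < n)%N -> punit y -> eqm n x y -> eqm n x^-1 y^-1.
Proof.
move=> n0 uy hxy; have ux := punit_eqm (eqm_weak n0 hxy) uy.
case: ux uy => x0 hx hxV [y0 hy hyV]; case: hxy => z hz E.
exists (- (z * x^-1 * y^-1)); first by apply/pintN/pintM => //; apply: pintM.
have -> : - (z * x^-1 * y^-1) = - z * x^-1 * y^-1 by ring.
rewrite !mulrA; have -> : P ^+ n * - z = y - x by rewrite E; ring.
by field; rewrite x0 y0.
Qed.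

Lemma eqm_cancel n c x y : punit c -> eqm n (c * x) (c * y) -> eqm n x y.
Proof.
case=> c0 hc hcV h; rewrite -[x](mulKf c0) -[y](mulKf c0); exact: eqm_mull.
Qed.

Lemma punit_range n : (0 < n < p)%N -> punit n%:R.
Proof. by case/andP=> n0 np; apply/punit_nat; rewrite gtnNdvd. Qed.

End PAdicCongruence.

(** * Harmonic sums *)

Definition harm (r n : nat) : rat := \sum_(1 <= k < n.+1) k%:R ^- r.

Lemma harm0 r : harm r 0 = 0. Proof. by rewrite /harm big_geq. Qed.

Lemma harmS r n : harm r n.+1 = harm r n + n.+1%:R ^- r.
Proof. by rewrite /harm big_nat_recr. Qed.

(** * Denominators with prime factors 2 and 3 *)

Section SmoothNumbers.
Variables (p : nat) (p_pr : prime p) (p_gt3 : (3 < p)%N).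
Local Notation pint := (pint p).
Local Notation punit := (punit p).

(** The numerals in the denominators of the proof are products of powers of 2 and 3. Phrased with
    [primes], the condition on a numeral is settled by computation. *)
Lemma ndvd_smooth n : (0 < n)%N -> all (fun q => q <= 3)%N (primes n) -> ~~ (p %| n)%N.
Proof.
move=> n0 h; apply/negP => pn; have := allP h p.
by rewrite mem_primes p_pr n0 pn leqNgt p_gt3 => /(_ isT).
Qed.

Lemma punit_smooth n : (0 < n)%N -> all (fun q => q <= 3)%N (primes n) -> punit n%:R.
Proof. by move=> n0 h; apply/punit_nat/ndvd_smooth. Qed.

Lemma pint_smoothV n : (0 < n)%N -> all (fun q => q <= 3)%N (primes n) -> pint n%:R^-1.
Proof. by move=> n0 h; apply/punitV_pint/punit_smooth. Qed.

End SmoothNumbers.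

(** Syntax-directed integrality. Context facts are compared by [constr_eq]; an inverse that is not
    that of a numeral with prime factors 2 and 3, or a power of one, has to be in the context. *)
Ltac solve_pint := repeat match goal with
  | hx : pint ?p ?y |- pint ?p ?x => constr_eq x y; exact hx
  | p_pr : is_true (prime ?p) |- pint ?p ?x =>
    lazymatch x with
    | _ + _ => apply: (pintD p_pr)
    | - _ => apply: (pintN p_pr)
    | _ * _ => apply: (pintM p_pr)
    | _ ^+ _ => apply: (pintX p_pr)
    | 0 => exact: (pint0 p_pr)
    | 1 => exact: (pint1 p_pr)
    | _%:R => exact: (pint_nat p_pr)
    | _%:~R => exact: (pint_int p_pr)
    | (_ ^+ _)^-1 => rewrite -exprVn
    | _%:R^-1 => match goal with p_gt3 : is_true (3 < p)%N |- _ => by apply: (pint_smoothV p_pr p_gt3) end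
    end
  end.

(** * Truncated exponentials modulo [p ^ 3] *)

Section TruncatedExponential.
Variables (p : nat) (p_pr : prime p) (p_gt3 : (3 < p)%N).
Local Notation P := (p%:R : rat).
Local Notation pint := (pint p).
Local Notation punit := (punit p).
Local Notation eqm := (eqm p).

(* [texp u v] is [exp (p u + p^2 v)] up to the terms in [p^3]. *)
Definition texp (u v : rat) : rat := 1 + P * u + P ^+ 2 * (u ^+ 2 / 2 + v).

Lemma pint_texp u v : pint u -> pint v -> pint (texp u v).
Proof. by move=> hu hv; rewrite /texp; solve_pint. Qed.

Lemma texpM u v u' v' : pint u -> pint v -> pint u' -> pint v' ->
  eqm 3 (texp u v * texp u' v') (texp (u + u') (v + v')).
Proof.
move=> hu hv hu' hv'; rewrite /texp.
exists (u * (u' ^+ 2 / 2 + v') + u' * (u ^+ 2 / 2 + v)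
  + P * (u ^+ 2 / 2 + v) * (u' ^+ 2 / 2 + v')); first by solve_pint.
by field.
Qed.

Lemma texp_eq u v u' v' : pint u' -> eqm 2 u u' -> eqm 1 v v' ->
  eqm 3 (texp u v) (texp u' v').
Proof.
move=> hu' [x hx ->] [y hy ->]; rewrite /texp.
exists (x + u' * P * x + P ^+ 3 * x ^+ 2 / 2 + y); first by solve_pint.
by field.
Qed.

(** The two slots overlap, since p (p w) = p^2 w. Harmonic congruences produce such corrections in
    [u]; moving them to [v] restores a normal form. *)
Lemma texp_shift u v w : pint u -> pint w -> eqm 3 (texp (u + P * w) v) (texp u (v + w)).
Proof.
move=> hu hw; exists (u * w + P * w ^+ 2 / 2); first by solve_pint.
by rewrite /texp; field.
Qed.

Lemma texp0 : texp 0 0 = 1.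
Proof. by rewrite /texp; field. Qed.

Lemma punit_texp u v : pint u -> pint v -> punit (texp u v).
Proof.
move=> hu hv; apply: (punit_eqm p_pr _ (punit1 p_pr)).
exists (u + P * (u ^+ 2 / 2 + v)); first by solve_pint.
by rewrite /texp; ring.
Qed.

Lemma texpV u v : pint u -> pint v -> eqm 3 (texp u v)^-1 (texp (- u) (- v)).
Proof.
move=> hu hv; have U := punit_texp hu hv.
apply: (eqm_cancel p_pr U); rewrite divff ?(punit_neq0 U) //.
apply: eqm_sym => //; have := texpM hu hv (pintN p_pr hu) (pintN p_pr hv).
by rewrite !subrr texp0.
Qed.

Lemma texpX u v k : pint u -> pint v -> eqm 3 (texp u v ^+ k) (texp (k%:R * u) (k%:R * v)).
Proof.
move=> hu hv; elim: k => [|k IHk].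
  by rewrite !mul0r texp0; exact: eqm_refl.
rewrite exprS; apply: (eqm_trans p_pr (eqm_mull p_pr _ IHk)); first exact: pint_texp.
have E w : k.+1%:R * w = w + k%:R * w :> rat by ring.
by rewrite !E; apply: texpM; solve_pint.
Qed.

(** Up to p^3, log (1 + p F) = p F - p^2 F^2 / 2, so the first two power sums fill the two slots. *)
Lemma texp_prod (I : Type) (r : seq I) (F : I -> rat) : (forall i, pint (F i)) ->
  eqm 3 (\prod_(i <- r) (1 + P * F i))
        (texp (\sum_(i <- r) F i) (- (\sum_(i <- r) F i ^+ 2) / 2)).
Proof.
move=> hF; elim: r => [|i r IHr].
  by rewrite !big_nil oppr0 mul0r texp0; exact: eqm_refl.
rewrite !big_cons.
have hs : pint (\sum_(j <- r) F j) by apply: pint_sum.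
have hs2 : pint (\sum_(j <- r) F j ^+ 2) by apply: pint_sum => // j _; apply: pintX.
have hi := hF i.
apply: (eqm_trans p_pr (eqm_mull p_pr _ IHr)); first by solve_pint.
have -> : 1 + P * F i = texp (F i) (- (F i ^+ 2) / 2) by rewrite /texp; field.
have E a b : - (a + b) / 2 = - a / 2 + - b / 2 :> rat by ring.
by rewrite E; apply: texpM; solve_pint.
Qed.

Lemma pint_harm r n : (n < p)%N -> pint (harm r n).
Proof.
move=> np; rewrite /harm big_nat_cond; apply: pint_sum => // k; rewrite andbT => /andP[k0 kn].
rewrite -exprVn; apply: pintX => //; apply/punitV_pint/punit_range => //.
by rewrite k0 (leq_trans kn).
Qed.

Lemma punit_fact n : (n < p)%N -> punit n`!%:R.
Proof.
move=> np; apply: punit_nat => //; elim: n np => [|n IHn] np; first by apply: ndvd_smooth.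
by rewrite factS Euclid_dvdM // negb_or IHn 1?ltnW // gtnNdvd.
Qed.

Lemma prod_shift_fact x n : (n < p)%N -> pint x ->
  eqm 3 (\prod_(1 <= i < n.+1) (i%:R + P * x))
        (n`!%:R * texp (x * harm 1 n) (- (x ^+ 2 / 2) * harm 2 n)).
Proof.
(* The default 0 makes [F] integral at every index, as [texp_prod] asks. *)
move=> np hx; pose F i := if (0 < i < p)%N then x / i%:R else 0.
have hF i : pint (F i).
  rewrite /F; case: ifP => hi; last exact: pint0.
  by apply: (pintM p_pr) => //; apply/punitV_pint/punit_range.
have := texp_prod (index_iota 1 n.+1) hF.
have E r : (0 < r)%N -> \sum_(1 <= i < n.+1) F i ^+ r = x ^+ r * harm r n.
  move=> r0; rewrite /harm big_distrr; apply: eq_big_nat => i /andP[i0 lin].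
  by rewrite /F i0 (leq_trans lin) // expr_div_n.
have -> : \sum_(1 <= i < n.+1) F i = x * harm 1 n.
  by rewrite -[x]expr1 -E //; apply: eq_bigr => i _; rewrite expr1.
rewrite E // => h.
have -> : \prod_(1 <= i < n.+1) (i%:R + P * x)
   = n`!%:R * \prod_(1 <= i < n.+1) (1 + P * F i).
  rewrite fact_prod natr_prod -big_split; apply: eq_big_nat => i /andP[i0 lin].
  have iN : i%:R != 0 :> rat by rewrite pnatr_eq0 -lt0n.
  by rewrite /F i0 (leq_trans lin) //=; field.
apply: (eqm_mull p_pr); first exact: pint_nat.
by have -> : - (x ^+ 2 / 2) * harm 2 n = - (x ^+ 2 * harm 2 n) / 2 by ring.
Qed.

End TruncatedExponential.

(** * Big operators split by residue class or reversed *)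

Section BigClasses.
Variables (R : Type) (idx : R) (op : Monoid.com_law idx).
Local Notation "*%M" := op.
Local Notation "x * y" := (op x y).

Lemma big_even_odd (f : nat -> R) l :
  \big[*%M/idx]_(1 <= i < (2 * l).+1) f i =
  (\big[*%M/idx]_(1 <= i < l.+1) f (2 * i)%N) * \big[*%M/idx]_(0 <= i < l) f (2 * i).+1.
Proof.
elim: l => [|l IHl]; first by rewrite !big_geq // Monoid.mul1m.
have -> : (2 * l.+1)%N = (2 * l).+2 by lia.
rewrite big_nat_recr //= big_nat_recr //= IHl (@big_nat_recr _ _ _ l.+1) //= (@big_nat_recr _ _ _ l 0) //=.
have -> : (2 * l.+1)%N = (2 * l).+2 by lia.
rewrite Monoid.mulmA [LHS]Monoid.mulmAC; congr (_ * _); exact: Monoid.mulmAC.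
Qed.

(** The range ends at 3k + 1, which is p - 1 for p = 3k + 2, the case where classes modulo 3 are
    used. *)
Lemma big_mod3 (f : nat -> R) k :
  \big[*%M/idx]_(1 <= i < (3 * k).+2) f i =
  (\big[*%M/idx]_(1 <= i < k.+1) f (3 * i)%N) *
  ((\big[*%M/idx]_(0 <= i < k) f (3 * i).+2) * \big[*%M/idx]_(0 <= i < k.+1) f (3 * i).+1).
Proof.
elim: k => [|k IHk]; first by rewrite !big_nat1 !big_geq // !Monoid.mul1m.
have -> : (3 * k.+1)%N = (3 * k).+3 by lia.
have E : \big[*%M/idx]_(1 <= i < (3 * k).+3.+2) f i =
    (\big[*%M/idx]_(1 <= i < (3 * k).+2) f i) * f (3 * k).+2 * f (3 * k).+3 * f (3 * k).+4.
  by rewrite big_nat_recr //= big_nat_recr //= big_nat_recr.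
rewrite E IHk; set O := \big[_/_]_(0 <= i < k.+1) f (3 * i).+1.
rewrite (@big_nat_recr _ _ _ k.+1 1) //= (@big_nat_recr _ _ _ k 0) //=.
rewrite (@big_nat_recr _ _ _ k.+1 0) //= -/O.
have -> : (3 * k.+1)%N = (3 * k).+3 by lia.
rewrite !Monoid.mulmA; congr (_ * _); rewrite [LHS]Monoid.mulmAC [RHS]Monoid.mulmAC.
congr (_ * _); rewrite [LHS]Monoid.mulmAC; congr (_ * _); exact: Monoid.mulmAC.
Qed.

(** Prepares the reflection i -> p - i: a range is indexed by the distance from its end. *)
Lemma big_reflect (f : nat -> R) (a n : nat) :
  \big[*%M/idx]_(0 <= i < n) f (a + i)%N = \big[*%M/idx]_(1 <= j < n.+1) f (a + n - j)%N.
Proof.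
rewrite big_nat_rev big_add1 /= add0n !big_mkord; apply: eq_bigr => i _.
by congr f; have := ltn_ord i; lia.
Qed.

End BigClasses.

(** * Harmonic sums up to p/2, p/3, p/6 and the powers 2^(p-1), 3^(p-1) *)

Section HarmonicCongruences.
Variables (p : nat) (p_pr : prime p) (p_gt3 : (3 < p)%N).
Local Notation P := (p%:R : rat).
Local Notation pint := (pint p).
Local Notation eqm := (eqm p).

Lemma eqm_sum_nat n a b (F G : nat -> rat) :
  (forall i, (a <= i < b)%N -> eqm n (F i) (G i)) ->
  eqm n (\sum_(a <= i < b) F i) (\sum_(a <= i < b) G i).
Proof.
by move=> h; rewrite big_nat_cond [X in eqm n _ X]big_nat_cond; apply: eqm_sum => // i; rewrite andbT => /h.
Qed.

Lemma reflect_inv i : (0 < i < p)%N ->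
  eqm 2 ((p - i)%:R ^- 1) (- i%:R ^- 1 - P * i%:R ^- 2).
Proof.
move=> hi; have [i0 _ hiV] := punit_range p_pr hi.
have hpi : (0 < p - i < p)%N by lia.
have [j0 _ hjV] := punit_range p_pr hpi.
have E : (p - i)%:R = P - i%:R :> rat by rewrite natrB //; lia.
exists (i%:R ^- 2 * (p - i)%:R^-1); first by rewrite -exprVn; solve_pint.
by rewrite E in j0 *; field; rewrite i0 j0.
Qed.

Lemma reflect_inv2 i : (0 < i < p)%N -> eqm 1 ((p - i)%:R ^- 2) (i%:R ^- 2).
Proof.
move=> hi; have [i0 hI hiV] := punit_range p_pr hi.
rewrite -!exprVn -[X in eqm 1 _ X]sqrrN.
apply: eqmX => //; first by solve_pint.
apply: (eqm_trans p_pr (eqm_weak p_pr _ (reflect_inv hi))) => //.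
exists (- i%:R ^- 2); first by rewrite -exprVn; solve_pint.
by rewrite !expr1; ring.
Qed.

Lemma natrMVn (c i r : nat) : (c * i)%:R ^- r = c%:R ^- r * i%:R ^- r :> rat.
Proof. by rewrite natrM exprMn invfM. Qed.

Lemma harm_scale (r c n : nat) :
  \sum_(1 <= i < n.+1) (c * i)%:R ^- r = c%:R ^- r * harm r n :> rat.
Proof. by rewrite /harm big_distrr; apply: eq_bigr => i _ /=; rewrite natrMVn. Qed.

Lemma eqm_double0 n x : eqm n (2 * x) 0 -> eqm n x 0.
Proof.
move=> hx; apply: (eqm_cancel p_pr (punit_smooth p_pr p_gt3 (n := 2) isT isT)).
by rewrite mulr0.
Qed.

Variable h : nat.
Hypothesis pE : p = (2 * h).+1.

Lemma harm2_full_half : eqm 1 (harm 2 (2 * h)) (2 * harm 2 h).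
Proof.
have -> : harm 2 (2 * h) = harm 2 h + \sum_(0 <= i < h) (h.+1 + i)%:R ^- 2.
  rewrite /harm (big_cat_nat (n := h.+1)) //=; last by lia.
  congr (_ + _); rewrite -[X in \sum_(X <= _ < _) _]addn0 (_ : (2 * h).+1 = h + h.+1)%N; last by lia.
  rewrite addnC big_addn addnK; apply: eq_bigr => i _; congr (_%:R ^- _); lia.
rewrite mulr_natl mulr2n; apply: eqmD => //; first exact: eqm_refl.
rewrite (big_reflect _ (fun i => i%:R ^- 2)).
apply: eqm_sum_nat => i hi; rewrite (_ : (h.+1 + h - i = p - i)%N); last by lia.
by apply: reflect_inv2; lia.
Qed.

(** The sum of inverse squares up to p - 1 is evaluated twice: by halves it is twice [harm 2 h]; by
    parity, with the odd numbers written p - 2i, it is half of it. The difference carries the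
    invertible factor 3/2. *)
Lemma harm2_half : eqm 1 (harm 2 h) 0.
Proof.
have E : eqm 1 (harm 2 (2 * h)) (harm 2 h / 2).
  rewrite {1}/harm big_even_odd /= harm_scale.
  have -> : harm 2 h / 2 = 2 ^- 2 * harm 2 h + 2 ^- 2 * harm 2 h by field.
  apply: eqmD => //; first exact: eqm_refl.
  rewrite -harm_scale (big_reflect _ (fun i => (2 * i).+1%:R ^- 2) 0).
  apply: eqm_sum_nat => i hi; rewrite (_ : ((2 * (0 + h - i)).+1 = p - 2 * i)%N); last by lia.
  by apply: reflect_inv2; lia.
have := eqm_trans p_pr (eqm_sym p_pr harm2_full_half) E.
move=> /(eqmB p_pr)/(_ (eqm_refl p_pr 1 (harm 2 h / 2))); rewrite subrr.
have -> : 2 * harm 2 h - harm 2 h / 2 = 3 / 2 * harm 2 h by field.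
move=> H; apply: (eqm_cancel p_pr (c := 3 / 2)); last by rewrite mulr0.
by apply: punitM => //; [|apply: punitV => //]; apply: (punit_smooth p_pr p_gt3 (n := _)).
Qed.

Lemma harm2_full : eqm 1 (harm 2 (2 * h)) 0.
Proof.
apply: (eqm_trans p_pr harm2_full_half); rewrite -[X in eqm 1 _ X](mulr0 2).
by apply: (eqm_mull p_pr _ harm2_half); solve_pint.
Qed.

(** Wolstenholme: by the reflection i -> p - i, twice the sum is -p [harm 2 (2 * h)], and that sum
    is 0 modulo [p]. *)
Lemma harm1_full : eqm 2 (harm 1 (2 * h)) 0.
Proof.
apply: eqm_double0.
have R : eqm 2 (harm 1 (2 * h)) (- harm 1 (2 * h) - P * harm 2 (2 * h)).
  have -> : - harm 1 (2 * h) - P * harm 2 (2 * h) =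
      \sum_(1 <= i < (2 * h).+1) (- i%:R ^- 1 - P * i%:R ^- 2).
    by rewrite /harm big_split /= -!sumrN big_distrr /= -sumrN.
  rewrite {1}/harm big_add1 /= (eq_bigr (fun i => (1 + i)%:R ^- 1)); last by move=> i _; rewrite add1n.
  rewrite (big_reflect _ (fun i => i%:R ^- 1) 1).
  apply: eqm_sum_nat => i hi; rewrite (_ : (1 + 2 * h - i = p - i)%N); last by lia.
  by apply: reflect_inv; lia.
have := eqmD p_pr R (eqm_refl p_pr 2 (harm 1 (2 * h))).
have -> : harm 1 (2 * h) + harm 1 (2 * h) = 2 * harm 1 (2 * h) by ring.
move/(eqm_trans p_pr); apply.
have -> : - harm 1 (2 * h) - P * harm 2 (2 * h) + harm 1 (2 * h) = - (P ^+ 1 * harm 2 (2 * h)).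
  by ring.
by rewrite -oppr0 -[X in eqm 2 _ (- X)](mulr0 (P ^+ 1)); apply/eqmN/(eqm_mulp 1 harm2_full).
Qed.

(* The odd numbers up to [k] are the [p - 2 j] with [k < j <= h]. *)
Lemma sum_split_reflect (f : nat -> rat) (k l : nat) :
  (k + (k - l) = h)%N -> (k = 2 * l \/ k = (2 * l).+1)%N ->
  \sum_(1 <= i < k.+1) f i =
  \sum_(1 <= i < l.+1) f (2 * i)%N + \sum_(k.+1 <= j < h.+1) f (p - 2 * j)%N.
Proof.
move=> hE hk; pose c := (k - l)%N.
have -> : \sum_(k.+1 <= j < h.+1) f (p - 2 * j)%N = \sum_(0 <= i < c) f (2 * i).+1.
  rewrite (_ : h.+1 = c + k.+1)%N; last by lia.
  rewrite -[X in \sum_(X <= _ < _) _]add0n big_addn addnK.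
  rewrite big_nat_rev /= add0n; apply: eq_big_nat => i hi; congr f; lia.
case: hk => hk; first by rewrite hk big_even_odd (_ : c = l) //; lia.
rewrite hk (_ : c = l.+1); last by lia.
by rewrite big_nat_recr //= big_even_odd -addrA -big_nat_recr.
Qed.

Lemma texp_divide x u v u' v' : pint x -> pint u -> pint v -> pint u' -> pint v' ->
  eqm 3 (x * texp p u v) (texp p u' v') -> eqm 3 x (texp p (u' - u) (v' - v)).
Proof.
move=> hx hu hv hu' hv' H; have U := punit_texp p_pr p_gt3 hu hv.
apply: (eqm_cancel p_pr U); rewrite mulrC.
apply: (eqm_trans p_pr H); apply: eqm_sym => //.
have := texpM p_pr p_gt3 hu hv (pintB p_pr hu' hu) (pintB p_pr hv' hv).
by rewrite [u + _]addrC [v + _]addrC !subrK.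
Qed.

Lemma prod_scale (c : rat) n (F : nat -> rat) :
  \prod_(1 <= i < n.+1) (c * F i) = c ^+ n * \prod_(1 <= i < n.+1) F i.
Proof. by rewrite big_split /= prodr_const_nat subn1. Qed.

Lemma fact_reflect :
  (2 * h)`!%:R = h`!%:R * ((-1) ^+ h * \prod_(1 <= i < h.+1) (i%:R + P * (- 1))) :> rat.
Proof.
rewrite !fact_prod (big_cat_nat (n := h.+1)) //=; last by lia.
rewrite natrM; congr (_ * _); rewrite natr_prod -prod_scale.
rewrite -[X in \prod_(X <= _ < _) _]addn0 (_ : (2 * h).+1 = h + h.+1)%N; last by lia.
rewrite addnC big_addn addnK (eq_bigr (fun i => (h.+1 + i)%:R)); last by move=> i _; rewrite addnC.
rewrite (big_reflect _ (fun i => i%:R)); apply: eq_big_nat => i hi.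
rewrite (_ : (h.+1 + h - i = p - i)%N) ?natrB; [by ring | lia | lia].
Qed.

(** (p - 1)! is factored by halves, the upper half being the p - i, and by parity, the odd factors
    being the p - 2i. Comparison gives the exact identity [2 ^+ (2 * h) * A = B], to which product
    expansion applies. *)
Lemma pow2_texp : eqm 3 (2 ^+ (2 * h)) (texp p (- harm 1 h / 2) 0).
Proof.
have hp : (h < p)%N by lia.
have h1 := pint_harm p_pr 1 hp; have h2 := pint_harm p_pr 2 hp.
have hf := punit_fact p_pr p_gt3 hp.
pose A := \prod_(1 <= i < h.+1) (i%:R + P * (- 2^-1)).
pose B := \prod_(1 <= i < h.+1) (i%:R + P * (- 1)).
have E1 : (2 * h)`!%:R = h`!%:R * ((-1) ^+ h * B) := fact_reflect.
have E2 : (2 * h)`!%:R = h`!%:R * ((-1) ^+ h * (2 ^+ (2 * h) * A)) :> rat.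
  have -> : h`!%:R * ((-1) ^+ h * (2 ^+ (2 * h) * A)) = (2 ^+ h * h`!%:R) * ((- 2) ^+ h * A) :> rat.
    have -> : (- 2) ^+ h = (-1) ^+ h * 2 ^+ h :> rat by rewrite -exprMn mulN1r.
    by rewrite mul2n -addnn exprD; ring.
  rewrite !fact_prod !natr_prod -!prod_scale big_even_odd /=; congr (_ * _).
    by apply: eq_bigr => i _; rewrite natrM.
  rewrite (big_reflect _ (fun i => (2 * i).+1%:R) 0); apply: eq_big_nat => i hi.
  rewrite (_ : ((2 * (0 + h - i)).+1 = p - 2 * i)%N) ?natrB ?natrM; [by field | lia | lia].
have E : 2 ^+ (2 * h) * A = B.
  have s0 : (-1) ^+ h != 0 :> rat by rewrite signr_eq0.
  by apply: (mulfI s0); apply: (mulfI (punit_neq0 hf)); rewrite -E1 -E2.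
have pa : pint (- 2^-1) by solve_pint.
have pb : pint (- 1) by solve_pint.
have HA := prod_shift_fact p_pr p_gt3 hp pa; have HB := prod_shift_fact p_pr p_gt3 hp pb.
have p2 : pint (2 ^+ (2 * h)) by solve_pint.
have H : eqm 3 (2 ^+ (2 * h) * texp p (- 2^-1 * harm 1 h) (- ((- 2^-1) ^+ 2 / 2) * harm 2 h))
               (texp p (- 1 * harm 1 h) (- ((- 1) ^+ 2 / 2) * harm 2 h)).
  apply: (eqm_cancel p_pr hf); rewrite mulrCA.
  by apply: (eqm_trans p_pr (eqm_mull p_pr p2 (eqm_sym p_pr HA))); rewrite -/A E.
have {}H := texp_divide p2 _ _ _ _ H.
apply: (eqm_trans p_pr (H _ _ _ _)); try solve_pint.
apply: (texp_eq p_pr p_gt3); first by solve_pint.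
  by rewrite (_ : _ - _ = - harm 1 h / 2); [exact: eqm_refl | field].
rewrite (_ : _ - _ = - (3 / 8) * harm 2 h); last by field.
by rewrite -[X in eqm 1 _ X](mulr0 (- (3 / 8))); apply: (eqm_mull p_pr _ harm2_half); solve_pint.
Qed.

(** The same method with 3, for p = 3k + 2: (p - 1)! by classes modulo 3 is compared with the
    product of all 3i, 0 < i < p, cut after k and after 2k + 1. *)
Lemma pow3_texp k : (2 * h = (3 * k).+1)%N ->
  eqm 3 (3 ^+ (2 * h)) (texp p (- (2 / 3) * harm 1 k) (- (2 / 9) * harm 2 k)).
Proof.
move=> hk3; have kp : (k < p)%N by lia.
have h1 := pint_harm p_pr 1 kp; have h2 := pint_harm p_pr 2 kp.
have kf := punit_fact p_pr p_gt3 kp.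
have n0 i : (0 < i)%N -> i%:R != 0 :> rat by move=> ?; rewrite pnatr_eq0; lia.
pose A := \prod_(1 <= i < k.+1) (i%:R + P * (- 3^-1)).
pose B := \prod_(1 <= i < k.+1) (i%:R + P * (- 1)).
pose G j := if (j < k.+1)%N then (3 * j).+1%:R^-1 : rat else 0.
pose C := \prod_(0 <= j < k.+1) (1 + P * G j).
have GE j : (j < k.+1)%N -> G j = (3 * j).+1%:R^-1 by rewrite /G => ->.
have pG j : pint (G j).
  rewrite /G; case: ifP => hl; last exact: pint0.
  by apply/punitV_pint/punit_range => //; lia.
have E1 : (2 * h)`!%:R = \prod_(1 <= i < k.+1) (3 * i)%:R * ((- 3) ^+ k * A
      * \prod_(0 <= j < k.+1) (3 * j).+1%:R) :> rat.
  rewrite fact_prod natr_prod hk3 big_mod3 /=; congr (_ * (_ * _)).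
  rewrite (eq_bigr (fun j => (2 + 3 * j)%:R)); last by move=> j _.
  rewrite -prod_scale (big_reflect _ (fun j => (2 + 3 * j)%:R) 0); apply: eq_big_nat => i hi.
  rewrite (_ : (2 + 3 * (0 + k - i) = p - 3 * i)%N) ?natrB ?natrM; [by field | lia | lia].
(* The upper third consists of the 3 (p - i); the middle third of 3 (k + 1 + j) = p + (3j + 1),
   whence [C]. *)
have E2 : 3 ^+ (2 * h) * (2 * h)`!%:R = \prod_(1 <= i < k.+1) (3 * i)%:R * ((- 3) ^+ k * B
      * (C * \prod_(0 <= j < k.+1) (3 * j).+1%:R)) :> rat.
  rewrite fact_prod natr_prod -prod_scale hk3 (eq_bigr (fun i => (3 * i)%:R)); last first.
    by move=> i _; rewrite natrM.
  rewrite (big_cat_nat (n := k.+1)) //=; last by lia.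
  rewrite (big_cat_nat (m := k.+1) (n := (2 * k).+2)) /=; [ | lia | lia].
  congr (_ * _); rewrite mulrC; congr (_ * _).
    rewrite -prod_scale -[X in \prod_(X <= _ < _) _]add0n (_ : (3 * k).+2 = k + (2 * k).+2)%N; last by lia.
    rewrite big_addn addnK (eq_bigr (fun i => (3 * ((2 * k).+2 + i))%:R)); last first.
      by move=> i _; rewrite addnC.
    rewrite (big_reflect _ (fun i => (3 * i)%:R)); apply: eq_big_nat => i hi.
    rewrite (_ : ((2 * k).+2 + k - i = p - i)%N) ?natrM ?natrB; [by ring | lia | lia].
  rewrite -big_split /= -[X in \prod_(X <= _ < _) _]add0n (_ : (2 * k).+2 = k.+1 + k.+1)%N; last by lia.
  rewrite big_addn addnK; apply: eq_big_nat => i hi.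
  rewrite GE // mulrDl mul1r divfK ?n0 // -natrD; congr _%:R; lia.
have T0 : \prod_(1 <= i < k.+1) (3 * i)%:R != 0 :> rat.
  by rewrite big_nat_cond prodf_seq_neq0; apply/allP => i _; apply/implyP; rewrite andbT => hi; apply: n0; lia.
have O0 : \prod_(0 <= j < k.+1) (3 * j).+1%:R != 0 :> rat.
  by rewrite prodf_seq_neq0; apply/allP => i _; apply: n0.
have E : 3 ^+ (2 * h) * A = B * C.
  have s0 : (- 3) ^+ k != 0 :> rat by rewrite expf_neq0.
  apply: (mulfI T0); apply: (mulfI s0); apply: (mulIf O0).
  transitivity (3 ^+ (2 * h) * (2 * h)`!%:R : rat); last by rewrite E2; ring.
  by rewrite E1; ring.
have pa : pint (- 3^-1) by solve_pint.
have pb : pint (- 1) by solve_pint.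
have HA := prod_shift_fact p_pr p_gt3 kp pa; have HB := prod_shift_fact p_pr p_gt3 kp pb.
have HC := texp_prod p_pr p_gt3 (index_iota 0 k.+1) pG.
pose a1 := \sum_(0 <= j < k.+1) G j; pose a2 := \sum_(0 <= j < k.+1) G j ^+ 2.
have pa1 : pint a1 by apply: pint_sum.
have pa2 : pint a2 by apply: pint_sum => // i _; solve_pint.
have V r : harm r (2 * h) = 3 ^- r * harm r k + (\sum_(1 <= i < k.+1) (p - 3 * i)%:R ^- r
      + \sum_(0 <= j < k.+1) G j ^+ r).
  rewrite {1}/harm hk3 big_mod3 /= harm_scale; congr (_ + (_ + _)).
    rewrite (eq_bigr (fun j => (2 + 3 * j)%:R ^- r)); last by move=> j _.
    rewrite (big_reflect _ (fun j => (2 + 3 * j)%:R ^- r) 0); apply: eq_big_nat => i hi.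
    by congr (_%:R ^- _); lia.
  by apply: eq_big_nat => i hi; rewrite GE // exprVn.
have c3 : pint (3 ^- 2) by solve_pint.
(* The sums over the class 1 modulo 3 are what remains of the full sums up to p - 1, which vanish,
   once the other two classes are expressed by sums up to [k]. *)
have V1 : eqm 2 a1 (P / 9 * harm 2 k).
  have W : eqm 2 (\sum_(1 <= i < k.+1) (p - 3 * i)%:R ^- 1) (- (3^-1 * harm 1 k) - P * (3 ^- 2 * harm 2 k)).
    rewrite -[3^-1]expr1 -!exprVn !exprVn -!harm_scale big_distrr -!sumrN -big_split /=.
    by apply: eqm_sum_nat => i hi; apply: reflect_inv; lia.
  have := eqmD p_pr (eqmD p_pr (eqm_refl p_pr 2 (3 ^- 1 * harm 1 k)) (eqmD p_pr W (eqm_refl p_pr 2 a1)))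
    (eqm_refl p_pr 2 (P / 9 * harm 2 k)).
  have -> : 3 ^- 1 * harm 1 k + (- (3^-1 * harm 1 k) - P * (3 ^- 2 * harm 2 k) + a1) + P / 9 * harm 2 k = a1.
    by field.
  have -> : a1 = \sum_(0 <= j < k.+1) G j ^+ 1 by apply: eq_bigr => j _; rewrite expr1.
  rewrite -V => H; apply: (eqm_trans p_pr (eqm_sym p_pr H)).
  rewrite -[X in eqm 2 _ X]add0r; apply: eqmD => //; [exact: harm1_full | exact: eqm_refl].
have V2 : eqm 1 a2 (- (2 / 9) * harm 2 k).
  have W : eqm 1 (\sum_(1 <= i < k.+1) (p - 3 * i)%:R ^- 2) (3 ^- 2 * harm 2 k).
    rewrite -harm_scale.
    by apply: eqm_sum_nat => i hi; apply: reflect_inv2; lia.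
  have := eqmD p_pr (eqmD p_pr (eqm_refl p_pr 1 (3 ^- 2 * harm 2 k)) (eqmD p_pr W (eqm_refl p_pr 1 a2)))
    (eqm_refl p_pr 1 (- (2 / 9) * harm 2 k)).
  have -> : 3 ^- 2 * harm 2 k + (3 ^- 2 * harm 2 k + a2) + - (2 / 9) * harm 2 k = a2 by field.
  rewrite -V => H; apply: (eqm_trans p_pr (eqm_sym p_pr H)).
  rewrite -[X in eqm 1 _ X]add0r; apply: eqmD => //; [exact: harm2_full | exact: eqm_refl].
have p3 : pint (3 ^+ (2 * h)) by solve_pint.
have pC : pint C by apply: pint_prod => // i _; have := pG i => ?; solve_pint.
have H : eqm 3 (3 ^+ (2 * h) * texp p (- 3^-1 * harm 1 k) (- ((- 3^-1) ^+ 2 / 2) * harm 2 k))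
               (texp p (- 1 * harm 1 k) (- ((- 1) ^+ 2 / 2) * harm 2 k) * texp p a1 (- a2 / 2)).
  apply: (eqm_cancel p_pr kf); rewrite mulrCA.
  apply: (eqm_trans p_pr (eqm_mull p_pr p3 (eqm_sym p_pr HA))); rewrite -/A E mulrA.
  apply: eqmM => //; last by apply: (pint_texp p_pr p_gt3); solve_pint.
  by apply: pintM => //; [exact: pint_nat | apply: (pint_texp p_pr p_gt3); solve_pint].
have {}H := eqm_trans p_pr H (texpM p_pr p_gt3 _ _ pa1 _).
have {}H := texp_divide p3 _ _ _ _ (H _ _ _).
apply: (eqm_trans p_pr (H _ _ _ _ _ _ _)); try solve_pint.
set u := _ - _; set v := _ - _.
have -> : u = - (2 / 3) * harm 1 k + a1 by rewrite /u; field.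
have -> : v = - (4 / 9) * harm 2 k - a2 / 2 by rewrite /v; field.
(* [a1] is a first-slot term that is really of second order; after its transfer the coefficient is
   -4/9 + 1/9 + 1/9 = -2/9. *)
apply: (eqm_trans p_pr (y := texp p (- (2 / 3) * harm 1 k + P * (harm 2 k / 9)) (- (4 / 9) * harm 2 k + (harm 2 k / 9)))).
  apply: (texp_eq p_pr p_gt3); first by solve_pint.
    apply: eqmD => //; first exact: eqm_refl.
    by have -> : P * (harm 2 k / 9) = P / 9 * harm 2 k by field.
  apply: eqmD => //; first exact: eqm_refl.
  have -> : - (a2 / 2) = - 2^-1 * a2 by field.
  have -> : harm 2 k / 9 = - 2^-1 * (- (2 / 9) * harm 2 k) by field.
  by apply: (eqm_mull p_pr _ V2); solve_pint.
apply: (eqm_trans p_pr (texp_shift p_pr p_gt3 _ _ _)); try solve_pint.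
rewrite (_ : _ + _ + _ = - (2 / 9) * harm 2 k); [exact: eqm_refl | by field].
Qed.

Variables k l : nat.
Hypotheses (hE : (k + (k - l) = h)%N) (hk : (k = 2 * l \/ k = (2 * l).+1)%N).

Lemma harm_cut r : harm r h = harm r k + \sum_(k.+1 <= j < h.+1) j%:R ^- r.
Proof. by rewrite /harm (big_cat_nat (n := k.+1)) //=; lia. Qed.

(** The hypotheses make [h], [k], [l] the integer parts of p/2, p/3, p/6, covering both p = 6l + 1
    and p = 6l + 5. Split by parity and reflected, [harm 2 k] becomes a quarter of
    [harm 2 l + harm 2 h - harm 2 k], and [harm 2 h] vanishes. *)
Lemma harm2_sixth : eqm 1 (harm 2 l) (5 * harm 2 k).
Proof.
have R : eqm 1 (harm 2 k) (2 ^- 2 * harm 2 l + 2 ^- 2 * (harm 2 h - harm 2 k)).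
  rewrite {1}/harm (sum_split_reflect _ hE hk) harm_scale.
  apply: eqmD => //; first exact: eqm_refl.
  rewrite harm_cut addrAC subrr add0r big_distrr /=.
  apply: eqm_sum_nat => i hi.
  rewrite -natrMVn.
  by apply: reflect_inv2; lia.
have c4 : pint (2 ^- 2) by rewrite -exprVn; solve_pint.
have {}R := eqmB p_pr R (eqm_sym p_pr (eqm_mull p_pr c4 harm2_half)).
have := eqm_mull p_pr (pint_nat p_pr 4) R; rewrite mulr0 subr0.
have -> : 4 * (2 ^- 2 * harm 2 l + 2 ^- 2 * (harm 2 h - harm 2 k) - 2 ^- 2 * harm 2 h)
  = harm 2 l - harm 2 k by field.
move=> {}R; have := eqmD p_pr R (eqm_refl p_pr 1 (harm 2 k)).
have -> : 4 * harm 2 k + harm 2 k = 5 * harm 2 k by ring.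
by rewrite subrK; apply: eqm_sym.
Qed.

(** The same splitting to one more power of [p], where each reflected term has a correction in
    inverse squares; p [harm 2 h] vanishes modulo p^2, so only [harm 2 k] is left of it. *)
Lemma harm1_sixth : eqm 2 (harm 1 l) (harm 1 k + harm 1 h - P / 2 * harm 2 k).
Proof.
have kp : (k < p)%N by lia.
have hk2 := pint_harm p_pr 2 kp.
pose X := harm 1 h - harm 1 k; pose Y := harm 2 h - harm 2 k.
have R : eqm 2 (harm 1 k) (2^-1 * harm 1 l + (- (2^-1 * X) - P * (2 ^- 2 * Y))).
  rewrite {1}/harm (sum_split_reflect _ hE hk) harm_scale expr1.
  apply: eqmD => //; first exact: eqm_refl.
  rewrite /X /Y !harm_cut ![_ + _ - harm _ k]addrAC !subrr !add0r !big_distrr /= -!sumrN -big_split /=.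
  apply: eqm_sum_nat => i hi.
  have E r : 2 ^- r * i%:R ^- r = (2 * i)%:R ^- r :> rat by rewrite natrMVn.
  by have := @reflect_inv (2 * i); rewrite -!E expr1; apply; lia.
have Z : eqm 2 (P * harm 2 h) 0.
  by rewrite -[P]expr1 -(mulr0 (P ^+ 1)); apply: (eqm_mulp 1 harm2_half).
have c2 : pint 2^-1 by solve_pint.
have := eqmD p_pr (eqm_mull p_pr (pint_nat p_pr 2) R) (eqm_sym p_pr (eqm_mull p_pr c2 Z)).
rewrite mulr0 addr0.
have -> : 2 * (2^-1 * harm 1 l + (- (2^-1 * X) - P * (2 ^- 2 * Y))) + 2^-1 * (P * harm 2 h)
   = harm 1 l - X + P / 2 * harm 2 k by rewrite /Y; field.
move=> {}R; have := eqmD p_pr R (eqm_refl p_pr 2 (X - P / 2 * harm 2 k)).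
have -> : harm 1 l - X + P / 2 * harm 2 k + (X - P / 2 * harm 2 k) = harm 1 l by ring.
have -> : 2 * harm 1 k + (X - P / 2 * harm 2 k) = harm 1 k + harm 1 h - P / 2 * harm 2 k.
  by rewrite /X; ring.
exact: eqm_sym.
Qed.

End HarmonicCongruences.

(** * Truncated hypergeometric sums *)

Definition rising (x : rat) (n : nat) : rat := \prod_(0 <= i < n) (x + i%:R).

Lemma rising0 x : rising x 0 = 1. Proof. by rewrite /rising big_geq. Qed.

Lemma risingS x n : rising x n.+1 = rising x n * (x + n%:R).
Proof. by rewrite /rising big_nat_recr. Qed.

Lemma risingSl x n : rising x n.+1 = x * rising (x + 1) n.
Proof.
rewrite /rising big_nat_recl // addr0; congr (_ * _); apply: eq_bigr => i _.
by rewrite -addrA nat1r.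
Qed.

Lemma rising_add x m n : rising x (m + n) = rising x m * rising (x + m%:R) n.
Proof.
by elim: n => [|n IHn]; rewrite ?addn0 ?rising0 ?mulr1 // addnS !risingS IHn natrD; ring.
Qed.

Lemma factS_neq0 n : n`!%:R != 0 :> rat.
Proof. by rewrite pnatr_eq0 -lt0n fact_gt0. Qed.

Lemma natS_neq0 n : 1 + n%:R != 0 :> rat.
Proof. by rewrite nat1r pnatr_eq0. Qed.

(* The [k]-th term of 3F2(1/2, -a, a+1; 1, 1; 1). *)
Definition hterm (a : rat) (k : nat) : rat :=
  rising (1 / 2) k * rising (- a) k * rising (a + 1) k / k`!%:R ^+ 3.

Definition hsum (N : nat) (a : rat) : rat := \sum_(0 <= k < N) hterm a k.

Lemma hterm_sym a k : hterm (-1 - a) k = hterm a k.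
Proof.
rewrite /hterm (_ : - (-1 - a) = a + 1); last by ring.
by rewrite (_ : -1 - a + 1 = - a); ring.
Qed.

Lemma hsum_sym N a : hsum N (-1 - a) = hsum N a.
Proof. by apply: eq_bigr => k _; rewrite hterm_sym. Qed.

Lemma hsumS N a : hsum N.+1 a = hsum N a + hterm a N.
Proof. by rewrite /hsum big_nat_recr. Qed.

Lemma hterm0 a : hterm a 0 = 1.
Proof. by rewrite /hterm !rising0 fact0; field. Qed.

(** Contiguity relation for this 3F2, with the telescoped truncation error on the right. Its three
    rising factorials are the source of the three powers of [p]. *)
Lemma hsum_rec N a :
  (a + 1) ^+ 2 * hsum N.+1 (a + 1) - a ^+ 2 * hsum N.+1 (a - 1) =
  2 * (2 * a + 1) * rising (1 / 2) N.+1 * rising (- a) N * rising (a + 1) N / N`!%:R ^+ 3.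
Proof.
elim: N => [|N IHN].
  by rewrite !hsumS /hsum !big_geq // !hterm0 risingS !rising0 fact0; field.
rewrite ![hsum N.+2 _]hsumS !mulrDr opprD addrACA IHN.
(* Both new products are multiples of [rising (- a) N * rising (a + 1) N], which turns the induction
   step into a rational identity in [a] and [N]. *)
have E1 : rising (- (a + 1)) N.+1 * rising (a + 1 + 1) N.+1 =
    - (rising (- a) N * rising (a + 1) N * (a + 1 + N%:R) * (a + 2 + N%:R)).
  have -> : rising (- (a + 1)) N.+1 = - (a + 1) * rising (- a) N.
    by rewrite risingSl; congr (_ * rising _ _); ring.
  transitivity (- (rising (- a) N * rising (a + 1) N.+2)).
    by rewrite [rising _ N.+2]risingSl; ring.
  by rewrite !risingS -[in N.+1%:R]addn1 natrD; ring.
have E2 : rising (- (a - 1)) N.+1 * rising (a - 1 + 1) N.+1 =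
    - (rising (- a) N * rising (a + 1) N * (N%:R - a) * (N%:R + 1 - a)).
  have -> : rising (a - 1 + 1) N.+1 = a * rising (a + 1) N.
    by rewrite risingSl; congr (_ * rising _ _); ring.
  transitivity (- (rising (- a) N.+2 * rising (a + 1) N)).
    rewrite [rising _ N.+2]risingSl (_ : - a + 1 = - (a - 1)); ring.
  by rewrite !risingS -[in N.+1%:R]addn1 natrD; ring.
rewrite /hterm -![rising (1 / 2) N.+1 * _ * _]mulrA E1 E2.
rewrite [rising (1 / 2) N.+2]risingS ![rising _ N.+1]risingS factS natrM -[N.+1]addn1 natrD.
have f0 := factS_neq0 N; have s0 := natS_neq0 N; rewrite addrC in s0.
by field; rewrite f0 s0.
Qed.

Lemma hterm_third k : hterm (- (1 / 3)) k = rising (1 / 2) k * rising (1 / 3) k * rising (2 / 3) k / k`!%:R ^+ 3.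
Proof. by rewrite /hterm opprK (_ : - (1 / 3) + 1 = 2 / 3) //; field. Qed.

Lemma fact_double k : (2 * k)`!%:R = 4 ^+ k * k`!%:R * rising (1 / 2) k :> rat.
Proof.
elim: k => [|k IHk]; first by rewrite rising0.
rewrite (_ : 2 * k.+1 = (2 * k).+2)%N; last by lia.
rewrite !factS !natrM IHk risingS exprS -[(2 * k).+2]addn2 -[(2 * k).+1]addn1 -[k.+1]addn1 !natrD ?natrM.
by field.
Qed.

Lemma fact_triple k :
  (3 * k)`!%:R = 27 ^+ k * k`!%:R * rising (1 / 3) k * rising (2 / 3) k :> rat.
Proof.
elim: k => [|k IHk]; first by rewrite !rising0.
rewrite (_ : 3 * k.+1 = (3 * k).+3)%N; last by lia.
rewrite !factS !natrM IHk !risingS exprS -[(3 * k).+3]addn3 -[(3 * k).+2]addn2 -[(3 * k).+1]addn1 -[k.+1]addn1 !natrD ?natrM.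
by field.
Qed.

Lemma summandE k :
  'C(2 * k, k)%:R ^+ 2 * 'C(3 * k, k)%:R / 108 ^+ k = hterm (- (1 / 3)) k.
Proof.
have f0 := factS_neq0 k; have g0 := factS_neq0 (2 * k).
have B2 : 'C(2 * k, k)%:R = (2 * k)`!%:R / k`!%:R ^+ 2 :> rat.
  have le : (k <= 2 * k)%N by lia.
  have := congr1 (fun x => x%:R : rat) (bin_fact le).
  by rewrite (_ : 2 * k - k = k)%N ?natrM => [<-|]; [field | lia].
have B3 : 'C(3 * k, k)%:R = (3 * k)`!%:R / (k`!%:R * (2 * k)`!%:R) :> rat.
  have le : (k <= 3 * k)%N by lia.
  have := congr1 (fun x => x%:R : rat) (bin_fact le).
  by rewrite (_ : 3 * k - k = 2 * k)%N ?natrM => [<-|]; [field; rewrite f0 g0 | lia].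
rewrite B2 B3 hterm_third fact_triple fact_double (_ : 108 = 4 * 27) ?exprMn; last by ring.
have r0 : rising (1 / 2) k != 0.
  by apply/eqP => r0; case/eqP: g0; rewrite fact_double r0 mulr0.
have p4 : 4 ^+ k != 0 :> rat by rewrite expf_neq0.
have p27 : 27 ^+ k != 0 :> rat by rewrite expf_neq0.
by field; rewrite f0 r0 p4 p27.
Qed.

(** The value 1/3 enters as a neighbour of -1/3, because F (1/3) = F (-4/3). Divided by the new
    summand, the increment is a polynomial identity in [N]; its quartic terms cancel, and the four
    other coefficients determine 1/2, 115/8, 111/4 and 8. The case N = 0 gives 9. *)
Lemma shifted_sum_telescope N :
  \sum_(0 <= k < N) hterm (- (1 / 3)) k / (k + 1)%:R ^+ 3 =
  9 - hsum N.+1 (- (1 / 3)) / 2 - 115 / 8 * hsum N.+1 (1 / 3)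
    + (111 / 4 * (N%:R + 1 / 2) - 8) * hterm (- (1 / 3)) N.
Proof.
elim: N => [|N IHN].
  by rewrite big_geq // /hsum !big_nat1 !hterm0; field.
rewrite big_nat_recr //= IHN ![hsum N.+2 _]hsumS.
have E : hterm (1 / 3) N.+1 = - (rising (1 / 2) N.+1 * rising (1 / 3) N * rising (2 / 3) N
    * (1 / 3 + N%:R) * (4 / 3 + N%:R)) / N.+1`!%:R ^+ 3.
  rewrite /hterm (_ : rising (- (1 / 3)) N.+1 = - (1 / 3) * rising (2 / 3) N); last first.
    by rewrite risingSl; congr (_ * rising _ _); field.
  have E3 : 1 / 3 * rising (1 / 3 + 1) N.+1
      = rising (1 / 3) N * (1 / 3 + N%:R) * (4 / 3 + N%:R).
    by rewrite -risingSl !risingS -[N.+1]addn1 natrD; field.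
  transitivity (- (rising (1 / 2) N.+1 * rising (2 / 3) N
      * (1 / 3 * rising (1 / 3 + 1) N.+1)) / N.+1`!%:R ^+ 3); first by ring.
  by rewrite E3; ring.
rewrite E !hterm_third ![rising _ N.+1]risingS factS natrM -[N.+1]addn1 natrD.
have f0 := factS_neq0 N; have s0 := natS_neq0 N; rewrite addrC in s0.
by field; rewrite f0 s0.
Qed.

(** * Steps of the recursion modulo [p ^ 3] and expansion near 0 *)

Section HypergeometricCongruences.
Variables (p : nat) (p_pr : prime p) (p_gt3 : (3 < p)%N).
Local Notation P := (p%:R : rat).
Local Notation pint := (pint p).
Local Notation punit := (punit p).
Local Notation eqm := (eqm p).

Lemma pint_rising x n : pint x -> pint (rising x n).
Proof. by move=> hx; apply: pint_prod => // i _; solve_pint. Qed.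

Lemma eqm_rising k x y n : pint y -> eqm k x y -> eqm k (rising x n) (rising y n).
Proof.
move=> hy hxy; apply: eqm_prod => // i _; first by solve_pint.
by apply: eqmD => //; exact: eqm_refl.
Qed.

Lemma rising_eqm0 x i n : pint x -> eqm 1 (x + i%:R) 0 -> (i < n)%N -> eqm 1 (rising x n) 0.
Proof.
move=> hx [z hz E] lt_in; rewrite -(subnKC lt_in) rising_add risingS E.
have A := pint_rising i hx; have hy : pint (x + i.+1%:R) by solve_pint.
have B := pint_rising (n - i.+1) hy.
by exists (rising x i * z * rising (x + i.+1%:R) (n - i.+1)); [solve_pint | ring].
Qed.

Lemma eqm0_mul3 x y z : eqm 1 x 0 -> eqm 1 y 0 -> eqm 1 z 0 -> eqm 3 (x * y * z) 0.
Proof.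
case=> a ha -> [b hb ->] [c hc ->]; exists (a * b * c); first by solve_pint.
by ring.
Qed.

Lemma pint_hterm a k : pint a -> (k < p)%N -> pint (hterm a k).
Proof.
move=> ha kp; have [_ _ hf] := punit_fact p_pr p_gt3 kp.
have h1 : pint (1 / 2) by solve_pint.
have h2 : pint (- a) by solve_pint.
have h3 : pint (a + 1) by solve_pint.
have := pint_rising k h1; have := pint_rising k h2; have := pint_rising k h3.
by rewrite /hterm -exprVn => A B C; solve_pint.
Qed.

Lemma pint_hsum a : pint a -> pint (hsum p a).
Proof.
move=> ha; rewrite /hsum big_nat_cond; apply: pint_sum => // k; rewrite andbT => /andP[_ kp].
exact: pint_hterm.
Qed.

Variable h : nat.
Hypothesis pE : p = (2 * h).+1.

Lemma PE : P = 2 * h%:R + 1.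
Proof. by rewrite pE -addn1 natrD natrM. Qed.

Lemma half_eqm : eqm 1 (1 / 2 + h%:R) 0.
Proof. by exists (1 / 2); [solve_pint | rewrite PE; field]. Qed.

(** At N = p - 1 each rising factorial of the truncation error has a factor divisible by [p], at the
    indices h, i and p - 1 - i. The bounds on [i] keep the last two in range and [a + 1]
    invertible. *)
Lemma hsum_step a i : pint a -> eqm 1 a i%:R -> (0 < i <= p - 2)%N ->
  eqm 3 (hsum p (a + 1)) ((a / (a + 1)) ^+ 2 * hsum p (a - 1)).
Proof.
move=> ha hai hi.
have hp1 : (p.-1 < p)%N by lia.
have [_ _ hf] := punit_fact p_pr p_gt3 hp1.
have u : punit (a + 1).
  apply: (punit_eqm p_pr (y := i.+1%:R)); last by apply: punit_range => //; lia.
  by rewrite -[i.+1]addn1 natrD; apply: eqmD => //; exact: eqm_refl.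
have u2 : punit ((a + 1) ^+ 2) by exact: punitX.
apply: (eqm_cancel p_pr u2); rewrite expr_div_n mulrA mulrCA divff ?mulr1; last by case: u2.
have := hsum_rec p.-1 a; rewrite prednK ?prime_gt0 // => E.
have Z : eqm 3 ((a + 1) ^+ 2 * hsum p (a + 1) - a ^+ 2 * hsum p (a - 1)) 0.
  have h1 : pint (1 / 2) by solve_pint.
  have h2 : pint (- a) by solve_pint.
  have h3 : pint (a + 1) by solve_pint.
  have A : eqm 1 (rising (1 / 2) p) 0 by apply: (rising_eqm0 h1 half_eqm); lia.
  have B : eqm 1 (rising (- a) p.-1) 0.
    apply: (rising_eqm0 (i := i) h2); last by lia.
    by rewrite -(addNr i%:R); apply: eqmD => //; [apply: eqmN | exact: eqm_refl].
  have C : eqm 1 (rising (a + 1) p.-1) 0.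
    apply: (rising_eqm0 (i := (p - i.+1)%N) h3); last by lia.
    apply: (eqm_trans p_pr (y := i%:R + 1 + (p - i.+1)%:R)).
      by apply: eqmD => //; [apply: eqmD => // |]; exact: eqm_refl.
    rewrite natrB ?natr1; last by lia.
    by exists 1; [solve_pint | ring].
  have := eqm_mull p_pr (c := 2 * (2 * a + 1) * (p.-1)`!%:R^-1 ^+ 3) _ (eqm0_mul3 A B C).
  rewrite mulr0 E -exprVn.
  set x := rising _ _; set y := rising _ _; set z := rising _ _; set f := _^-1 => H.
  by rewrite (_ : _ * f ^+ 3 = 2 * (2 * a + 1) * f ^+ 3 * (x * y * z)); [apply: H; solve_pint | ring].
have := eqmD p_pr Z (eqm_refl p_pr 3 (a ^+ 2 * hsum p (a - 1))).
by rewrite subrK add0r.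
Qed.

Lemma hsum_steps y e j : pint y -> eqm 1 y e%:R -> (e + 2 * j < p)%N ->
  eqm 3 (hsum p (y + (2 * j)%:R))
   ((\prod_(1 <= i < j.+1) ((y + (2 * i)%:R - 1) / (y + (2 * i)%:R))) ^+ 2 * hsum p y).
Proof.
move=> hy hye; elim: j => [|j IHj] hj.
  by rewrite big_geq // expr1n mul1r muln0 addr0; exact: eqm_refl.
rewrite big_nat_recr //= exprMn.
pose a := y + (2 * j).+1%:R.
have ha : pint a by rewrite /a; solve_pint.
have E1 : y + (2 * j.+1)%:R = a + 1 by rewrite /a mulnS -[(2 * j).+1]addn1 !natrD; ring.
have E2 : a - 1 = y + (2 * j)%:R by rewrite /a -[(2 * j).+1]addn1 natrD; ring.
rewrite E1 addrK -mulrA mulrCA.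
have hai : eqm 1 a (e + (2 * j).+1)%:R.
  by rewrite /a (natrD _ e); apply: eqmD => //; exact: eqm_refl.
apply: (eqm_trans p_pr (hsum_step ha hai _)); first by lia.
have hu : punit (a + 1).
  apply: (punit_eqm p_pr (y := (e + (2 * j).+2)%:R)); last by apply: punit_range => //; lia.
  by rewrite addnS -natr1; apply: eqmD => //; exact: eqm_refl.
have huV := punitV_pint hu.
apply: (eqm_mull p_pr); first by solve_pint.
by rewrite E2; apply: IHj; lia.
Qed.

(** Removes the boundary term of the telescoped sum, so that only two truncated 3F2 values
    remain. *)
Lemma hterm_boundary : eqm 3 (hterm (- (1 / 3)) p.-1) 0.
Proof.
have h1 : pint (1 / 2) by solve_pint.
have h2 : pint (1 / 3) by solve_pint.
have h3 : pint (2 / 3) by solve_pint.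
have A : eqm 1 (rising (1 / 2) p.-1) 0 by apply: (rising_eqm0 h1 half_eqm); lia.
(* The vanishing factors 1/3 + i and 2/3 + i equal p/3 or 2p/3; which is which depends on [p] modulo
   3. *)
have D c i : (3 * i + c = p)%N -> (c%:R / 3 + i%:R = P / 3 :> rat).
  by move=> <-; rewrite natrD natrM; field.
have D2 c i : (3 * i + c = 2 * p)%N -> (c%:R / 3 + i%:R = P * (2 / 3) :> rat).
  by move=> E; rewrite (_ : c%:R = (2 * p)%:R - 3 * i%:R :> rat); [rewrite natrM; field | rewrite -E natrD natrM; ring].
have Z1 x : x = P / 3 -> eqm 1 x 0 by move=> ->; exists 3^-1; [solve_pint | field].
have Z2 x : x = P * (2 / 3) -> eqm 1 x 0 by move=> ->; exists (2 / 3); [solve_pint | field].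
have [B C] : eqm 1 (rising (1 / 3) p.-1) 0 /\ eqm 1 (rising (2 / 3) p.-1) 0.
  have np3 : (p %% 3 != 0)%N.
    have := ndvd_smooth (n := 3) p_pr p_gt3 isT isT; apply: contra => /eqP p3.
    by have := dvdn_prime2 (isT : prime 3) p_pr; rewrite /dvdn p3 eqxx => /esym/eqP <-.
  have [m [pm|pm]] : exists m, (p = 3 * m + 1 \/ p = 3 * m + 2)%N.
    by exists (p %/ 3)%N; have := divn_eq p 3; have := ltn_pmod p (isT : (0 < 3)%N); lia.
  - split; first by apply: (rising_eqm0 (i := m) h2); [apply: (Z1 _ (@D 1%N m _)) | ]; lia.
    by apply: (rising_eqm0 (i := (2 * m)%N) h3); [apply: (Z2 _ (@D2 2%N (2 * m)%N _)) | ]; lia.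
  - split; first by apply: (rising_eqm0 (i := (2 * m + 1)%N) h2); [apply: (Z2 _ (@D2 1%N (2 * m + 1)%N _)) | ]; lia.
    by apply: (rising_eqm0 (i := m) h3); [apply: (Z1 _ (@D 2%N m _)) | ]; lia.
have hp1 : (p.-1 < p)%N by lia.
have [_ _ hf] := punit_fact p_pr p_gt3 hp1.
have := eqm_mulr p_pr (c := (p.-1)`!%:R^-1 ^+ 3) _ (eqm0_mul3 A B C).
by rewrite mul0r hterm_third -exprVn; apply; solve_pint.
Qed.

Lemma hsum0 : hsum p 0 = 1.
Proof.
rewrite /hsum -(prednK (prime_gt0 p_pr)) big_nat_recl // hterm0 big1_seq ?addr0 // => i _.
by rewrite /hterm oppr0 [rising 0 _]risingSl mul0r mulr0 !mul0r.
Qed.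

Lemma shifted_sum_congr :
  eqm 3 (\sum_(0 <= k < p.-1) ('C(2 * k, k)%:R ^+ 2 * 'C(3 * k, k)%:R) / (108 ^+ k * (k + 1)%:R ^+ 3))
        (9 - hsum p (- (1 / 3)) / 2 - 115 / 8 * hsum p (1 / 3)).
Proof.
have -> : \sum_(0 <= k < p.-1) ('C(2 * k, k)%:R ^+ 2 * 'C(3 * k, k)%:R) / (108 ^+ k * (k + 1)%:R ^+ 3)
    = \sum_(0 <= k < p.-1) hterm (- (1 / 3)) k / (k + 1)%:R ^+ 3 :> rat.
  by apply: eq_bigr => k _; rewrite -summandE invfM mulrA.
rewrite shifted_sum_telescope prednK ?prime_gt0 // -[X in eqm 3 _ X]addr0.
apply: eqmD => //; first exact: eqm_refl.
rewrite -(mulr0 (111 / 4 * (p.-1%:R + 1 / 2) - 8)).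
by apply: (eqm_mull p_pr _ hterm_boundary); solve_pint.
Qed.

(** [sum1] and [sum2] are, up to sign, the coefficients of p t and p^2 t^2 in
    [hsum p (- (P * t))]. *)
Definition sum1 := \sum_(1 <= k < p) rising (1 / 2) k / k`!%:R / k%:R.
Definition sum2 := \sum_(1 <= k < p) rising (1 / 2) k / k`!%:R / k%:R ^+ 2.

Lemma pint_sum1 : pint sum1.
Proof.
rewrite /sum1 big_nat_cond; apply: pint_sum => // k; rewrite andbT => /andP[k0 kp].
have [_ _ hf] := punit_fact p_pr p_gt3 kp.
have h1 : pint (1 / 2) by solve_pint.
have hr := pint_rising k h1.
have kr : (0 < k < p)%N by rewrite k0.
by have [_ _ hk] := punit_range p_pr kr; solve_pint.
Qed.

Lemma pint_sum2 : pint sum2.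
Proof.
rewrite /sum2 big_nat_cond; apply: pint_sum => // k; rewrite andbT => /andP[k0 kp].
have [_ _ hf] := punit_fact p_pr p_gt3 kp.
have h1 : pint (1 / 2) by solve_pint.
have hr := pint_rising k h1.
have kr : (0 < k < p)%N by rewrite k0.
by have [_ _ hk] := punit_range p_pr kr; solve_pint.
Qed.

Lemma rising_fact n : rising 1 n = n`!%:R.
Proof.
elim: n => [|n IHn]; first by rewrite rising0 fact0.
by rewrite risingS IHn factS natrM -[n.+1]add1n natrD mulrC.
Qed.

Lemma rising_pm k t : pint t ->
  eqm 2 (rising (1 + P * t) k * rising (1 - P * t) k) (k`!%:R ^+ 2).
Proof.
move=> ht; rewrite -!rising_fact /rising expr2 -!big_split /=.
apply: eqm_prod => // i _; first by solve_pint.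
by exists (- t ^+ 2); [solve_pint | ring].
Qed.

(** For k > 0 the rising factorials of p t and 1 - p t multiply to p t (k - p t) times the product
    of the j^2 - p^2 t^2 over 0 < j < k; the leading [p] makes the squares p^2 t^2 negligible. *)
Lemma hsum_near0 t : pint t ->
  eqm 3 (hsum p (- (P * t))) (1 + P * t * sum1 - P ^+ 2 * t ^+ 2 * sum2).
Proof.
move=> ht; rewrite /hsum big_ltn ?prime_gt0 // hterm0 -addrA; apply: eqmD => //.
  exact: eqm_refl.
rewrite /sum1 /sum2 !big_distrr -sumrN -big_split /=.
apply: eqm_sum_nat => // -[//|n] /andP[_ hn].
have n0 : (0 < n.+1 < p)%N by lia.
have hn' : (n < p)%N by lia.
have [N0 _ hN] := punit_range p_pr n0.
have [F0 _ hF] := punit_fact p_pr p_gt3 hn'.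
have h1 : pint (1 / 2) by solve_pint.
have hr := pint_rising n.+1 h1.
have := eqm_mulp 1 (rising_pm n ht); rewrite expr1 => R.
have {}R := eqm_mull p_pr (c := rising (1 / 2) n.+1 * t * (n.+1%:R - P * t) * n`!%:R^-1 ^+ 3 * n.+1%:R^-1 ^+ 3) _ R.
rewrite /hterm opprK factS natrM [rising (P * t) _]risingSl [rising (- (P * t) + 1) _]risingS.
rewrite ![_ + 1]addrC.
set r := rising (1 / 2) n.+1 in R hr *; set x := rising (1 + _) n in R *; set y := rising (1 - P * t) n in R *.
rewrite (_ : r * _ * _ / _ = r * t * (n.+1%:R - P * t) * n`!%:R^-1 ^+ 3 * n.+1%:R^-1 ^+ 3 * (P * (x * y))); last first.
  by rewrite -[n.+1]addn1 natrD in N0 *; field; rewrite F0 N0.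
rewrite [X in eqm 3 _ X](_ : _ = r * t * (n.+1%:R - P * t) * n`!%:R^-1 ^+ 3 * n.+1%:R^-1 ^+ 3 * (P * n`!%:R ^+ 2)); last first.
  by field; rewrite F0 nat1r N0.
by apply: R; solve_pint.
Qed.

End HypergeometricCongruences.

(** The free upper end [N] lets n and n + 1 share a range. Passing to n + 1 adds 1/(n + 1) times an
    alternating binomial row without its first term, that is, -1/(n + 1). *)
Lemma alt_bin_sum1 N n : (n <= N)%N ->
  \sum_(1 <= k < N.+1) (-1) ^+ k * 'C(n, k)%:R / k%:R = - harm 1 n :> rat.
Proof.
elim: n => [|n IHn] hn.
  rewrite harm0 oppr0 big_nat_cond big1 // => -[//|k] _.
  by rewrite bin0n mulr0 mul0r.
rewrite harmS opprD -IHn ?(ltnW hn) //.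
have S0 : \sum_(1 <= k < N.+1) (-1) ^+ k * 'C(n.+1, k)%:R = -1 :> rat.
  have Z : \sum_(0 <= k < N.+1) (-1) ^+ k * 'C(n.+1, k)%:R = 0 :> rat.
    rewrite (big_cat_nat (n := n.+2)) //= [X in _ + X]big_nat_cond [X in _ + X]big1 ?addr0; last first.
      by move=> k /andP[/andP[hk _] _]; rewrite bin_small ?mulr0.
    transitivity ((1 + (-1)) ^+ n.+1 : rat); last by rewrite subrr expr0n.
    rewrite exprDn big_mkord; apply: eq_bigr => i _.
    by rewrite expr1n mul1r mulr_natr.
  by move: Z; rewrite big_ltn // expr0 bin0 mul1r => /eqP; rewrite addrC addr_eq0 => /eqP.
have -> : - n.+1%:R ^- 1 = (\sum_(1 <= k < N.+1) (-1) ^+ k * 'C(n.+1, k)%:R) / n.+1%:R :> rat.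
  by rewrite S0 mulN1r.
rewrite big_distrl -big_split /=.
apply: eq_big_nat => -[//|k] _.
have E : n.+1%:R * 'C(n, k)%:R = k.+1%:R * 'C(n.+1, k.+1)%:R :> rat.
  by rewrite -!natrM mul_bin_diag.
have n0 : n.+1%:R != 0 :> rat by rewrite pnatr_eq0.
have k0 : k.+1%:R != 0 :> rat by rewrite pnatr_eq0.
have -> : 'C(n, k.+1)%:R = 'C(n.+1, k.+1)%:R - k.+1%:R * 'C(n.+1, k.+1)%:R / n.+1%:R :> rat.
  by rewrite -E mulrAC divff // mul1r binS natrD addrK.
by field; rewrite !nat1r n0 k0.
Qed.

(** Here the increment is 1/(n + 1) times the preceding sum taken at n + 1. *)
Lemma alt_bin_sum2 N n : (n <= N)%N ->
  \sum_(1 <= k < N.+1) (-1) ^+ k * 'C(n, k)%:R / k%:R ^+ 2 =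
  - (harm 1 n ^+ 2 + harm 2 n) / 2 :> rat.
Proof.
elim: n => [|n IHn] hn.
  rewrite !harm0 expr0n addr0 oppr0 mul0r big_nat_cond big1 // => -[//|k] _.
  by rewrite bin0n mulr0 mul0r.
have n0 : n.+1%:R != 0 :> rat by rewrite pnatr_eq0.
have -> : - (harm 1 n.+1 ^+ 2 + harm 2 n.+1) / 2 =
    - (harm 1 n ^+ 2 + harm 2 n) / 2 + (- harm 1 n.+1) / n.+1%:R.
  by rewrite !harmS; field; rewrite nat1r.
rewrite -IHn ?(ltnW hn) // -(alt_bin_sum1 hn) big_distrl -big_split /=.
apply: eq_big_nat => -[//|k] _.
have E : n.+1%:R * 'C(n, k)%:R = k.+1%:R * 'C(n.+1, k.+1)%:R :> rat.
  by rewrite -!natrM mul_bin_diag.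
have k0 : k.+1%:R != 0 :> rat by rewrite pnatr_eq0.
have -> : 'C(n, k.+1)%:R = 'C(n.+1, k.+1)%:R - k.+1%:R * 'C(n.+1, k.+1)%:R / n.+1%:R :> rat.
  by rewrite -E mulrAC divff // mul1r binS natrD addrK.
by field; rewrite !nat1r n0 k0.
Qed.

Lemma rising_opp_nat n k : rising (- n%:R) k = (-1) ^+ k * k`!%:R * 'C(n, k)%:R.
Proof.
have -> : rising (- n%:R) k = (-1) ^+ k * (n ^_ k)%:R.
  elim: k => [|k IHk]; first by rewrite rising0 ffactn0 expr0 mul1r.
  rewrite risingS IHk ffactnSr natrM exprS; case: (leqP k n) => hk.
    by rewrite natrB //; ring.
  by rewrite ffact_small // mulr0 !mul0r mulr0.
by rewrite -mulrA -natrM mulnC bin_ffact.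
Qed.

(** * Values at the starting points -p/3 and 1 - p/3 *)

Section HypergeometricValues.
Variables (p : nat) (p_pr : prime p) (p_gt3 : (3 < p)%N).
Local Notation P := (p%:R : rat).
Local Notation pint := (pint p).
Local Notation punit := (punit p).
Local Notation eqm := (eqm p).
Variable h : nat.
Hypothesis pE : p = (2 * h).+1.
Let hp : (h < p)%N. Proof. lia. Qed.
Let h1 : pint (1 / 2). Proof. by solve_pint. Qed.

(** Modulo [p] the parameter 1/2 is -h, so the coefficients become signed binomial coefficients of
    [h]. *)
Lemma sum2_congr : eqm 1 (sum2 p) (- harm 1 h ^+ 2 / 2).
Proof.
have H1 := pint_harm p_pr 1 hp; have H2 := pint_harm p_pr 2 hp.
apply: (eqm_trans p_pr (y := - (harm 1 h ^+ 2 + harm 2 h) / 2)); last first.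
  have -> : - (harm 1 h ^+ 2 + harm 2 h) / 2 = - harm 1 h ^+ 2 / 2 + (- (1 / 2)) * harm 2 h by field.
  rewrite -[X in eqm 1 _ X]addr0; apply: eqmD => //; first exact: eqm_refl.
  rewrite -(mulr0 (- (1 / 2))); apply: (eqm_mull p_pr _ (harm2_half p_pr p_gt3 pE)).
  by solve_pint.
have hN : (h <= 2 * h)%N by lia.
rewrite -(alt_bin_sum2 hN) /sum2 -pE; apply: eqm_sum_nat => // k hk.
have kp : (k < p)%N by case/andP: hk.
have [_ _ hf] := punit_fact p_pr p_gt3 kp; have [_ _ hkV] := punit_range p_pr hk.
rewrite -exprVn; apply: (eqm_mulr p_pr); first by solve_pint.
have -> : (-1) ^+ k * 'C(h, k)%:R = rising (- h%:R) k / k`!%:R :> rat.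
  by rewrite rising_opp_nat; field; rewrite factS_neq0.
apply: (eqm_mulr p_pr hf); apply: eqm_rising => //; first by solve_pint.
have := eqmD p_pr (half_eqm p_pr p_gt3 pE) (eqm_refl p_pr 1 (- h%:R)).
by rewrite addrK add0r.
Qed.

(** As -p = -1 - 2h, symmetry gives F (- p) = F (2h), reached from F (0) = 1 in [h] steps; the
    numerators 2i - 1 of the step ratios are reflected into multiples of i - p/2. *)
Lemma hsum_minus_p : eqm 3 (hsum p (- P)) (texp p (- harm 1 h) 0).
Proof.
have H1 := pint_harm p_pr 1 hp; have H2 := pint_harm p_pr 2 hp.
have -> : - P = -1 - (0 + (2 * h)%:R) by rewrite pE -natr1; ring.
rewrite hsum_sym; apply: (eqm_trans p_pr (hsum_steps p_pr p_gt3 pE (e := 0) _ _ _)).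
- exact: pint0.
- exact: eqm_refl.
- by rewrite pE; lia.
rewrite hsum0 // mulr1.
have pa : pint (- 2^-1) by solve_pint.
have A := prod_shift_fact p_pr p_gt3 hp pa.
have [F0 hF hFV] := punit_fact p_pr p_gt3 hp.
have -> : \prod_(1 <= i < h.+1) ((0 + (2 * i)%:R - 1) / (0 + (2 * i)%:R)) =
   (-1) ^+ h / h`!%:R * \prod_(1 <= i < h.+1) (i%:R + P * - 2^-1).
  rewrite prodf_div (_ : \prod_(1 <= i < h.+1) (0 + (2 * i)%:R) = 2 ^+ h * h`!%:R); last first.
    by rewrite fact_prod natr_prod -prod_scale; apply: eq_bigr => i _; rewrite add0r natrM.
  have -> : \prod_(1 <= i < h.+1) (0 + (2 * i)%:R - 1) =
      (- 2) ^+ h * \prod_(1 <= i < h.+1) (i%:R + P * - 2^-1).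
    rewrite -prod_scale big_add1 /= (eq_bigr (fun i => (2 * i).+1%:R)); last first.
      by move=> i _; rewrite -[(2 * i).+1]addn1 !mulnS !natrD; ring.
    rewrite (big_reflect _ (fun i => (2 * i).+1%:R) 0); apply: eq_big_nat => i hi.
    rewrite (_ : ((2 * (0 + h - i)).+1 = p - 2 * i)%N) ?natrB ?natrM; [by field | lia | lia].
  have -> : (- 2) ^+ h = (-1) ^+ h * 2 ^+ h :> rat by rewrite -exprMn mulN1r.
  have p2 : 2 ^+ h != 0 :> rat by rewrite expf_neq0.
  by field; rewrite F0 p2.
rewrite -mulrA exprMn sqrr_sign mul1r.
set T := texp _ _ _ in A.
have hT : pint T by apply: (pint_texp p_pr p_gt3); solve_pint.
have {}A := eqm_mull p_pr hFV A; rewrite mulKf // in A.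
apply: (eqm_trans p_pr (eqmX p_pr 2 hT A)).
apply: (eqm_trans p_pr (texpX p_pr p_gt3 2 _ _)); try solve_pint.
apply: (texp_eq p_pr p_gt3); first by solve_pint.
  by rewrite (_ : 2 * _ = - harm 1 h); [exact: eqm_refl | field].
rewrite (_ : 2 * _ = - (1 / 4) * harm 2 h); last by field.
by rewrite -(mulr0 (- (1 / 4))); apply: (eqm_mull p_pr _ (harm2_half p_pr p_gt3 pE)); solve_pint.
Qed.

(** The expansion near 0 at t = 1, solved for its linear coefficient. *)
Lemma sum1_congr : eqm 3 (P * sum1 p) (- P * harm 1 h).
Proof.
have H1 := pint_harm p_pr 1 hp.
have A := hsum_near0 p_pr p_gt3 pE (pint1 p_pr).
rewrite mulr1 expr1n mulr1 in A.
have {}A := eqm_trans p_pr (eqm_sym p_pr A) hsum_minus_p.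
have B := eqm_mulp 2 sum2_congr.
have := eqmD p_pr (eqmD p_pr A B) (eqm_refl p_pr 3 (-1)).
rewrite (_ : 1 + _ - _ + _ + _ = P * sum1 p); last by ring.
by rewrite (_ : _ + _ + _ = - P * harm 1 h) // /texp; field.
Qed.

(** The expansion at t = 1/3. Its quadratic term is exactly that of the exponential, so the second
    slot is 0. *)
Lemma hsum_third0 : eqm 3 (hsum p (- (P / 3))) (texp p (- harm 1 h / 3) 0).
Proof.
have H1 := pint_harm p_pr 1 hp.
have c3 : pint 3^-1 by solve_pint.
have c9 : pint (- 3^-1 ^+ 2) by solve_pint.
apply: (eqm_trans p_pr (hsum_near0 p_pr p_gt3 pE c3)).
have := eqmD p_pr (eqm_mull p_pr c3 sum1_congr) (eqm_mull p_pr c9 (eqm_mulp 2 sum2_congr)).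
move/(eqmD p_pr (eqm_refl p_pr 3 1)).
set Y := 1 + (_ + _); set Z := 1 + (_ + _) => H.
rewrite (_ : _ - _ = Y); last by rewrite /Y; field.
by rewrite (_ : texp _ _ _ = Z) // /Z /texp; field.
Qed.

(** The factor of index [h] is p/2. The others are, up to sign, the i - p/2 and i + p/2, with
    product (-1)^h h!^2 modulo [p], which is (p - 1)!. *)
Lemma rising_half_p : eqm 2 (rising (1 / 2) p) (P * ((p.-1)`!%:R / 2)).
Proof.
have E : rising (1 / 2) p = P / 2 * (rising (1 / 2) h * rising (P / 2 + 1) h).
  have Ep : p = (h + h.+1)%N by lia.
  rewrite {1}Ep rising_add risingSl.
  have -> : 1 / 2 + h%:R = P / 2 by rewrite (PE pE); field.
  by ring.
have E1 : rising (1 / 2) h = (-1) ^+ h * \prod_(1 <= i < h.+1) (i%:R + P * - 2^-1).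
  rewrite -prod_scale /rising (big_reflect _ (fun i => 1 / 2 + i%:R) 0).
  apply: eq_big_nat => i hi; rewrite add0n natrB; last by lia.
  by rewrite (PE pE); field.
have E2 : rising (P / 2 + 1) h = \prod_(1 <= i < h.+1) (i%:R + P * 2^-1).
  by rewrite /rising big_add1 /=; apply: eq_bigr => i _; rewrite -natr1; ring.
have hF := pint_nat p_pr h`!; have hF1 := pint_nat p_pr (p.-1)`!.
have A : eqm 1 (\prod_(1 <= i < h.+1) (i%:R + P * - 2^-1) * \prod_(1 <= i < h.+1) (i%:R + P * 2^-1))
               (h`!%:R ^+ 2).
  rewrite expr2 fact_prod natr_prod; apply: eqmM; rewrite -?natr_prod; try by solve_pint.
    rewrite natr_prod; apply: eqm_prod => // i _; first by solve_pint.
    by exists (- 2^-1); [solve_pint | rewrite expr1].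
  rewrite natr_prod; apply: eqm_prod => // i _; first by solve_pint.
  by exists 2^-1; [solve_pint | rewrite expr1].
have B : eqm 1 (p.-1)`!%:R ((-1) ^+ h * h`!%:R ^+ 2).
  have -> : p.-1 = (2 * h)%N by lia.
  rewrite (fact_reflect p_pr p_gt3 pE) mulrCA expr2; apply: (eqm_mull p_pr); first by solve_pint.
  apply: (eqm_mull p_pr) => //; rewrite [in X in eqm 1 _ X]fact_prod natr_prod.
  apply: eqm_prod => // i _; first by solve_pint.
  by exists (- 1); [solve_pint | rewrite expr1].
rewrite E E1 E2 -mulrA -mulrA; apply: (eqm_mulp 1).
have c2 : pint 2^-1 by solve_pint.
rewrite [X in eqm 1 _ X]mulrC; apply: (eqm_mull p_pr c2).
have sg : pint ((-1) ^+ h) by solve_pint.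
exact: (eqm_trans p_pr (eqm_mull p_pr sg A) (eqm_sym p_pr B)).
Qed.

(** The step at a = -p/3, of residue 0, where only two of the rising factorials gain a factor [p].
    The truncation error is -p^2/3 and the term a^2 F (a - 1) is p^2/9, whence -2/9. *)
Lemma hsum_third1 : eqm 3 (hsum p (- (P / 3) + 1)) (- (2 / 9) * P ^+ 2).
Proof.
have := hsum_rec p.-1 (- (P / 3)); rewrite prednK ?prime_gt0 // opprK => E.
have hp1 : (p.-1 < p)%N by lia.
have hp2 : (p.-2 < p)%N by lia.
have [F0 hF hFV] := punit_fact p_pr p_gt3 hp1.
have hF2 := pint_nat p_pr (p.-2)`!.
have A1 : eqm 1 (hsum p (- (P / 3) - 1)) 1.
  have c3 : pint (- 3^-1) by solve_pint.
  rewrite (_ : - (P / 3) - 1 = -1 - (- (P * (- 3^-1)))) ?hsum_sym; last by field.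
  apply: (eqm_trans p_pr (eqm_weak p_pr _ (hsum_near0 p_pr p_gt3 pE c3))) => //.
  have s1 := pint_sum1 p_pr p_gt3; have s2 := pint_sum2 p_pr p_gt3.
  exists (- 3^-1 * sum1 p - P * (- 3^-1) ^+ 2 * sum2 p); first by solve_pint.
  by ring.
have p1 : p.-1 = p.-2.+1 by lia.
have A2 : eqm 2 (rising (P / 3) p.-1) (P * ((p.-2)`!%:R / 3)).
  rewrite p1 risingSl (_ : P / 3 * _ = P ^+ 1 * (3^-1 * rising (P / 3 + 1) p.-2)); last by ring.
  rewrite -{2}[P]expr1; apply: (eqm_mulp 1); rewrite [X in eqm 1 _ X]mulrC.
  apply: (eqm_mull p_pr); first by solve_pint.
  rewrite -rising_fact; apply: eqm_rising => //; first by solve_pint.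
  by exists 3^-1; [solve_pint | ring].
have A3 : eqm 1 (rising (- (P / 3) + 1) p.-1) (p.-1)`!%:R.
  rewrite -rising_fact; apply: eqm_rising => //; first by solve_pint.
  by exists (- 3^-1); [solve_pint | field].
have A4 := rising_half_p.
case: A2 A3 A4 A1 => a ha Ea [b hb Eb] [c hc Ec] [d hd Ed].
have pP : (p.-1)%:R = P - 1 by rewrite -subn1 natrB // prime_gt0.
have fE : (p.-1)`!%:R = (P - 1) * (p.-2)`!%:R by rewrite {1}p1 factS natrM -p1 pP.
have P1 : P - 1 != 0 by rewrite -pP pnatr_eq0; lia.
have hP1V : pint (P - 1)^-1 by rewrite -pP; apply: pint_natV => //; rewrite gtnNdvd; lia.
have G0 : (p.-2)`!%:R != 0 :> rat := factS_neq0 _.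
have uu : punit ((- (P / 3) + 1) ^+ 2).
  apply: punitX => //; apply: (punit_eqm p_pr _ (punit1 p_pr)).
  by exists (- 3^-1); [solve_pint | field].
apply: (eqm_cancel p_pr uu).
set f := (p.-2)`!%:R in fE Ea hF2 G0 *; set f1 := (p.-1)`!%:R in E Eb Ec fE hF hFV F0 *.
pose q := f1 / 2 * a + f / 3 * c + P * a * c.
pose q' := q * (f1 + P * b) + f1 / 2 * (f / 3) * b.
exists (d / 9 + 2 * (1 - 2 * P / 3) * q' * f1^-1 ^+ 3
        + (7 / 3 - 14 / 9 * P + 2 / 9 * P ^+ 2) / 9 * (P - 1)^-1).
  rewrite /q' /q; solve_pint.
move/eqP: E; rewrite subr_eq => /eqP ->; rewrite Ea Eb Ec Ed /q' /q fE.
by field; rewrite P1 G0.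
Qed.

End HypergeometricValues.

(** * Calculus of exponential forms *)

Section ExponentialForm.
Variables (p : nat) (p_pr : prime p) (p_gt3 : (3 < p)%N).
Local Notation P := (p%:R : rat).
Local Notation pint := (pint p).
Local Notation punit := (punit p).
Local Notation eqm := (eqm p).

(** Integrality and invertibility are bundled with the congruence, so that products, inverses and
    powers carry no side conditions. *)
Definition exp_form (c u v x : rat) : Prop :=
  [/\ punit c, pint u, pint v & eqm 3 x (c * texp p u v)].

Lemma exp_form_punit c u v x : exp_form c u v x -> punit x.
Proof.
move=> [uc hu hv hx]; apply: (punit_eqm p_pr (eqm_weak p_pr _ hx)) => //.
by apply: punitM => //; apply: punit_texp.
Qed.

Lemma exp_formM c u v x c' u' v' x' : exp_form c u v x -> exp_form c' u' v' x' ->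
  exp_form (c * c') (u + u') (v + v') (x * x').
Proof.
move=> [uc hu hv hx] [uc' hu' hv' hx'].
have hc := punit_pint uc; have hc' := punit_pint uc'.
have ht := pint_texp p_pr p_gt3 hu hv; have ht' := pint_texp p_pr p_gt3 hu' hv'.
split; [exact: punitM | by solve_pint | by solve_pint |].
apply: (eqm_trans p_pr (eqmM p_pr _ _ hx hx')); try by solve_pint.
rewrite mulrACA; apply: (eqm_mull p_pr); first by solve_pint.
exact: texpM.
Qed.

Lemma exp_formV c u v x : exp_form c u v x -> exp_form c^-1 (- u) (- v) x^-1.
Proof.
move=> [uc hu hv hx]; split; [exact: punitV | by solve_pint | by solve_pint |].
have U : punit (c * texp p u v) by apply: punitM => //; apply: punit_texp.
apply: (eqm_trans p_pr (eqmV p_pr _ U hx)) => //.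
rewrite invfM; apply: (eqm_mull p_pr); first exact: punitV_pint.
exact: texpV.
Qed.

Lemma exp_formZ b c u v x : punit b -> exp_form c u v x -> exp_form (b * c) u v (b * x).
Proof.
move=> ub [uc hu hv hx]; split=> //; first exact: punitM.
by rewrite -mulrA; apply: (eqm_mull p_pr) => //; exact: punit_pint.
Qed.

Lemma exp_form_congr c u v x y : eqm 3 x y -> exp_form c u v y -> exp_form c u v x.
Proof. by move=> xy [uc hu hv hy]; split=> //; apply: eqm_trans hy. Qed.

Lemma exp_formX c u v x n : exp_form c u v x ->
  exp_form (c ^+ n) (n%:R * u) (n%:R * v) (x ^+ n).
Proof.
move=> [uc hu hv hx]; split; [exact: punitX | by solve_pint | by solve_pint |].
have hc := punit_pint uc; have ht := pint_texp p_pr p_gt3 hu hv.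
apply: (eqm_trans p_pr (eqmX p_pr n _ hx)); first by solve_pint.
rewrite exprMn; apply: (eqm_mull p_pr); first by solve_pint.
exact: texpX.
Qed.

Lemma exp_form_eq c u v x u' v' : exp_form c u v x -> pint u' -> pint v' ->
  eqm 2 u u' -> eqm 1 v v' -> exp_form c u' v' x.
Proof.
move=> [uc hu hv hx] hu' hv' eu ev; split=> //; apply: (eqm_trans p_pr hx).
by apply: (eqm_mull p_pr); [exact: punit_pint | exact: texp_eq].
Qed.

Lemma exp_form_shift c u v w x : pint u -> pint w -> exp_form c (u + P * w) v x ->
  exp_form c u (v + w) x.
Proof.
move=> hu hw [uc _ hv hx]; split=> //; first by solve_pint.
apply: (eqm_trans p_pr hx); apply: (eqm_mull p_pr); first exact: punit_pint.
exact: texp_shift.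
Qed.

(** At a natural number x = q this is (q p + n)! / (q p)!; the fractions -1/2, -1/3, -1/6 come from
    the step ratios. *)
Definition shift_prod (n : nat) (x : rat) : rat := \prod_(1 <= i < n.+1) (i%:R + P * x).

Lemma exp_form_shift_prod n x : (n < p)%N -> pint x ->
  exp_form n`!%:R (x * harm 1 n) (- (x ^+ 2 / 2) * harm 2 n) (shift_prod n x).
Proof.
move=> np hx; have := pint_harm p_pr 1 np; have := pint_harm p_pr 2 np => h2 h1.
split; [exact: punit_fact | by solve_pint | by solve_pint | exact: prod_shift_fact].
Qed.

End ExponentialForm.

(** * The two chains of steps from -p/3 and 1 - p/3 *)

Section EvenOddValues.
Variables (p : nat) (p_pr : prime p) (p_gt3 : (3 < p)%N).
Local Notation P := (p%:R : rat).
Local Notation pint := (pint p).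
Local Notation punit := (punit p).
Local Notation eqm := (eqm p).
Variable h : nat.
Hypothesis pE : p = (2 * h).+1.

Local Notation shift_prod := (shift_prod p).

Lemma shift_prodS n x : shift_prod n.+1 x = shift_prod n x * (n.+1%:R + P * x).
Proof. by rewrite /shift_prod big_nat_recr. Qed.

Lemma shift_prod0 x : shift_prod 0 x = 1.
Proof. by rewrite /shift_prod big_geq. Qed.

Lemma punit_shift i x : (0 < i < p)%N -> pint x -> punit (i%:R + P * x).
Proof.
move=> hi hx; apply: (punit_eqm p_pr _ (punit_range p_pr hi)).
by exists x => //; rewrite expr1.
Qed.

Lemma punit_shift_prod n x : (n < p)%N -> pint x -> punit (shift_prod n x).
Proof.
move=> np hx; elim: n np => [|n IHn] np; first by rewrite shift_prod0; exact: punit1.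
rewrite shift_prodS; apply: punitM => //; first by apply: IHn; lia.
by apply: punit_shift => //; lia.
Qed.

(** As p = 2h + 1, the factor 1/2 + i is -((h - i) - p/2): up to sign, the rising factorial is the
    top segment of [shift_prod h]. *)
Lemma rising_half_shift n : (n <= h)%N ->
  rising (1 / 2) n * shift_prod (h - n) (- 2^-1) = (-1) ^+ n * shift_prod h (- 2^-1).
Proof.
elim: n => [|n IHn] hn; first by rewrite rising0 subn0 expr0.
rewrite exprS -mulrA -IHn ?(ltnW hn) // risingS (_ : h - n = (h - n.+1).+1)%N; last by lia.
rewrite shift_prodS (_ : (h - n.+1).+1 = h - n)%N ?natrB ?(ltnW hn) //; last by lia.
by rewrite (PE pE); field.
Qed.

(** Among the factors i - p/3, odd over even is the whole product up to 2n over the square of its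
    even part, and 2i - p/3 = 2 (i - p/6). *)
Lemma step_ratio n : (2 * n < p)%N ->
  \prod_(1 <= i < n.+1) ((- (P / 3) + (2 * i)%:R - 1) / (- (P / 3) + (2 * i)%:R))
  = shift_prod (2 * n) (- 3^-1) / (4 ^+ n * shift_prod n (- 6^-1) ^+ 2).
Proof.
have c3 : pint (- 3^-1) by solve_pint.
have c6 : pint (- 6^-1) by solve_pint.
elim: n => [|n IHn] hn.
  by rewrite big_geq // muln0 !shift_prod0; field.
rewrite big_nat_recr //= IHn; last by lia.
have -> : (2 * n.+1 = (2 * n).+2)%N by lia.
have u1 := punit_neq0 (punit_shift_prod (n := n) _ c6).
have u2 := punit_neq0 (punit_shift (i := n.+1) _ c6).
have {}u1 := u1 ltac:(lia); have {}u2 := u2 ltac:(lia).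
rewrite !shift_prodS (exprS 4 n); move: u1 u2; set x := shift_prod _ _; set y := shift_prod _ _.
move: x y => x y.
have -> : n.+1%:R = n%:R + 1 :> rat by rewrite natr1.
have -> : (2 * n).+1%:R = 2 * n%:R + 1 :> rat by rewrite -natr1 natrM.
have -> : (2 * n).+2%:R = 2 * n%:R + 2 :> rat by rewrite -addn2 natrD natrM.
have p4 : 4 ^+ n != 0 :> rat by rewrite expf_neq0.
move: (4 ^+ n) p4 => q p4 u1 u2.
have u3 : - (P / 3) + (2 * n%:R + 2) != 0.
  by rewrite (_ : _ + _ = 2 * (n%:R + 1 + P * - 6^-1)) ?mulf_neq0 //; field.
have u4 : n%:R * 6 + 6 - P != 0.
  by rewrite (_ : _ - _ = 6 * (n%:R + 1 + P * - 6^-1)) ?mulf_neq0 //; field.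
by field; rewrite u1 p4 mulrDl mul1r mulrN1 u4.
Qed.

(** The ratios of the chain from [x] interlace with those of the chain from [x + 1], so the product
    telescopes. *)
Lemma alternate_ratio (x : rat) n : (forall i, (0 < i <= 2 * n.+1)%N -> x + i%:R != 0) ->
  \prod_(1 <= i < n.+2) ((x + (2 * i)%:R - 1) / (x + (2 * i)%:R)) *
  \prod_(1 <= i < n.+1) ((x + 1 + (2 * i)%:R - 1) / (x + 1 + (2 * i)%:R)) =
  (x + 1) / (x + (2 * n.+1)%:R).
Proof.
elim: n => [|n IHn] nz.
  have := nz 2%N isT; rewrite big_nat1 big_geq // muln1 => n2; field.
  by rewrite n2.
rewrite big_nat_recr //= [X in _ * X]big_nat_recr //= mulrACA IHn; last first.
  by move=> i hi; apply: nz; lia.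
have := nz (2 * n.+2)%N; have := nz (2 * n.+1)%N; have := nz (2 * n.+1).+1.
rewrite -[(2 * n.+1).+1]addn1 (_ : 2 * n.+2 = 2 * n.+1 + 2)%N; last by lia.
rewrite !natrD => /(_ ltac:(lia)) n1 /(_ ltac:(lia)) n2 /(_ ltac:(lia)) n3.
move: (2 * n.+1)%:R n1 n2 n3 => a n1 n2 n3; rewrite [a + 1]addrC addrA in n1.
by field; rewrite n1 n2 n3.
Qed.

Let x0 := - (P / 3).

(** By interlacing, the product of the end values is ((x0 + 1)/(x0 + 2n))^2 times that of the
    starting values. The latter is -2/9 p^2 up to a factor 1 modulo [p], and the denominator
    contributes 9. *)
Lemma even_odd_product n : (0 < n)%N -> (2 * n < p)%N ->
    (x0 + (2 * n)%:R) ^+ 2 = (1 / 3) ^+ 2 ->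
  eqm 3 (hsum p (x0 + (2 * n)%:R) * hsum p (x0 + (2 * n)%:R - 1)) (- 2 * P ^+ 2).
Proof.
case: n => // n _ hn e3.
have px : pint x0 by rewrite /x0; solve_pint.
have px1 : pint (x0 + 1) by solve_pint.
have e0 : eqm 1 x0 0%:R by exists (- 3^-1); [solve_pint | rewrite /x0; field].
have e1 : eqm 1 (x0 + 1) 1%:R by rewrite -[X in eqm 1 _ X]add0r; apply: eqmD => //; exact: eqm_refl.
have A := hsum_steps p_pr p_gt3 pE (j := n.+1) px e0 hn.
have hn' : (1 + 2 * n < p)%N by lia.
have B := hsum_steps p_pr p_gt3 pE (j := n) px1 e1 hn'.
have nz i : (0 < i <= 2 * n.+1)%N -> x0 + i%:R != 0.
  move=> hi; have c3 : pint (- 3^-1) by solve_pint.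
  have hi' : (0 < i < p)%N by lia.
  have /punit_neq0 := punit_shift hi' c3.
  by rewrite (_ : i%:R + _ = x0 + i%:R) // /x0; ring.
have := alternate_ratio nz.
move: A B; set W := \prod_(1 <= i < _) _; set Z := \prod_(1 <= i < _) _ => A B WZ.
have E1 : x0 + (2 * n.+1)%:R - 1 = x0 + 1 + (2 * n)%:R.
  by rewrite mulnS natrD; ring.
have pF0 := pint_hsum p_pr p_gt3 px; have pF1 := pint_hsum p_pr p_gt3 px1.
have pA : pint (W ^+ 2 * hsum p x0).
  by apply: (eqm_pint p_pr (eqm_sym p_pr A)); apply: pint_hsum => //; solve_pint.
have pB : pint (Z ^+ 2 * hsum p (x0 + 1)).
  by apply: (eqm_pint p_pr (eqm_sym p_pr B)); apply: pint_hsum => //; solve_pint.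
rewrite E1; apply: (eqm_trans p_pr (eqmM p_pr pA pB A B)).
have -> : W ^+ 2 * hsum p x0 * (Z ^+ 2 * hsum p (x0 + 1)) =
    9 * (x0 + 1) ^+ 2 * (hsum p x0 * hsum p (x0 + 1)).
  transitivity ((W * Z) ^+ 2 * (hsum p x0 * hsum p (x0 + 1))); first by ring.
  rewrite WZ expr_div_n e3; by field.
have H1 := pint_harm p_pr 1 (_ : h < p)%N; have {}H1 := H1 ltac:(lia).
have pH : pint (- harm 1 h / 3) by solve_pint.
set T := texp p (- harm 1 h / 3) 0.
have pT : pint T by apply: (pint_texp p_pr p_gt3) => //; exact: pint0.
have p9 : pint (9 * (x0 + 1) ^+ 2) by solve_pint.
have p29 : pint (- (2 / 9) * P ^+ 2) by solve_pint.
apply: (eqm_trans p_pr (eqm_mull p_pr p9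
  (eqmM p_pr pT p29 (hsum_third0 p_pr p_gt3 pE) (hsum_third1 p_pr p_gt3 pE)))).
rewrite (_ : _ * (T * _) = P ^+ 2 * (- 2 * (x0 + 1) ^+ 2 * T)); last by field.
rewrite (_ : - 2 * P ^+ 2 = P ^+ 2 * - 2); last by ring.
apply: (eqm_mulp 2).
exists (- 2 * ((- (2 / 3) + P / 9) * T + - harm 1 h / 3 + P * ((- harm 1 h / 3) ^+ 2 / 2 + 0))).
  by solve_pint.
by rewrite /T /texp /x0; field.
Qed.

Variables k l : nat.
Hypotheses (hE : (k + (k - l) = h)%N) (hk : (k = 2 * l \/ k = (2 * l).+1)%N).

(** The product of the step ratios from -p/3, up to an explicit unit, in a form common to both
    residues of [p] modulo 6. The power of 4 in [step_ratio] has been traded for the shifts by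
    -p/2. *)
Definition even_root : rat :=
  shift_prod k (- 3^-1) * shift_prod h (- 2^-1)
   / (shift_prod k (- 2^-1) * shift_prod l (- 6^-1) ^+ 2).

Lemma even_root_sqr :
  exp_form p ((h`!%:R / l`!%:R ^+ 2) ^+ 2) (- (2 / 3) * harm 1 h + harm 1 k) (harm 2 k / 12)
    (even_root ^+ 2 * hsum p x0).
Proof.
have hp : (h < p)%N by lia.
have kp : (k < p)%N by lia.
have lp : (l < p)%N by lia.
have c2 : pint (- 2^-1) by solve_pint.
have c3 : pint (- 3^-1) by solve_pint.
have c6 : pint (- 6^-1) by solve_pint.
have h1 := pint_harm p_pr 1 hp; have k1 := pint_harm p_pr 1 kp; have l1 := pint_harm p_pr 1 lp.
have h2 := pint_harm p_pr 2 hp; have k2 := pint_harm p_pr 2 kp; have l2 := pint_harm p_pr 2 lp.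
have F0 : exp_form p 1 (- harm 1 h / 3) 0 (hsum p x0).
  split; [exact: punit1 | by solve_pint | exact: pint0 |].
  by rewrite mul1r; apply: hsum_third0.
have R := exp_formM p_pr p_gt3 (exp_formX p_pr p_gt3 2
  (exp_formM p_pr p_gt3
    (exp_formM p_pr p_gt3 (exp_form_shift_prod p_pr p_gt3 kp c3) (exp_form_shift_prod p_pr p_gt3 hp c2))
    (exp_formV p_pr p_gt3 (exp_formM p_pr p_gt3 (exp_form_shift_prod p_pr p_gt3 kp c2)
      (exp_formX p_pr p_gt3 2 (exp_form_shift_prod p_pr p_gt3 lp c6)))))) F0.
rewrite -/even_root in R.
have k0 := factS_neq0 k; have l0 := factS_neq0 l.
move: R; rewrite (_ : _ ^+ 2 * 1 = (h`!%:R / l`!%:R ^+ 2) ^+ 2); last by field; rewrite k0 l0.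
have pk : pint (- (2 / 3) * harm 1 h + harm 1 k) by solve_pint.
have pw : pint (- (harm 2 k / 3)) by solve_pint.
have p12 : pint (harm 2 k / 12) by solve_pint.
(* The first-slot correction -p/3 [harm 2 k], due to [harm1_sixth], goes to the second slot: 5/12 -
   1/3 = 1/12. *)
rewrite (_ : harm 2 k / 12 = 5 / 12 * harm 2 k + - (harm 2 k / 3)); last by field.
move=> R; apply: exp_form_shift => //; apply: (exp_form_eq _ _ R) => //; try by solve_pint.
  have := eqmD p_pr (eqm_refl p_pr 2 (- (4 / 3) * harm 1 h + harm 1 k / 3))
    (eqm_mull p_pr (c := 2 / 3) _ (harm1_sixth p_pr p_gt3 pE hE hk)).
  set x := _ + _; set y := _ + _ => H.
  rewrite (_ : _ + - harm 1 h / 3 = x); last by rewrite /x; field.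
  rewrite (_ : _ + P * _ = y); last by rewrite /y; field.
  by apply: H; solve_pint.
have := eqmD p_pr (eqmD p_pr (eqm_mull p_pr (c := - (1 / 4)) _ (harm2_half p_pr p_gt3 pE))
    (eqm_refl p_pr 1 (5 / 36 * harm 2 k)))
    (eqm_mull p_pr (c := 1 / 18) _ (harm2_sixth p_pr p_gt3 pE hE hk)).
set x := _ + _; set y := _ + _ => H.
rewrite (_ : _ + 0 = x); last by rewrite /x; field.
rewrite (_ : 5 / 12 * _ = y); last by rewrite /y; field.
by apply: H; solve_pint.
Qed.

End EvenOddValues.

(** * The invertible value as a squared binomial coefficient times an exponential *)

Section EvenValueCases.
Variables (p : nat) (p_pr : prime p) (p_gt3 : (3 < p)%N).
Local Notation P := (p%:R : rat).
Local Notation pint := (pint p).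
Local Notation punit := (punit p).
Local Notation eqm := (eqm p).

Lemma bin_fact_rat n m : (m <= n)%N -> 'C(n, m)%:R = n`!%:R / (m`!%:R * (n - m)`!%:R) :> rat.
Proof.
move=> le; have := congr1 (fun x => x%:R : rat) (bin_fact le); rewrite !natrM => <-.
by rewrite mulfK // mulf_neq0 // factS_neq0.
Qed.

(** Here -p/3 + 2n is exactly -1/3. *)
Lemma even_value_1mod6 n : p = (6 * n).+1 ->
  exp_form p ('C(3 * n, n)%:R ^+ 2)
    (- (2 / 3) * harm 1 (3 * n) + harm 1 (2 * n)) (harm 2 (2 * n) / 12) (hsum p (- (1 / 3))).
Proof.
move=> pn; have pE : p = (2 * (3 * n)).+1 by lia.
have hE : (2 * n + (2 * n - n) = 3 * n)%N by lia.
have hk : (2 * n = 2 * n \/ 2 * n = (2 * n).+1)%N by left.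
have R := even_root_sqr p_pr p_gt3 pE hE hk.
have px : pint (- (P / 3)) by solve_pint.
have e0 : eqm 1 (- (P / 3)) 0%:R by exists (- 3^-1); [solve_pint | field].
have hn : (0 + 2 * n < p)%N by lia.
have A := hsum_steps p_pr p_gt3 pE px e0 hn; rewrite (step_ratio p_pr p_gt3 pE) // in A.
have EP : P = 6 * n%:R + 1 by rewrite pn -natr1 natrM.
rewrite (_ : - (P / 3) + _ = - (1 / 3)) in A; last by rewrite natrM EP; field.
have f0 := factS_neq0 n; have f1 := factS_neq0 (2 * n).
have c3 : pint (- 2^-1) by solve_pint.
have c6 : pint (- 6^-1) by solve_pint.
have n2 : (2 * n < p)%N by lia.
have n1 : (n < p)%N by lia.
have u2 := punit_neq0 (punit_shift_prod p_pr p_gt3 pE n2 c3).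
have u6 := punit_neq0 (punit_shift_prod p_pr p_gt3 pE n1 c6).
have sg : (-1) ^+ n * (-1) ^+ n = 1 :> rat by rewrite -expr2 sqrr_sign.
have WE : shift_prod p (2 * n) (- 3^-1) / (4 ^+ n * shift_prod p n (- 6^-1) ^+ 2) =
    (-1) ^+ n * (n`!%:R / (2 * n)`!%:R) * even_root p (3 * n) (2 * n) n.
  have n3 : (n <= 3 * n)%N by lia.
  have := rising_half_shift p_pr p_gt3 pE n3; rewrite (_ : 3 * n - n = 2 * n)%N; last by lia.
  rewrite /even_root; have := fact_double n.
  move: (shift_prod p (2 * n) (- 3^-1)) (shift_prod p n _) (shift_prod p (2 * n) _)
    (shift_prod p (3 * n) _) ((-1) ^+ n) (rising _ n) u2 u6 sg => a b c d e r u2 u6 sg fd rc.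
  have p4 : 4 ^+ n != 0 :> rat by rewrite expf_neq0.
  have r0 : r != 0 by apply/eqP => r0; case/eqP: f1; rewrite fd r0 mulr0.
  have -> : d = e * (r * c) by rewrite rc mulrA sg mul1r.
  rewrite fd; move: (4 ^+ n) p4 => q p4.
  transitivity (e * e * (a / (q * b ^+ 2))); first by rewrite sg mul1r.
  by field; rewrite u2 u6 r0 f0 p4.
rewrite WE exprMn -mulrA in A.
apply: (exp_form_congr p_pr A).
have u1 := punit_fact p_pr p_gt3 n1; have u3 := punit_fact p_pr p_gt3 n2.
have ub : punit (((-1) ^+ n * (n`!%:R / (2 * n)`!%:R)) ^+ 2).
  rewrite exprMn sqrr_sign mul1r; apply: punitX => //; apply: punitM => //; exact: punitV.
have := exp_formZ p_pr ub R.
rewrite (_ : _ * _ ^+ 2 = 'C(3 * n, n)%:R ^+ 2) //.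
rewrite exprMn sqrr_sign mul1r bin_fact_rat; last by lia.
rewrite (_ : 3 * n - n = 2 * n)%N; last by lia.
by field; rewrite f0 f1.
Qed.

(** Here -p/3 + 2 (m + 1) is exactly 1/3, and the last step has ratio -2. The factor 1 + p = 3 (2m +
    2) appears because the binomial coefficient involves (2m + 2)! and the step product (2m +
    1)!. *)
Lemma even_value_5mod6 m : p = (6 * m + 5)%N ->
  exp_form p (4 * 'C(3 * m + 2, m)%:R ^+ 2 * (1 + P) ^+ 2)
    (- (2 / 3) * harm 1 (3 * m + 2) + harm 1 (2 * m + 1)) (harm 2 (2 * m + 1) / 12)
    (hsum p (1 / 3)).
Proof.
move=> pn; have pE : p = (2 * (3 * m + 2)).+1 by lia.
have hE : (2 * m + 1 + (2 * m + 1 - m) = 3 * m + 2)%N by lia.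
have hk : (2 * m + 1 = 2 * m \/ 2 * m + 1 = (2 * m).+1)%N by right; lia.
have R := even_root_sqr p_pr p_gt3 pE hE hk.
have px : pint (- (P / 3)) by solve_pint.
have e0 : eqm 1 (- (P / 3)) 0%:R by exists (- 3^-1); [solve_pint | field].
have hn : (0 + 2 * m.+1 < p)%N by lia.
have A := hsum_steps p_pr p_gt3 pE px e0 hn.
have n2 : (2 * m < p)%N by lia.
rewrite big_nat_recr //= (step_ratio p_pr p_gt3 pE) // in A.
have EP : P = 6 * m%:R + 5 by rewrite pn natrD natrM.
rewrite (_ : - (P / 3) + _ = 1 / 3) in A; last by rewrite natrM EP -natr1; field.
have f0 := factS_neq0 m; have f1 := factS_neq0 (2 * m + 1).
have c3 : pint (- 2^-1) by solve_pint.
have c6 : pint (- 6^-1) by solve_pint.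
have k2 : (2 * m + 1 < p)%N by lia.
have n1 : (m < p)%N by lia.
have u2 := punit_neq0 (punit_shift_prod p_pr p_gt3 pE k2 c3).
have u6 := punit_neq0 (punit_shift_prod p_pr p_gt3 pE n1 c6).
have sg : (-1) ^+ m.+1 * (-1) ^+ m.+1 = 1 :> rat by rewrite -expr2 sqrr_sign.
have WE : shift_prod p (2 * m) (- 3^-1) / (4 ^+ m * shift_prod p m (- 6^-1) ^+ 2)
     * ((1 / 3 - 1) / (1 / 3)) =
    (-1) ^+ m.+1 * (6 * m`!%:R / (2 * m + 1)`!%:R) * even_root p (3 * m + 2) (2 * m + 1) m.
  have n3 : (m.+1 <= 3 * m + 2)%N by lia.
  have := rising_half_shift p_pr p_gt3 pE n3; rewrite (_ : 3 * m + 2 - m.+1 = 2 * m + 1)%N; last by lia.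
  rewrite /even_root; have := fact_double m.
  rewrite [in shift_prod p (2 * m + 1) (- 3^-1)]addn1 shift_prodS.
  have -> : (2 * m).+1%:R + P * - 3^-1 = - (2 / 3) by rewrite EP -natr1 natrM; field.
  rewrite addn1 in u2; move: f1; rewrite addn1 factS natrM risingS -natr1 natrM.
  move: (shift_prod p (2 * m) (- 3^-1)) (shift_prod p m _) (shift_prod p (2 * m).+1 _)
    (shift_prod p (3 * m + 2) _) ((-1) ^+ m.+1) (rising _ m) u2 u6 sg => a b c d e r u2 u6 sg f1 fd rc.
  have p4 : 4 ^+ m != 0 :> rat by rewrite expf_neq0.
  have /andP[m0 f1'] : (2 * m%:R + 1 != 0 :> rat) && ((2 * m)`!%:R != 0 :> rat).
    by rewrite -negb_or -mulf_eq0.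
  have r0 : r != 0 by apply/eqP => r0; case/eqP: f1'; rewrite fd r0 mulr0.
  have -> : d = e * (r * (1 / 2 + m%:R) * c) by rewrite rc mulrA sg mul1r.
  rewrite fd; move: (4 ^+ m) p4 => q p4.
  transitivity (e * e * (- 2 * a / (q * b ^+ 2))); first by rewrite sg; field; rewrite u6 p4.
  by field; rewrite u2 u6 r0 f0 p4 m0.
rewrite WE exprMn -[X in eqm 3 _ X]mulrA in A.
apply: (exp_form_congr p_pr A).
have u1 := punit_fact p_pr p_gt3 n1; have u3 := punit_fact p_pr p_gt3 k2.
have ub : punit (((-1) ^+ m.+1 * (6 * m`!%:R / (2 * m + 1)`!%:R)) ^+ 2).
  rewrite exprMn sqrr_sign mul1r; apply: punitX => //; apply: punitM => //; last exact: punitV.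
  by apply: punitM => //; apply: (punit_smooth p_pr p_gt3).
have E : ((-1) ^+ m.+1 * (6 * m`!%:R / (2 * m + 1)`!%:R)) ^+ 2 *
    ((3 * m + 2)`!%:R / m`!%:R ^+ 2) ^+ 2 = 4 * 'C(3 * m + 2, m)%:R ^+ 2 * (1 + P) ^+ 2.
  rewrite exprMn sqrr_sign mul1r bin_fact_rat; last by lia.
rewrite (_ : 3 * m + 2 - m = (2 * m + 1).+1)%N; last by lia.
have -> : 1 + P = 3 * (2 * m + 1)%N.+1%:R.
  by rewrite EP -(natr1 (2 * m + 1)%N) (natrD _ (2 * m)%N 1) (natrM _ 2 m); ring.
rewrite factS natrM; have m0 : (2 * m + 1)%N.+1%:R != 0 :> rat by rewrite pnatr_eq0.
move: ((2 * m + 1)%N.+1%:R) m0 => a m0.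
by field; rewrite f0 f1 m0.
by have := exp_formZ p_pr ub R; rewrite E.
Qed.

End EvenValueCases.

(** * The numbers [U n] *)

(* [Upoly n x / n!] is the coefficient of [t^n] in [e^(x t) / (2 cosh t - 1)]. *)
Definition Upoly (n : nat) (x : rat) : rat :=
  \sum_(0 <= k < n.+1) 'C(n, k)%:R * (U k)%:~R * x ^+ (n - k).

Lemma bin_mul_bin n i k : (k <= i <= n)%N ->
  ('C(n, k) * 'C(n - k, i - k) = 'C(n, i) * 'C(i, k))%N.
Proof.
case/andP=> ki ni.
have := bin_fact ni; have := bin_fact ki.
have kn := leq_trans ki ni; have := bin_fact kn.
have ink : (i - k <= n - k)%N by lia.
have := bin_fact ink; rewrite (_ : n - k - (i - k) = n - i)%N; last by lia.
have f := fact_gt0; have := f k; have := f (i - k)%N; have := f (n - i)%N; have := f (n - k)%N.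
have := f i.
set a := 'C(n, k); set b := 'C(n - k, _); set c := 'C(n, i); set d := 'C(i, k).
set x := k`!; set y := (i - k)`!; set z := (n - i)`!; set w := (n - k)`!; set v := i`!.
move=> v0 w0 z0 y0 x0 E1 E2 E3 E4.
have E : (a * b * (x * y * z) = c * d * (x * y * z))%N.
  by transitivity n`!; [rewrite -E2 -E1; ring | rewrite -E4 -E3; ring].
by apply/eqP; move/eqP: E; rewrite eqn_pmul2r // !muln_gt0 x0 y0.
Qed.

(** Addition formula of an Appell sequence: binomial theorem, trinomial revision, exchange of
    sums. *)
Lemma Upoly_add n x y :
  Upoly n (x + y) = \sum_(0 <= i < n.+1) 'C(n, i)%:R * Upoly i y * x ^+ (n - i).
Proof.
transitivity (\sum_(0 <= k < n.+1) \sum_(0 <= i < n.+1 | (k <= i)%N)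
    'C(n, i)%:R * 'C(i, k)%:R * (U k)%:~R * y ^+ (i - k) * x ^+ (n - i)).
  apply: eq_big_nat => k /andP[_ kn].
  rewrite exprDn -(big_mkord xpredT (fun j => x ^+ (n - k - j) * y ^+ j *+ 'C(n - k, j))).
  rewrite big_distrr /= [RHS]big_mkcond.
  rewrite [RHS](big_cat_nat (n := k)) //=; last exact: ltnW.
  rewrite [X in X + _]big_nat_cond [X in X + _]big1 ?add0r; last first.
    by move=> i /andP[/andP[_ ik] _]; rewrite leqNgt ik.
  rewrite -[X in _ = \sum_(X <= _ < _) _]add0n big_addn (_ : n.+1 - k = (n - k).+1)%N; last by lia.
  apply: eq_big_nat => j hj; rewrite leq_addl addnK.
  have E : 'C(n, k)%:R * 'C(n - k, j)%:R = 'C(n, j + k)%:R * 'C(j + k, k)%:R :> rat.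
    by rewrite -!natrM -bin_mul_bin ?addnK //; lia.
  rewrite (_ : n - k - j = n - (j + k))%N; last by lia.
  transitivity ('C(n, k)%:R * 'C(n - k, j)%:R * (U k)%:~R * y ^+ j * x ^+ (n - (j + k)));
    by [rewrite -mulr_natr; ring | rewrite E].
rewrite (exchange_big_dep_nat xpredT) //=; apply: eq_big_nat => i /andP[_ hi].
rewrite /Upoly big_distrr big_distrl /= [LHS]big_mkcond.
rewrite (big_cat_nat (n := i.+1)) //= [X in _ + X]big_nat_cond [X in _ + X]big1 ?addr0; last first.
  by move=> k /andP[/andP[ik _] _]; rewrite leqNgt ik.
by apply: eq_big_nat => k /andP[_ ki]; rewrite -ltnS ki; ring.
Qed.

Lemma U_odd0 k : odd k -> U k = 0.
Proof. by rewrite /U => ->. Qed.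

Lemma Upoly0 n : Upoly n 0 = (U n)%:~R.
Proof.
rewrite /Upoly big_nat_recr //= binn subnn expr0 mulr1 mul1r big_nat_cond big1 ?add0r //.
by move=> k /andP[/andP[_ kn] _]; rewrite expr0n subn_eq0 leqNgt kn mulr0.
Qed.

(** Coefficients of (e^t + e^(-t) - 1) times 1/(2 cosh t - 1): for even n > 0 this is the recurrence
    defining [U], for odd n all terms vanish by parity. *)
Lemma Upoly_rec0 n : Upoly n 1 + Upoly n (-1) - Upoly n 0 = (n == 0)%:R.
Proof.
rewrite Upoly0.
have -> : Upoly n 1 + Upoly n (-1) = \sum_(0 <= k < n.+1) 'C(n, k)%:R * (U k)%:~R * (1 + (-1) ^+ (n - k)).
  by rewrite -big_split /=; apply: eq_bigr => k _; rewrite expr1n; ring.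
have [on|en] := boolP (odd n).
  rewrite U_odd0 // big_nat_cond big1 => [|k /andP[/andP[_ kn] _]]; first by case: n on.
  have [ok|ek] := boolP (odd k); first by rewrite (U_odd0 ok) mulr0 mul0r.
  by rewrite -signr_odd oddB // on (negbTE ek) subrr mulr0.
have [q nE] : exists q, n = (2 * q)%N by exists n./2; rewrite mul2n even_halfK.
case: q nE => [|q] ->; first by rewrite big_nat1 U0.
rewrite big_ltn // big_even_odd [X in _ + (_ + X)]big1 ?addr0 => [|i _]; last first.
  by rewrite U_odd0 ?mulr0 ?mul0r //= mul2n odd_double.
have -> : (2 * q.+1 == 0 = false)%N by [].
have sgn i : (i <= q.+1)%N -> (-1) ^+ (2 * q.+1 - 2 * i) = 1 :> rat.
  by move=> hi; rewrite -mulnBr exprM sqrrN !expr1n.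
rewrite big_nat_recr //= binn subnn expr0.
have := congr1 (fun z : int => z%:~R : rat) (U_even (isT : (0 < q.+1)%N)).
rewrite rmorphM rmorph_sum /= big_nat_recr //= subnn U0 binn mulr1 => E.
pose T : rat := \sum_(1 <= i < q.+1) 'C(2 * q.+1, 2 * i)%:R * (U (2 * i))%:~R.
have {}E : (U (2 * q.+1))%:~R = - 2 * (T + 1) :> rat.
  rewrite E; congr (_ * (_ + _)); rewrite /T big_nat_rev /=; apply: eq_big_nat => i hi.
  rewrite rmorphM /= -[in LHS]bin_sub; last by lia.
  by congr ('C(_, _)%:~R * (U _)%:~R); lia.
have -> : \sum_(1 <= i < q.+1) 'C(2 * q.+1, 2 * i)%:R * (U (2 * i))%:~R * (1 + (-1) ^+ (2 * q.+1 - 2 * i))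
    = 2 * T.
  by rewrite big_distrr /=; apply: eq_big_nat => i hi; rewrite sgn; [ring | lia].
have s0 := sgn 0%N isT; rewrite muln0 in s0; rewrite bin0 s0 E ?U0 mulr1; ring.
Qed.

Lemma Upoly_rec n x : Upoly n (x + 1) + Upoly n (x - 1) - Upoly n x = x ^+ n.
Proof.
have E : Upoly n x = \sum_(0 <= i < n.+1) 'C(n, i)%:R * Upoly i 0 * x ^+ (n - i).
  by rewrite -Upoly_add addr0.
rewrite E !Upoly_add -big_split -sumrB /= big_ltn //= big_nat_cond big1 ?addr0 => [|i].
  have := Upoly_rec0 0; rewrite /= => R0; rewrite bin0 subn0.
  by transitivity ((Upoly 0 1 + Upoly 0 (-1) - Upoly 0 0) * x ^+ n); [ring | rewrite R0 mul1r].
case/andP=> /andP[i0 _] _.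
transitivity ('C(n, i)%:R * (Upoly i 1 + Upoly i (-1) - Upoly i 0) * x ^+ (n - i)); first by ring.
by rewrite Upoly_rec0; case: i i0 => // i _; rewrite mulr0 mul0r.
Qed.

Lemma Upoly_opp n x : ~~ odd n -> Upoly n (- x) = Upoly n x.
Proof.
move=> en; apply: eq_big_nat => k /andP[_ kn].
have [ok|ek] := boolP (odd k); first by rewrite U_odd0 // mulr0 !mul0r.
by rewrite exprNn -signr_odd oddB // (negbTE en) (negbTE ek) mul1r.
Qed.

(** Solution of s (j + 2) = s (j + 1) - s (j) starting with 0, 1. As [Upoly_rec] writes x^n by the
    same three-term pattern, sums of powers weighted by it telescope. *)
Definition sign6 (j : nat) : rat := [:: 0; 1; 1; 0; - 1; - 1]`_(j %% 6).

Lemma sign6SS j : sign6 j.+2 = sign6 j.+1 - sign6 j.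
Proof.
rewrite /sign6 -[j.+2]addn2 -[j.+1]addn1 -(modnDml j 2) -(modnDml j 1).
by have := ltn_pmod j (isT : (0 < 6)%N); move: (j %% 6)%N; do 6?[case => //].
Qed.

Lemma sum_by_parts n N :
  \sum_(1 <= j < N.+1) sign6 j * j%:R ^+ n =
  sign6 N * Upoly n N.+1%:R - sign6 N.+1 * Upoly n N%:R + Upoly n 0.
Proof.
elim: N => [|N IHN].
  by rewrite big_geq // /sign6 /=; ring.
rewrite big_nat_recr //= IHN sign6SS -(Upoly_rec n N.+1%:R).
have -> : N.+1%:R + 1 = N.+2%:R :> rat by rewrite natr1.
have -> : N.+1%:R - 1 = N%:R :> rat by rewrite -natr1 addrK.
ring.
Qed.

(** * The number U_(p-3) modulo [p] *)

Section UCongruence.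
Variables (p : nat) (p_pr : prime p) (p_gt3 : (3 < p)%N).
Local Notation P := (p%:R : rat).
Local Notation pint := (pint p).
Local Notation eqm := (eqm p).

Lemma eqm_Upoly k n x y : pint y -> eqm k x y -> eqm k (Upoly n x) (Upoly n y).
Proof.
move=> hy hxy; apply: eqm_sum => // i _; apply: (eqm_mull p_pr); first by solve_pint.
exact: eqmX.
Qed.

Lemma fermat_eqm a : (0 < a < p)%N -> eqm 1 (a%:R ^+ p.-1) 1.
Proof.
move=> ha; have ua := punit_range p_pr ha.
apply: (eqm_cancel p_pr ua); rewrite -exprS prednK ?prime_gt0 // mulr1.
have := congr1 (fun x => x%:R : rat) (divn_eq a p).
have := congr1 (fun x => x%:R : rat) (divn_eq (a ^ p) p).
rewrite (fermat_little a p_pr) !natrD !natrM natrX => -> E.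
rewrite [X in eqm 1 _ X]E.
by exists ((a ^ p %/ p)%:R - (a %/ p)%:R); [solve_pint | ring].
Qed.

Lemma pint_sign6 j : pint (sign6 j).
Proof.
rewrite /sign6; have := ltn_pmod j (isT : (0 < 6)%N).
by move: (j %% 6)%N; do 6?[case => /= [_|]; first by solve_pint].
Qed.

Variable m : nat.
Hypothesis pm : p = (6 * m + 5)%N.

(** Summation by parts with exponent p - 3, where the power of j is j^(-2) modulo [p]. The end terms
    are values at p and p - 1, congruent to 0 and -1, and evenness makes the value at -1 half of
    that at 0. *)
Lemma U_half_congr : eqm 1 ((U (p - 3))%:~R / 2) (\sum_(1 <= j < p) sign6 j * j%:R ^- 2).
Proof.
pose n := (p - 3)%N.
have en : ~~ odd n by rewrite /n pm; lia.
have n0 : (n == 0)%N = false by rewrite /n; lia.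
have V1 : Upoly n 1 = Upoly n 0 / 2.
  by have := Upoly_rec0 n; rewrite Upoly_opp // n0 => /eqP; rewrite subr_eq0 => /eqP <-; field.
have A := sum_by_parts n p.-1; rewrite prednK ?prime_gt0 // in A.
have e1 : sign6 p.-1 = -1.
  by rewrite /sign6 (_ : p.-1 = m * 6 + 4)%N ?modnMDl //; lia.
have e2 : sign6 p = -1.
  by rewrite /sign6 (_ : p = m * 6 + 5)%N ?modnMDl //; lia.
rewrite e1 e2 in A.
have B1 : eqm 1 (Upoly n P) (Upoly n 0).
  by apply: eqm_Upoly; [exact: pint0 | exists 1; [exact: pint1 | ring]].
have B2 : eqm 1 (Upoly n (p.-1)%:R) (Upoly n 0 / 2).
  rewrite -V1 -(Upoly_opp 1 en); apply: eqm_Upoly; first by solve_pint.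
  by rewrite -subn1 natrB ?prime_gt0 //; exists 1; [exact: pint1 | ring].
apply: (eqm_trans p_pr (y := \sum_(1 <= j < p) sign6 j * j%:R ^+ n)).
  have := eqmD p_pr (eqmD p_pr (eqmN p_pr B1) B2) (eqm_refl p_pr 1 (Upoly n 0)).
  rewrite A -Upoly0 => H; apply: eqm_sym => //.
  rewrite (_ : _ + Upoly n 0 = - Upoly n P + Upoly n (p.-1)%:R + Upoly n 0); last by ring.
  by rewrite (_ : Upoly n 0 / 2 = - Upoly n 0 + Upoly n 0 / 2 + Upoly n 0) //; field.
apply: eqm_sum_nat => // j hj; apply: (eqm_mull p_pr); first exact: pint_sign6.
have [j0 hjj hjV] := punit_range p_pr hj.
have -> : j%:R ^+ n = j%:R ^- 2 * j%:R ^+ p.-1 :> rat.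
  by rewrite (_ : p.-1 = 2 + n)%N ?exprD ?mulKf ?expf_neq0 // /n; lia.
rewrite -[X in eqm 1 _ X]mulr1; apply: (eqm_mull p_pr); first by solve_pint.
exact: fermat_eqm.
Qed.

Lemma sum_sign6 (f : nat -> rat) q :
  \sum_(1 <= j < (6 * q + 5)%N) sign6 j * f j =
  \sum_(0 <= i < q.+1) f (6 * i + 1)%N + \sum_(0 <= i < q.+1) f (6 * i + 2)%N
  - \sum_(0 <= i < q.+1) f (6 * i + 4)%N - \sum_(0 <= i < q) f (6 * i + 5)%N.
Proof.
have sg i r : (r < 6)%N -> sign6 (6 * i + r) = sign6 r.
  by move=> hr; rewrite /sign6 mulnC modnMDl.
elim: q => [|q IHq].
  rewrite !big_nat1 [X in _ - X]big_geq // muln0 !add0n.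
  by rewrite 4?big_ltn // big_geq // /sign6 /=; ring.
rewrite (_ : 6 * q.+1 + 5 = (6 * q + 5).+4.+2)%N; last by lia.
have E : \sum_(1 <= j < (6 * q + 5).+4.+2) sign6 j * f j =
   \sum_(1 <= j < (6 * q + 5)%N) sign6 j * f j + sign6 (6 * q + 5) * f (6 * q + 5)%N
   + sign6 (6 * q.+1 + 0) * f (6 * q + 5).+1 + sign6 (6 * q.+1 + 1) * f (6 * q.+1 + 1)%N
   + sign6 (6 * q.+1 + 2) * f (6 * q.+1 + 2)%N + sign6 (6 * q.+1 + 3) * f (6 * q.+1 + 3)%N
   + sign6 (6 * q.+1 + 4) * f (6 * q.+1 + 4)%N.
  rewrite 6?big_nat_recr //=; try lia.
  by do 5?[congr (_ + _)]; try (congr (sign6 _ * f _); lia).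
rewrite E IHq !sg // ![\sum_(0 <= i < q.+2) _]big_nat_recr //= [X in _ = _ - X]big_nat_recr //=.
rewrite /sign6 /=; ring.
Qed.

(** The reflection i -> p - i exchanges the classes r and 5 - r modulo 6: classes 1 and 4 cancel, 2
    and 5 become 3 and 0. Class 0 is [harm 2 m / 36], and 9 times class 3 is the odd part of
    [harm 2 (2 * m + 1)]. *)
Lemma U_congr : eqm 1 (U (p - 3))%:~R (- harm 2 (2 * m + 1) / 3).
Proof.
pose f (j : nat) : rat := j%:R ^- 2.
pose h := (3 * m + 2)%N; have pE : p = (2 * h).+1 by rewrite /h; lia.
have hE : (2 * m + 1 + (2 * m + 1 - m) = h)%N by rewrite /h; lia.
have hk : (2 * m + 1 = 2 * m \/ 2 * m + 1 = (2 * m).+1)%N by right; lia.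
have R (b d n : nat) : (0 < b)%N -> (0 < d)%N -> (b + 6 * n + d = p + 6)%N ->
  eqm 1 (\sum_(0 <= i < n) f (6 * i + b)%N) (\sum_(0 <= i < n) f (6 * i + d)%N).
  move=> b0 d0 E; rewrite big_nat_rev /=; apply: eqm_sum_nat => // i hi.
  rewrite (_ : 6 * (0 + n - i.+1) + b = p - (6 * i + d))%N; last by lia.
  by apply: reflect_inv2 => //; lia.
have S := harm2_sixth p_pr p_gt3 pE hE hk.
have D1 : harm 2 (2 * m + 1) = harm 2 m / 4 + 9 * \sum_(0 <= i < m.+1) f (6 * i + 3)%N.
  rewrite addn1 {1}/harm big_nat_recr //= big_even_odd /= harm_scale -addrA -big_nat_recr //=.
  congr (_ + _); first by field.
  rewrite big_distrr /=; apply: eq_bigr => i _.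
  rewrite /f (_ : 6 * i + 3 = 3 * (2 * i).+1)%N; last by lia.
  by rewrite natrMVn; field; rewrite -natrM nat1r pnatr_eq0.
have D2 : \sum_(0 <= i < m) f (6 * i + 6)%N = harm 2 m / 36.
  transitivity (\sum_(1 <= i < m.+1) (6 * i)%:R ^- 2 : rat); last by rewrite harm_scale; field.
  by rewrite big_add1; apply: eq_bigr => i _; rewrite /f mulnS addnC.
have c2 := pint_nat p_pr 2.
rewrite (_ : (U (p - 3))%:~R = 2 * ((U (p - 3))%:~R / 2)); last by field.
apply: (eqm_trans p_pr (eqm_mull p_pr c2 U_half_congr)).
rewrite -/f [in X in \sum_(1 <= j < X) _]pm (sum_sign6 f).
have R1 : eqm 1 (\sum_(0 <= i < m.+1) f (6 * i + 1)%N) (\sum_(0 <= i < m.+1) f (6 * i + 4)%N).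
  by apply: R; lia.
have R2 : eqm 1 (\sum_(0 <= i < m.+1) f (6 * i + 2)%N) (\sum_(0 <= i < m.+1) f (6 * i + 3)%N).
  by apply: R; lia.
have R3 : eqm 1 (\sum_(0 <= i < m) f (6 * i + 5)%N) (\sum_(0 <= i < m) f (6 * i + 6)%N).
  by apply: R; lia.
apply: (eqm_trans p_pr (eqm_mull p_pr c2 (eqmB p_pr (eqmB p_pr (eqmD p_pr R1 R2) (eqm_refl p_pr 1 _)) R3))).
rewrite D2; have {}D1 : \sum_(0 <= i < m.+1) f (6 * i + 3)%N = (harm 2 (2 * m + 1) - harm 2 m / 4) / 9.
  by rewrite D1; field.
rewrite D1; set q := \sum_(_ <= _ < _) _.
rewrite (_ : 2 * _ = 2 / 9 * harm 2 (2 * m + 1) + - (1 / 9) * harm 2 m); last by field.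
rewrite (_ : - harm 2 _ / 3 = 2 / 9 * harm 2 (2 * m + 1) + - (1 / 9) * (5 * harm 2 (2 * m + 1))); last by field.
by apply: eqmD => //; [exact: eqm_refl | apply: (eqm_mull p_pr _ S); solve_pint].
Qed.

End UCongruence.

(** * Jacobi sums modulo [p ^ 3] *)

Lemma eqm_int_dvd p n (a b : int) : prime p -> eqm p n a%:~R b%:~R -> (p%:Z ^+ n %| a - b)%Z.
Proof.
move=> p_pr /(rat_congr_eqm p_pr (pint_int p_pr b)) [_ _].
by rewrite -rmorphB /= numq_int -[((p ^ n)%N)%:Z]natz natrX natz.
Qed.

Lemma eqm_expp p n x y : prime p -> (0 < n)%N -> pint p x -> pint p y ->
  eqm p n x y -> eqm p n.+1 (x ^+ p) (y ^+ p).
Proof.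
move=> p_pr n0 hx hy hxy.
have h1 := eqm_weak p_pr n0 hxy.
have S : eqm p 1 (\sum_(i < p) x ^+ (p.-1 - i) * y ^+ i) 0.
  apply: (eqm_trans p_pr (y := \sum_(i < p) y ^+ p.-1)).
    apply: eqm_sum => // i _.
    have -> : y ^+ p.-1 = y ^+ (p.-1 - i) * y ^+ i.
      by rewrite -exprD subnK // -ltnS prednK ?prime_gt0.
    by apply: (eqm_mulr p_pr); [solve_pint | exact: eqmX].
  rewrite sumr_const card_ord -mulr_natl.
  by exists (y ^+ p.-1); [solve_pint | ring].
case: hxy S => u hu xE [v hv vE].
exists (u * v); first by solve_pint.
have := subrXX x y p => /eqP; rewrite subr_eq => /eqP ->.
have xy : x - y = p%:R ^+ n * u by rewrite xE; ring.
by rewrite vE xy expr1 exprS; ring.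
Qed.

Section Teichmuller.
Variables (p : nat) (p_pr : prime p) (p_gt3 : (3 < p)%N).
Local Notation R := 'Z_(p ^ 3).
Local Notation K := 'F_p.

Let p3_gt1 : (1 < p ^ 3)%N.
Proof. by rewrite -(exp1n 3) ltn_exp2r // prime_gt1. Qed.

Lemma natr_R (a : nat) : a%:R = 0 :> R -> (p ^ 3 %| a)%N.
Proof. by move/(congr1 val); rewrite /= val_Zp_nat // => /eqP. Qed.

Lemma pcube0 : (p%:R : R) ^+ 3 = 0.
Proof. by rewrite -natrX; apply: pchar_Zp. Qed.

Lemma natr_R_mod a b : a = b %[mod p ^ 3] -> a%:R = b%:R :> R.
Proof. by move=> E; apply: val_inj; rewrite /= !val_Zp_nat. Qed.

Lemma intr_R (z : int) : z%:~R = 0 :> R -> (p%:Z ^+ 3 %| z)%Z.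
Proof.
have -> : p%:Z ^+ 3 = (p ^ 3)%N%:Z by rewrite -[((p ^ 3)%N)%:Z]natz natrX natz.
case: z => n; first by move/natr_R.
rewrite NegzE rmorphN /= => /eqP; rewrite oppr_eq0 => /eqP/natr_R.
by rewrite dvdzE abszN.
Qed.

Lemma eqm_of_R (a b : int) : a%:~R = b%:~R :> R -> eqm p 3 a%:~R b%:~R.
Proof. by move=> E; apply: eqm_int => //; apply: intr_R; rewrite rmorphB /= E subrr. Qed.

Definition red (r : R) : K := (val r)%:R.

Lemma red_nat (a : nat) : red a%:R = a%:R.
Proof.
rewrite /red /= val_Zp_nat //; apply: val_inj; rewrite /= !val_Fp_nat //.
by rewrite modn_dvdm // dvdn_exp.
Qed.

Lemma R_nat (r : R) : r = (val r)%:R.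
Proof. by rewrite natr_Zp. Qed.

Lemma redD r s : red (r + s) = red r + red s.
Proof. by rewrite (R_nat r) (R_nat s) -natrD !red_nat natrD. Qed.

Lemma redM r s : red (r * s) = red r * red s.
Proof. by rewrite (R_nat r) (R_nat s) -natrM !red_nat natrM. Qed.

Lemma red1 : red 1 = 1. Proof. exact: (red_nat 1). Qed.
Lemma red0 : red 0 = 0. Proof. exact: (red_nat 0). Qed.

Lemma redN r : red (- r) = - red r.
Proof. by apply/eqP; rewrite -subr_eq0 opprK -redD addNr red0. Qed.

Lemma redB r s : red (r - s) = red r - red s.
Proof. by rewrite redD redN. Qed.

Lemma redX r n : red (r ^+ n) = red r ^+ n.
Proof. by elim: n => [|n IHn]; rewrite ?expr0 ?red1 // !exprS redM IHn. Qed.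

Lemma nat_R_unit a : ((a%:R : R) \is a GRing.unit) = (a%:R != 0 :> K).
Proof.
rewrite unitZpE // coprime_pexpl // prime_coprime //; congr (~~ _).
by rewrite -(dvdn_pcharf (pchar_Fp p_pr)).
Qed.

Lemma R_unit r : (r \is a GRing.unit) = (red r != 0).
Proof. by rewrite {1}(R_nat r) nat_R_unit. Qed.

Lemma red_eq0 r : red r = 0 -> exists s, r = p%:R * s.
Proof.
rewrite /red => /eqP; rewrite -(dvdn_pcharf (pchar_Fp p_pr)) => /dvdnP[q E].
by exists q%:R; rewrite (R_nat r) E natrM mulrC.
Qed.

Lemma red_exp r s : red r = red s -> r ^+ (p ^ 2) = s ^+ (p ^ 2).
Proof.
move=> E; rewrite (R_nat r) (R_nat s) -!natrX; apply: natr_R_mod.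
have E1 : eqm p 1 (val r)%:R (val s)%:R.
  have : (val r = val s %[mod p])%N by move/(congr1 val): E; rewrite /= !val_Fp_nat.
  move=> H; have := @eqm_int p p_pr 1 (val r)%:Z (val s)%:Z; apply.
  by rewrite expr1 -eqz_mod_dvd !modz_nat H.
have E3 := eqm_expp p_pr (isT : (0 < 2)%N) (pintX p_pr p (pint_nat p_pr (val r)))
  (pintX p_pr p (pint_nat p_pr (val s)))
  (eqm_expp p_pr (isT : (0 < 1)%N) (pint_nat p_pr (val r)) (pint_nat p_pr (val s)) E1).
rewrite -!exprM mulnn in E3; rewrite -!natrX in E3.
have := @eqm_int_dvd p 3 (val r ^ (p ^ 2))%N%:Z (val s ^ (p ^ 2))%N%:Z p_pr E3.
have -> : p%:Z ^+ 3 = (p ^ 3)%N%:Z by rewrite -[((p ^ 3)%N)%:Z]natz natrX natz.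
by rewrite -eqz_mod_dvd !modz_nat => /eqP[].
Qed.

(** Teichmuller lift to Z/p^3: by [red_exp] the choice of the representative [val x] is immaterial,
    which makes the lift multiplicative. *)
Definition teich (x : K) : R := (val x)%:R ^+ (p ^ 2).

Lemma p2_gt0 : (0 < p ^ 2)%N. Proof. by rewrite expn_gt0 prime_gt0. Qed.

Lemma K_nat (x : K) : (val x)%:R = x. Proof. exact: natr_Zp. Qed.

Lemma K_expp (x : K) : x ^+ (p ^ 2) = x.
Proof.
have E (y : K) : y ^+ p = y by rewrite -[RHS]expf_card card_Fp.
by rewrite -mulnn exprM !E.
Qed.

Lemma red_teich x : red (teich x) = x.
Proof. by rewrite /teich redX red_nat K_nat K_expp. Qed.

Lemma teich_red r : teich (red r) = r ^+ (p ^ 2).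
Proof. by rewrite /teich; apply: red_exp; rewrite red_nat K_nat. Qed.

Lemma teichM x y : teich (x * y) = teich x * teich y.
Proof.
by rewrite -[x]K_nat -[y]K_nat -!red_nat -redM !teich_red exprMn.
Qed.

Lemma teich1 : teich 1 = 1. Proof. by rewrite -red1 teich_red expr1n. Qed.

Lemma teich0 : teich 0 = 0.
Proof. by rewrite -red0 teich_red expr0n; case: (p ^ 2)%N p2_gt0. Qed.

Lemma teichX x n : teich (x ^+ n) = teich x ^+ n.
Proof. by elim: n => [|n IHn]; rewrite ?expr0 ?teich1 // !exprS teichM IHn. Qed.

Lemma teichN1 : teich (-1) = -1.
Proof.
have op : odd p by case: (even_prime p_pr) => // p2; move: p_gt3; rewrite p2.
by rewrite -red1 -redN teich_red -signr_odd oddX op orbT.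
Qed.

(** Makes the lift of 1 - x a polynomial in the lift of x, as binomial expansion requires. *)
Lemma sub1_teich x : (1 - teich x) ^+ (p ^ 2) = teich (1 - x).
Proof. by rewrite -teich_red redB red1 red_teich. Qed.

Lemma K_fermat (x : K) : x != 0 -> x ^+ p.-1 = 1.
Proof.
move=> x0; apply: (mulfI x0); rewrite -exprS prednK ?prime_gt0 // mulr1.
by rewrite -[RHS]expf_card card_Fp.
Qed.

(** Otherwise X^r - 1, with r the remainder of [k] modulo p - 1, would have p - 1 roots. *)
Lemma exists_power_neq1 k : (0 < k)%N -> ~~ (p.-1 %| k)%N ->
  exists2 x : K, x != 0 & x ^+ k != 1.
Proof.
move=> k0 pk.
pose r := (k %% p.-1)%N.
have r0 : (0 < r)%N by rewrite lt0n.
have rp : (r < p.-1)%N by rewrite ltn_mod; lia.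
apply/exists_inP; apply: contraT; rewrite negb_exists => /forallP H0.
have H (x : K) : x != 0 -> ~~ (x ^+ k != 1) by move=> xn; have := H0 x; rewrite negb_and xn.
have size_r : size ('X^r - 1%:P : {poly K}) = r.+1 by rewrite size_XnsubC.
have nz : ('X^r - 1%:P : {poly K}) != 0 by rewrite -size_poly_gt0 size_r.
have := max_poly_roots (rs := enum (predC1 (0 : K))) nz _ (enum_uniq _).
rewrite -cardE cardC1 card_Fp // size_r ltnS => M.
have : (p.-1 <= r)%N; last by rewrite leqNgt rp.
apply: M; apply/allP => x; rewrite mem_enum => xn0.
have := H x xn0; rewrite negbK => /eqP xk.
rewrite rootE !hornerE subr_eq0; apply/eqP.
by rewrite -[RHS]xk (divn_eq k p.-1) exprD mulnC exprM K_fermat // expr1n mul1r.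
Qed.

(** Orthogonality by rescaling with some x0. Since Z/p^3 has zero divisors, the factor cancelled
    must be a unit; it is, its residue being nonzero. *)
Lemma sum_teich k : (0 < k)%N ->
  \sum_x teich x ^+ k = if (p.-1 %| k)%N then p.-1%:R else 0.
Proof.
move=> k0; have E : \sum_x teich x ^+ k = \sum_(x | x != 0) teich x ^+ k.
  by rewrite (bigD1 0) //= teich0 expr0n eqn0Ngt k0 add0r.
case: ifP => pk.
  rewrite E (eq_bigr (fun _ => 1)) => [|x x0]; last first.
    by case/dvdnP: pk => q ->; rewrite mulnC exprM -!teichX K_fermat // expr1n teich1.
  rewrite sumr_const; congr _%:R.
  by rewrite (eq_card (B := predC1 0)) // cardC1 card_Fp.
have [x0 x0n x0k] := exists_power_neq1 k0 (negbT pk).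
have R1 : teich x0 ^+ k * \sum_x teich x ^+ k = \sum_x teich x ^+ k.
  rewrite [RHS](reindex (fun x => x0 * x)) /=; last first.
    by exists (fun x => x0^-1 * x) => x _; rewrite ?mulKf ?mulVKf.
  by rewrite big_distrr /=; apply: eq_bigr => x _; rewrite teichM exprMn.
have U : (teich x0 ^+ k - 1) \is a GRing.unit.
  by rewrite R_unit redB redX red_teich red1 subr_eq0.
apply: (mulrI U); rewrite mulr0 mulrBl mul1r R1 subrr //.
Qed.

(* For a unit [w], [z := w ^+ (6 * m)] is 1 modulo [p], and both [z ^+ ((p ^ 2 - 1) / 2)] and
   [(15 - 10 z + 3 z ^+ 2) / 8], the Taylor polynomial of [z^(-1/2)], are square roots
   of [z^-1] that reduce to 1. *)
Lemma lagrange_power (w : R) m : p = (6 * m).+1 ->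
  8 * w ^+ (3 * m * p ^ 2) = 15 * w ^+ (3 * m) - 10 * w ^+ (9 * m) + 3 * w ^+ (15 * m).
Proof.
move=> pm; have m0 : (0 < m)%N by case: m pm => // pm; move: p_gt3; rewrite pm.
have [w0|w0] := eqVneq (red w) 0.
  have Z k : (3 <= k)%N -> w ^+ k = 0.
    have [s ->] := red_eq0 w0; move=> k3; rewrite -(subnK k3) exprD.
    by rewrite [X in _ * X]exprMn pcube0 mul0r mulr0.
  by rewrite !Z ?mulr0 ?subr0 ?addr0 //; have := p2_gt0; nia.
pose q := ((p ^ 2).-1 %/ 2)%N; pose z := w ^+ (6 * m).
have qE : (2 * q + 1 = p ^ 2)%N.
  have op : odd (p ^ 2) by rewrite oddX pm /= oddM.
  by rewrite /q; have := p2_gt0; lia.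
have rz : red z = 1.
  by rewrite /z redX (_ : 6 * m = p.-1)%N ?K_fermat //; lia.
have [s zE] : exists s, z = 1 + p%:R * s.
  have : red (z - 1) = 0 by rewrite redB rz red1 subrr.
  by case/red_eq0 => s E; exists s; rewrite -E; ring.
have z1 : z ^+ (p ^ 2) = 1 by rewrite -teich_red rz teich1.
have uz : z \is a GRing.unit by rewrite R_unit rz oner_eq0.
pose y := z ^+ q; pose c : R := 15 - 10 * z + 3 * z ^+ 2.
have yE : 8 * y = c.
  (* The difference of squares vanishes modulo p^3 and [8 * y + c] reduces to 16, so the other
     factor is 0. *)
  have U : (8 * y + c) \is a GRing.unit.
    have ry : red y = 1 by rewrite [LHS]redX rz expr1n.
    rewrite R_unit redD redM ry /c !redD redN !redM rz !red_nat !mulr1.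
    have -> : 8 + (15 - 10 + 3) = 16%:R :> K by ring.
    have := ndvd_smooth p_pr p_gt3 (isT : (0 < 16)%N) isT.
    by rewrite (dvdn_pcharf (pchar_Fp p_pr)).
  have E : (8 * y - c) * (8 * y + c) = 0.
    apply: (mulIr uz); rewrite mul0r.
    have yy : y ^+ 2 * z = 1 by rewrite /y -exprM -exprSr (_ : (q * 2).+1 = p ^ 2)%N //; lia.
    transitivity (64 * (y ^+ 2 * z) - c ^+ 2 * z); first by ring.
    rewrite yy /c zE; have := pcube0; move: (p%:R : R) => P P3.
    transitivity (- (P ^+ 3) * (s ^+ 3 * (40 - 15 * (P * s) + 9 * (P * s) ^+ 2))); first by ring.
    by rewrite P3 oppr0 mul0r.
  by apply/eqP; rewrite -subr_eq0; apply/eqP; apply: (mulIr U); rewrite E mul0r.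
transitivity (w ^+ (3 * m) * (8 * y)).
  rewrite mulrCA; congr (_ * _); rewrite /y /z -!exprM -exprD; congr (_ ^+ _).
  by rewrite -qE; lia.
rewrite yE /c /z (_ : 9 * m = 3 * m + 6 * m)%N; last by lia.
rewrite (_ : 15 * m = 3 * m + 6 * m + 6 * m)%N; last by lia.
by rewrite !exprD; ring.
Qed.

Lemma sum_residue_class (f : nat -> R) d r q : (r < d)%N ->
  \sum_(0 <= j < d * q | (j %% d == r)%N) f j = \sum_(0 <= i < q) f (d * i + r)%N.
Proof.
move=> rd; elim: q => [|q IHq]; first by rewrite muln0 !big_geq.
rewrite (big_cat_nat (n := (d * q)%N)) //=; last by rewrite leq_mul.
rewrite IHq big_nat_recr //=; congr (_ + _).
rewrite -[X in \sum_(X <= _ < _ | _) _]add0n big_addn (_ : d * q.+1 - d * q = d)%N; last by nia.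
rewrite (eq_bigl (fun i => i %% d == r)%N) => [|i]; last by rewrite mulnC addnC modnMDl.
rewrite big_mkcond (big_cat_nat (n := r)) //=; last exact: ltnW.
rewrite [X in X + _]big_nat_cond [X in X + _]big1 ?add0r => [|i]; last first.
  by case/andP=> /andP[_ ir] _; rewrite modn_small ?(ltn_trans ir) // ltn_eqF.
rewrite big_ltn // modn_small // eqxx addnC big_nat_cond big1 ?addr0 // => i.
by case/andP=> /andP[ri id] _; rewrite modn_small // gtn_eqF.
Qed.

Variable m : nat.
Hypothesis pm : p = (6 * m).+1.

Let m_gt0 : (0 < m)%N.
Proof. by case: m pm p_gt3 => // ->. Qed.

(** After binomial expansion, orthogonality keeps the j congruent to 2m modulo 6m; these are even,
    so the signs disappear. *)
Lemma alt_power_sum E q : (E < 6 * m * q)%N ->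
  \sum_x teich x ^+ (4 * m) * (1 - teich x) ^+ E =
  p.-1%:R * \sum_(0 <= i < q) 'C(E, 6 * m * i + 2 * m)%:R.
Proof.
move=> Eq.
transitivity (\sum_(0 <= j < 6 * m * q) (-1) ^+ j * 'C(E, j)%:R * \sum_x teich x ^+ (4 * m + j)).
  rewrite (eq_bigr (fun x => \sum_(0 <= j < 6 * m * q) (-1) ^+ j * 'C(E, j)%:R * teich x ^+ (4 * m + j))).
    by rewrite exchange_big /=; apply: eq_bigr => j _; rewrite big_distrr.
  move=> x _; rewrite exprDn -(big_mkord xpredT (fun j => 1 ^+ (E - j) * (- teich x) ^+ j *+ 'C(E, j))).
  rewrite [RHS](big_cat_nat (n := E.+1)) //= [X in _ = _ + X]big_nat_cond [X in _ = _ + X]big1 ?addr0.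
    rewrite big_distrr /=; apply: eq_bigr => j _.
    by rewrite expr1n (exprNn (teich x) j) -mulr_natr (exprD _ (4 * m)%N j); ring.
  by move=> j /andP[/andP[Ej _] _]; rewrite bin_small ?mulr0 ?mul0r.
rewrite big_distrr /= -(sum_residue_class (fun j => p.-1%:R * 'C(E, j)%:R)); last by lia.
rewrite [RHS]big_mkcond /=; apply: eq_bigr => j _.
rewrite sum_teich ?addn_gt0 ?muln_gt0 ?m_gt0 // pm /=.
have -> : (6 * m %| 4 * m + j)%N = ((j %% (6 * m))%N == (2 * m)%N).
  have := ltn_pmod j (_ : 0 < 6 * m)%N; rewrite muln_gt0 m_gt0 => /(_ isT).
  rewrite /dvdn -modnDmr; move: (j %% (6 * m))%N => r hr.
  have [hr2|hr2] := ltnP r (2 * m); first by rewrite modn_small; lia.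
  by rewrite (_ : 4 * m + r = (r - 2 * m) + 6 * m)%N ?modnDr ?modn_small; lia.
case: ifP => [/eqP jE|_]; last by rewrite mulr0.
have oj : ~~ odd j by rewrite (divn_eq j (6 * m)) jE; lia.
by rewrite -signr_odd (negbTE oj) mul1r mulrC.
Qed.

(* [teich x ^+ (3 * m)] is the quadratic character and [teich x ^+ (2 * m)] a cubic one. *)
Definition jac (k : nat) : R := \sum_x teich x ^+ k * teich (1 - x) ^+ (3 * m).

(** The factor at 1 - x is (1 - teich x)^(3 m p^2), which [lagrange_power] replaces by the exponents
    3m, 9m, 15m; these leave one, two and three binomial coefficients. *)
Lemma jac_binomials : 8 * jac (4 * m) = p.-1%:R *
  (15 * 'C(3 * m, 2 * m)%:R - 10 * ('C(9 * m, 2 * m)%:R + 'C(9 * m, 8 * m)%:R)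
   + 3 * ('C(15 * m, 2 * m)%:R + 'C(15 * m, 8 * m)%:R + 'C(15 * m, 14 * m)%:R)).
Proof.
have E : 8 * jac (4 * m) = 15 * (\sum_x teich x ^+ (4 * m) * (1 - teich x) ^+ (3 * m))
   - 10 * (\sum_x teich x ^+ (4 * m) * (1 - teich x) ^+ (9 * m))
   + 3 * (\sum_x teich x ^+ (4 * m) * (1 - teich x) ^+ (15 * m)).
  rewrite /jac !big_distrr /= -sumrB -big_split /=; apply: eq_bigr => x _.
  by rewrite -sub1_teich -(exprM (1 - teich x)) [(p ^ 2 * _)%N]mulnC mulrCA (lagrange_power _ pm); ring.
rewrite E (@alt_power_sum (3 * m) 1) ?(@alt_power_sum (9 * m) 2) ?(@alt_power_sum (15 * m) 3); try lia.
rewrite !big_nat_recr ?big_geq //= !muln0 !muln1 !add0r !add0n.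
have -> : (6 * m + 2 * m = 8 * m)%N by lia.
have -> : (6 * m * 2 + 2 * m = 14 * m)%N by lia.
ring.
Qed.

(** For z distinct from 1, the substitution w = (1 - y z)/(1 - y) turns the argument into w up to a
    square, so the sum over all y is that of the quadratic character over w distinct from z. *)
Lemma sum_quad_twist (z : K) : z != 0 ->
  \sum_(y | y != 0) teich ((1 - y * z) * (1 - y)) ^+ (3 * m) =
  if z == 1 then p%:R - 2 else - teich z ^+ (3 * m) - 1.
Proof.
move=> z0; have k0 : (0 < 3 * m)%N by lia.
have Tz : teich 0 ^+ (3 * m) = 0 by rewrite teich0 expr0n; case: (3 * m)%N k0.
have sq (y : K) : y != 0 -> teich (y ^+ 2) ^+ (3 * m) = 1.
  move=> y0; rewrite -teichX -exprM (_ : 2 * (3 * m) = p.-1)%N; last by lia.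
  by rewrite K_fermat ?teich1.
case: eqP => [->|/eqP z1].
  rewrite (bigD1 1) ?oner_eq0 //= mulr1 subrr mul0r Tz add0r.
  rewrite (eq_bigr (fun _ => 1)) => [|y /andP[y0 y1]]; last first.
    by rewrite mulr1 -expr2 sq // subr_eq0 eq_sym.
  rewrite sumr_const.
  have -> : #|(fun i : K => (i != 0) && (i != 1))| = (p - 2)%N.
    rewrite (eq_card (B := predC (pred2 (0 : K) 1))) => [|i]; last by rewrite !inE negb_or.
    apply/eqP; rewrite -(eqn_add2l 2) subnKC; last by lia.
    have := cardC (pred2 (0 : K) 1); rewrite card2 card_Fp // eq_sym oner_eq0 /= => ->.
    exact: eqxx.
  by rewrite natrB // prime_gt1.
have E : \sum_y teich ((1 - y * z) * (1 - y)) ^+ (3 * m) = - teich z ^+ (3 * m).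
  rewrite (bigD1 1) //= subrr mulr0 Tz add0r.
  have S0 : \sum_x teich x ^+ (3 * m) = 0.
    by rewrite sum_teich // pm /= gtnNdvd //; lia.
  rewrite (bigD1 z) //= in S0; move/eqP: S0; rewrite addrC addr_eq0 => /eqP <-.
  rewrite (reindex_onto (fun w => (1 - w) / (z - w)) (fun y => (1 - y * z) / (1 - y))) /=; last first.
    move=> y y1; have y1' : 1 - y != 0 by rewrite subr_eq0 eq_sym.
    have z1' : z - 1 != 0 by rewrite subr_eq0.
    have E1 : 1 - (1 - y * z) / (1 - y) = y * (z - 1) / (1 - y) by field.
    have E2 : z - (1 - y * z) / (1 - y) = (z - 1) / (1 - y) by field.
    by rewrite E1 E2; field; rewrite z1' y1'.
  have z1' : z - 1 != 0 by rewrite subr_eq0.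
  have F1 (j : K) : j != z -> 1 - (1 - j) / (z - j) = (z - 1) / (z - j).
    by move=> jz; field; rewrite subr_eq0 eq_sym.
  have F2 (j : K) : j != z -> 1 - (1 - j) / (z - j) * z = j * (z - 1) / (z - j).
    by move=> jz; field; rewrite subr_eq0 eq_sym.
  have F0 (j : K) : j != z -> (z - 1) / (z - j) != 0.
    by move=> jz; rewrite mulf_neq0 // invr_eq0 subr_eq0 eq_sym.
  apply: eq_big => [j|j].
    (* At j = z the inverse of 0 is 0, the substituted point is 0, and its image 1 is not z: this
       index is excluded. *)
    have [->|jz] := eqVneq j z.
      by rewrite subrr invr0 mulr0 mul0r subr0 divr1 [1 == z]eq_sym (negbTE z1) andbF.
    rewrite F1 // F2 // -subr_eq0 -oppr_eq0 opprB F1 // F0 //=.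
    have zj : z - j != 0 by rewrite subr_eq0 eq_sym.
    by apply/eqP; field; rewrite z1' zj.
  case/andP=> j1; have [->|jz] := eqVneq j z.
    by rewrite subrr invr0 mulr0 mul0r subr0 divr1 [1 == z]eq_sym (negbTE z1).
  rewrite F1 // F2 // => _.
  rewrite (_ : j * (z - 1) / (z - j) * ((z - 1) / (z - j)) = j * ((z - 1) / (z - j)) ^+ 2); last by ring.
  by rewrite teichM exprMn sq ?mulr1 // F0.
rewrite (bigD1 0) //= mul0r subr0 mul1r teich1 expr1n in E.
by rewrite -E addrC addrK.
Qed.

(** The exponents 4m and 2m give inverse cubic characters. After z -> y z the sum over y is
    quadratic: z = 1 contributes p - 2, and the other z contribute 1 + 1 through two character sums
    lacking their term at 1. *)
Lemma jac_norm : jac (4 * m) * jac (2 * m) = p%:R.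
Proof.
have k1 : (0 < 4 * m)%N by lia.
transitivity (\sum_(y | y != 0) \sum_z teich z ^+ (4 * m) * teich ((1 - y * z) * (1 - y)) ^+ (3 * m)).
  rewrite [jac (2 * m)]/jac big_distrr /= (bigD1 0) //= teich0 expr0n.
  rewrite (_ : (2 * m == 0)%N = false) ?mul0r ?mulr0 ?add0r; last by lia.
  apply: eq_bigr => y y0; rewrite /jac big_distrl /=.
  rewrite (reindex (fun z => y * z)) /=; last first.
    by exists (fun z => y^-1 * z) => z _; rewrite ?mulKf ?mulVKf.
  apply: eq_bigr => z _; rewrite !teichM !exprMn.
  have Y : teich y ^+ (4 * m) * teich y ^+ (2 * m) = 1.
    rewrite -exprD -teichX (_ : 4 * m + 2 * m = p.-1)%N; last by lia.
    by rewrite K_fermat ?teich1.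
  set a := teich y ^+ (4 * m) in Y *; set b := teich y ^+ (2 * m) in Y *.
  set c := teich z ^+ _; set d := teich _ ^+ _; set e := teich _ ^+ _.
  by transitivity (a * b * (c * (d * e))); [ring | rewrite Y mul1r].
rewrite exchange_big /= (bigD1 0) //= [X in X + _]big1 ?add0r => [|y _]; last first.
  by rewrite teich0 expr0n (_ : (4 * m == 0)%N = false) ?mul0r //; lia.
have z10 : (1 : K) != 0 by exact: oner_neq0.
rewrite (bigD1 1) //= teich1 expr1n; under eq_bigr do rewrite mul1r.
rewrite sum_quad_twist // eqxx.
rewrite (eq_bigr (fun z => - teich z ^+ (7 * m) - teich z ^+ (4 * m))) => [|z /andP[z0 z1]]; last first.
  rewrite -big_distrr /= sum_quad_twist // (negbTE z1) (_ : 7 * m = 4 * m + 3 * m)%N ?exprD; [by ring | lia].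
rewrite sumrB sumrN.
have S k : (0 < k)%N -> ~~ (6 * m %| k)%N -> \sum_(z : K | (z != 0) && (z != 1)) teich z ^+ k = -1.
  move=> k0 kd; have := sum_teich k0.
  rewrite (_ : (p.-1 %| k)%N = false); last by rewrite pm; apply: negbTE.
  rewrite (bigD1 0) //= teich0 expr0n eqn0Ngt k0 add0r (bigD1 1) //= teich1 expr1n.
  by move/eqP; rewrite addrC addr_eq0 => /eqP.
rewrite !S; try lia.
- by ring.
- by rewrite gtnNdvd; lia.
have -> : (7 * m = m + 6 * m)%N by lia.
by rewrite dvdn_addl ?dvdnn // gtnNdvd //; lia.
Qed.

End Teichmuller.

(** [p] divides a^2 y^2 - x^2 d^2, hence one of a y - x d and a y + x d. With [e] this factor,
    Brahmagupta's identity p^2 = f^2 + 3 e^2 forces e = 0. *)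
Lemma sqr_add3sqr_unique (p : nat) (x y a d : int) : prime p ->
  p%:Z = x ^+ 2 + 3 * y ^+ 2 -> p%:Z = a ^+ 2 + 3 * d ^+ 2 -> x ^+ 2 = a ^+ 2.
Proof.
move=> p_pr E1 E2; have p0 : 0 < p%:Z by rewrite ltz_nat prime_gt0.
have main (e f : int) : (p%:Z %| e)%Z -> p%:Z ^+ 2 = f ^+ 2 + 3 * e ^+ 2 -> e = 0.
  case/dvdzP => q ->; rewrite exprMn => E.
  have [->|q0] := eqVneq q 0; first by rewrite mul0r.
  have q1 : 1 <= q ^+ 2 by rewrite -gtz0_ge1 exprn_even_gt0.
  have pp : 0 < p%:Z ^+ 2 by rewrite exprn_gt0.
  have h : p%:Z ^+ 2 <= q ^+ 2 * p%:Z ^+ 2 by rewrite ler_peMl // ltW.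
  have f0 := sqr_ge0 f.
  move: (p%:Z ^+ 2) (q ^+ 2 * _) (f ^+ 2) E h f0 pp => P Q F; lia.
have fin : a * y = x * d \/ a * y = - (x * d) -> x ^+ 2 = a ^+ 2.
  move=> H; have E : (a * y) ^+ 2 = (x * d) ^+ 2 by case: H => ->; rewrite ?sqrrN.
  have : p%:Z * (y ^+ 2 - d ^+ 2) = 0.
    rewrite mulrBr {1}E2 {1}E1; move: E; rewrite !exprMn => E.
    transitivity ((a ^+ 2 * y ^+ 2) - x ^+ 2 * d ^+ 2); first by ring.
    by rewrite E subrr.
  move/eqP; rewrite mulf_eq0 gt_eqF //= subr_eq0 => /eqP yd.
  by move: E1; rewrite E2 yd => /addIr ->.
apply: fin.
have : (p%:Z %| (a * y - x * d) * (a * y + x * d))%Z.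
  apply/dvdzP; exists (y ^+ 2 - d ^+ 2).
  by rewrite [RHS]mulrBl {1}E2 E1; ring.
rewrite dvdzE abszM Euclid_dvdM // => /orP[H|H]; [left | right].
  have := main (a * y - x * d) (a * x + 3 * d * y); rewrite dvdzE H => /(_ isT) Z.
  by apply/eqP; rewrite -subr_eq0 Z // expr2 {1}E1 E2; ring.
have := main (a * y + x * d) (a * x - 3 * d * y); rewrite dvdzE H => /(_ isT) Z.
by apply/eqP; rewrite -addr_eq0 Z // expr2 {1}E1 E2; ring.
Qed.

(** P^3 is at least 7 P^2, longer than the interval allowed for [Q], so k = 0. *)
Lemma small_residue (P Q k : int) :
  7 <= P -> 0 <= Q -> Q <= 6 * P ^+ 2 -> Q - P = k * P ^+ 3 -> Q = P.
Proof.
move=> P7 Q0 Q6 kE.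
have PP : 0 < P ^+ 3 by rewrite exprn_gt0 //; lia.
have P3 : 7 * P ^+ 2 <= P ^+ 3 by rewrite exprS; apply: ler_wpM2r; [exact: sqr_ge0 | exact: P7].
have P2 : 7 * P <= P ^+ 2 by rewrite expr2; apply: ler_wpM2r; [lia | exact: P7].
have [k0|k0|k0] := ltgtP k 0.
- have : k * P ^+ 3 <= - 1 * P ^+ 3 by apply: ler_wpM2r; [exact: ltW | lia].
  rewrite -kE; move: (P ^+ 3) (P ^+ 2) PP P3 P2 Q6 => X Y; lia.
- have : 1 * P ^+ 3 <= k * P ^+ 3 by apply: ler_wpM2r; [exact: ltW | lia].
  rewrite -kE; move: (P ^+ 3) (P ^+ 2) PP P3 P2 Q6 => X Y; lia.
- by apply/eqP; rewrite -subr_eq0 kE k0 mul0r.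
Qed.

(** 2 Q is the sum of the squares of the three differences, each of size at most 2 P. *)
Lemma norm_form_bound (A B C P : int) : `|A| <= P -> `|B| <= P -> `|C| <= P ->
  let Q := A ^+ 2 + B ^+ 2 + C ^+ 2 - A * B - A * C - B * C in
  0 <= Q /\ Q <= 6 * P ^+ 2.
Proof.
move=> bA bB bC Q.
have sq (u v : int) : `|u| <= P -> `|v| <= P -> (u - v) ^+ 2 <= 4 * P ^+ 2.
  move=> hu hv; have h : `|u - v| <= 2 * P.
    by apply: le_trans (ler_normB _ _) _; lia.
  rewrite -real_normK ?num_real // (_ : 4 * _ = (2 * P) ^+ 2); last by ring.
  by rewrite ler_pXn2r // nnegrE //; lia.
have Q2 : 2 * Q = (A - B) ^+ 2 + (A - C) ^+ 2 + (B - C) ^+ 2 by rewrite /Q; ring.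
have := sq _ _ bA bB; have := sq _ _ bA bC; have := sq _ _ bB bC.
have := sqr_ge0 (A - B); have := sqr_ge0 (A - C); have := sqr_ge0 (B - C).
move: Q2; move: Q => Q.
move: ((A - B) ^+ 2) ((A - C) ^+ 2) ((B - C) ^+ 2) (P ^+ 2) => X Y Z T; lia.
Qed.

(** * Norm and trace of the Jacobi sum through integral class sums *)

Section CubicClasses.
Variables (p : nat) (p_pr : prime p) (p_gt3 : (3 < p)%N).
Local Notation R := 'Z_(p ^ 3).
Local Notation K := 'F_p.
Variable m : nat.
Hypothesis pm : p = (6 * m).+1.

Let m_gt0 : (0 < m)%N.
Proof. by case: m pm p_gt3 => // ->. Qed.

Definition legendre (y : K) : int := if y == 0 then 0 else if y ^+ (3 * m) == 1 then 1 else -1.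

Lemma teich_legendre y : teich y ^+ (3 * m) = (legendre y)%:~R.
Proof.
rewrite -teichX // /legendre; case: eqP => [->|/eqP y0].
  by rewrite expr0n (_ : (3 * m == 0)%N = false) ?teich0 //; lia.
have : (y ^+ (3 * m) - 1) * (y ^+ (3 * m) + 1) = 0.
  rewrite -subr_sqr expr1n -exprM (_ : 3 * m * 2 = p.-1)%N ?K_fermat ?subrr //; lia.
case: eqP => [->|/eqP yn]; first by rewrite teich1.
by move/eqP; rewrite mulf_eq0 subr_eq0 (negbTE yn) /= addr_eq0 => /eqP ->; rewrite teichN1.
Qed.

(** Weight of the value [u] of the cubic character x^(2m) in the Jacobi sum, taken in the integers
    to allow size and parity arguments. *)
Definition class_sum (u : K) : int := \sum_(x : K | x ^+ (2 * m) == u) legendre (1 - x).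

Lemma class_sum_bound u : `|class_sum u| <= p%:Z.
Proof.
apply: le_trans (ler_norm_sum _ _ _) _.
apply: (@le_trans _ _ (\sum_(x : K | x ^+ (2 * m) == u) 1)).
  by apply: ler_sum => x _; rewrite /legendre; do 2?case: ifP.
rewrite sumr_const natz lez_nat; apply: leq_trans (max_card _) _.
by rewrite card_Fp.
Qed.

Lemma legendre_even x y : x != 0 -> y != 0 -> (2 %| legendre x - legendre y)%Z.
Proof. by rewrite /legendre => /negbTE -> /negbTE ->; do 2?case: ifP. Qed.

Variable w : K.
Hypotheses (w3 : w ^+ 3 = 1) (w1 : w != 1).

Let w0 : w != 0.
Proof. by apply: contra_eq_neq w3 => ->; rewrite expr0n eq_sym oner_neq0. Qed.

(** Inversion exchanges the classes of w and w^2. There x is neither 0 nor 1, so each pair of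
    symbols consists of two odd numbers. *)
Lemma class_sum_even : (2 %| class_sum w - class_sum (w ^+ 2))%Z.
Proof.
have -> : class_sum (w ^+ 2) = \sum_(x : K | x ^+ (2 * m) == w) legendre (1 - x^-1).
  rewrite /class_sum (reindex_inj invr_inj); apply: eq_bigl => x.
  rewrite exprVn -[x ^+ _ == w](inj_eq invr_inj); congr (_ == _).
  by apply: (mulfI w0); rewrite -exprS w3 divff.
rewrite /class_sum -sumrB; apply: (big_ind (fun z => (2 %| z)%Z)) => //.
  by move=> u v hu hv; rewrite rpredD.
move=> x /eqP xw; have x0 : x != 0.
  apply: contraNneq w0 => x0; rewrite -xw x0 expr0n.
  by rewrite (_ : (2 * m == 0)%N = false) //; lia.
have x1 : x != 1 by apply: contraNneq w1 => x1; rewrite -xw x1 expr1n.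
apply: legendre_even; rewrite subr_eq0 eq_sym //.
by rewrite -[1]invr1 (inj_eq invr_inj).
Qed.

Lemma omega_sum : teich w ^+ 2 + teich w + 1 = 0 :> R.
Proof.
have U : (teich w - 1 : R) \is a GRing.unit.
  by rewrite R_unit // redB // red_teich // red1 // subr_eq0.
apply: (mulrI U); rewrite mulr0.
transitivity (teich w ^+ 3 - 1); first by ring.
by rewrite -teichX // w3 teich1 // subrr.
Qed.

Lemma jac_class e : (0 < e)%N -> jac p m (2 * m * e)%N =
  (class_sum 1)%:~R + (class_sum w)%:~R * teich w ^+ e
    + (class_sum (w ^+ 2))%:~R * teich w ^+ (2 * e) :> R.
Proof.
move=> e0.
have C u (c : R) : \sum_(x : K) ((x ^+ (2 * m) == u)%:R * c) * teich (1 - x) ^+ (3 * m) = (class_sum u)%:~R * c.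
  rewrite /class_sum rmorph_sum big_distrl [RHS]big_mkcond /=; apply: eq_bigr => x _.
  by rewrite teich_legendre; case: ifP => _; rewrite ?mul1r ?mul0r // mulrC.
rewrite -[(class_sum 1)%:~R]mulr1 -!C -!big_split /=; apply: eq_bigr => x _.
rewrite -!mulrDl; congr (_ * _); rewrite exprM -teichX //.
set u := x ^+ (2 * m).
have w21 : (w ^+ 2 == 1) = false.
  by apply: contraNF w1 => /eqP w2; rewrite -[w]mul1r -{1}w2 -exprSr w3.
have w2w : (w ^+ 2 == w) = false.
  by apply: contraNF w1 => /eqP w2; apply/eqP; apply: (mulfI w0); rewrite mulr1 -expr2.
have [x0|x0] := eqVneq x 0.
  have -> : u = 0 by rewrite /u x0 expr0n (_ : (2 * m == 0)%N = false) //; lia.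
  rewrite teich0 // expr0n eqn0Ngt e0 ![0 == _]eq_sym oner_eq0 (negbTE w0) expf_eq0 (negbTE w0) andbF.
  by rewrite !mul0r !addr0.
have wK : w ^+ 2 + w + 1 = 0.
  have wn : w - 1 != 0 by rewrite subr_eq0.
  apply: (mulfI wn); rewrite mulr0.
  by transitivity (w ^+ 3 - 1); [ring | rewrite w3 subrr].
have u3 : u ^+ 3 = 1.
  by rewrite /u -exprM (_ : 2 * m * 3 = p.-1)%N ?K_fermat //; lia.
have : (u - 1) * ((u - w) * (u - w ^+ 2)) = 0.
  transitivity (u ^+ 3 - (w ^+ 2 + w + 1) * u ^+ 2 + w * (w ^+ 2 + w + 1) * u - w ^+ 3).
    by ring.
  by rewrite wK u3 w3; ring.
have one_w : (1 == w) = false by rewrite eq_sym; apply: negbTE.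
have one_w2 : (1 == w ^+ 2) = false by rewrite eq_sym.
have w_w2 : (w == w ^+ 2) = false by rewrite eq_sym.
move/eqP; rewrite !mulf_eq0 !subr_eq0 => /or3P[] /eqP ->.
- by rewrite eqxx one_w one_w2 teich1 // expr1n !mul0r mul1r !addr0.
- by rewrite eqxx (negbTE w1) w_w2 !mul0r mul1r add0r addr0.
- by rewrite eqxx w21 w2w !mul0r mul1r !add0r teichX // -exprM.
Qed.

(* With A, B, C the class sums of [1, w, w ^+ 2], the norm A^2+B^2+C^2-AB-AC-BC of the Jacobi sum is
   [p] modulo [p ^ 3], hence equal to [p] by size; as B - C is even, this norm is
   a^2 + 3 d^2 with 2 a the trace, and such a representation of [p] is unique. *)
Lemma jac_trace_sqr (x y : int) : p%:Z = x ^+ 2 + 3 * y ^+ 2 ->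
  4 * x%:~R ^+ 2 = (jac p m (4 * m)%N + jac p m (2 * m)%N) ^+ 2 :> R.
Proof.
move=> pxy; pose A := class_sum 1; pose B := class_sum w; pose C := class_sum (w ^+ 2).
have J2 : jac p m (2 * m)%N = A%:~R + B%:~R * teich w + C%:~R * teich w ^+ 2 :> R.
  by rewrite -[in LHS](muln1 (2 * m)%N) jac_class.
have J4 : jac p m (4 * m)%N = A%:~R + B%:~R * teich w ^+ 2 + C%:~R * teich w :> R.
  rewrite (_ : 4 * m = 2 * m * 2)%N ?jac_class //; last by lia.
  by rewrite -(@teichX p p_pr w (2 * 2)%N) (_ : w ^+ (2 * 2) = w) // (exprS w 3) w3 mulr1.
have W := omega_sum; set W1 := teich w in J2 J4 W.
pose Q := A ^+ 2 + B ^+ 2 + C ^+ 2 - A * B - A * C - B * C.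
have QR : Q%:~R = p%:R :> R.
  rewrite -(jac_norm p_pr p_gt3 pm) J2 J4 /Q !rmorphB !rmorphD /= !rmorphXn !rmorphM /=.
  move: W (A%:~R : R) (B%:~R : R) (C%:~R : R) => W a b c.
  transitivity ((a + b * W1 ^+ 2 + c * W1) * (a + b * W1 + c * W1 ^+ 2)
    - (W1 ^+ 2 + W1 + 1) * (a * b + a * c + (b ^+ 2 + c ^+ 2) * (W1 - 1) + b * c * (W1 ^+ 2 - W1 + 1))).
    by ring.
  by rewrite W mul0r subr0.
have TR : (2 * A - B - C)%:~R = jac p m (4 * m)%N + jac p m (2 * m)%N :> R.
  rewrite J2 J4 !rmorphB rmorphM /=.
  move: W (A%:~R : R) (B%:~R : R) (C%:~R : R) => W a b c.
  transitivity (a + b * W1 ^+ 2 + c * W1 + (a + b * W1 + c * W1 ^+ 2) - (W1 ^+ 2 + W1 + 1) * (b + c)).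
    by ring.
  by rewrite W mul0r subr0.
have QE : Q = p%:Z.
  have : (p%:Z ^+ 3 %| Q - p%:Z)%Z by apply: (intr_R p_pr); rewrite rmorphB /= QR subrr.
  case/dvdzP => k kE; have p7 : 7 <= p%:Z by rewrite lez_nat pm; move: m_gt0; clear; lia.
  have [Q0 Q6] := norm_form_bound (class_sum_bound 1) (class_sum_bound w) (class_sum_bound (w ^+ 2)).
  exact: small_residue p7 Q0 Q6 kE.
have /dvdzP[d dE] : (2 %| B - C)%Z := class_sum_even.
have QD : p%:Z = (A - C - d) ^+ 2 + 3 * d ^+ 2.
  rewrite -QE /Q (_ : B = C + d * 2); first by ring.
  by rewrite -dE; ring.
rewrite -TR; have -> : 2 * A - B - C = 2 * (A - C - d).
  by rewrite (_ : B = C + d * 2); [ring | rewrite -dE; ring].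
rewrite rmorphM exprMn -!rmorphXn /= -(sqr_add3sqr_unique p_pr pxy QD).
by rewrite -[4]/((2 ^+ 2)%:~R).
Qed.

End CubicClasses.

(** Leaves Z/p^3 for rational congruences. [j] represents the Jacobi sum J; its conjugate J'
    satisfies J J' = p and (J + J')^2 = 4 x^2, and multiplication by J^2 eliminates J'. *)
Lemma jacobi_link (p m : nat) (x y : int) : prime p -> (3 < p)%N -> p = (6 * m).+1 ->
    p%:Z = x ^+ 2 + 3 * y ^+ 2 ->
  exists j : nat,
    eqm p 3 (8 * j%:R) (p.-1%:R * (15 * 'C(3 * m, 2 * m)%:R
      - 10 * ('C(9 * m, 2 * m)%:R + 'C(9 * m, 8 * m)%:R)
      + 3 * ('C(15 * m, 2 * m)%:R + 'C(15 * m, 8 * m)%:R + 'C(15 * m, 14 * m)%:R))) /\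
    eqm p 3 (4 * x%:~R ^+ 2 * j%:R ^+ 2) ((j%:R ^+ 2 + p%:R) ^+ 2).
Proof.
move=> p_pr p_gt3 pm pxy; have m0 : (0 < m)%N by case: m pm p_gt3 => // ->.
have [||g g0 g1] := exists_power_neq1 p_pr p_gt3 (k := (2 * m)%N).
- by rewrite muln_gt0.
- by rewrite pm gtnNdvd //; lia.
have w3 : (g ^+ (2 * m)) ^+ 3 = 1.
  by rewrite -exprM (_ : 2 * m * 3 = p.-1)%N ?K_fermat //; lia.
have T := jac_trace_sqr p_pr p_gt3 pm w3 g1 pxy.
have N := jac_norm p_pr p_gt3 pm; have B := jac_binomials p_pr p_gt3 pm.
set J := jac p m (4 * m)%N in T N B; pose j := val J; exists j.
have JE : J = (j%:Z)%:~R by rewrite -pmulrn natr_Zp.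
split.
  have := @eqm_of_R p p_pr (8 * j%:Z) (p.-1%:Z * (15 * 'C(3 * m, 2 * m)%:Z
      - 10 * ('C(9 * m, 2 * m)%:Z + 'C(9 * m, 8 * m)%:Z)
      + 3 * ('C(15 * m, 2 * m)%:Z + 'C(15 * m, 8 * m)%:Z + 'C(15 * m, 14 * m)%:Z))).
  rewrite !(rmorphM, rmorphD, rmorphN) /= -!pmulrn; apply.
  by move: B; rewrite JE -!pmulrn.
have := @eqm_of_R p p_pr (4 * x ^+ 2 * j%:Z ^+ 2) ((j%:Z ^+ 2 + p%:Z) ^+ 2).
rewrite !(rmorphM, rmorphD, rmorphXn) /= -!pmulrn; apply.
have JJ : J = j%:R by rewrite JE -pmulrn.
rewrite -JJ T -exprMn; congr (_ ^+ 2).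
by rewrite -N; ring.
Qed.

(** * The Jacobi sum as an exponential form *)

Section JacobiValue.
Variables (p : nat) (p_pr : prime p) (p_gt3 : (3 < p)%N).
Local Notation P := (p%:R : rat).
Local Notation pint := (pint p).
Local Notation punit := (punit p).
Local Notation eqm := (eqm p).
Local Notation shift_prod := (shift_prod p).
Local Notation exp_form := (exp_form p).

Lemma fact_shift_prod q n : (q * p)`!%:R * shift_prod n q%:R = (q * p + n)`!%:R.
Proof.
elim: n => [|n IHn]; first by rewrite (shift_prod0 p) mulr1 addn0.
by rewrite (shift_prodS p) mulrA IHn addnS factS natrM -addnS natrD natrM; ring.
Qed.

Lemma jacobi_combination (c H K s y1 y2 y3 y4 y5 : rat) :
  3 * P - 1 != 0 -> 5 * P - 1 != 0 -> 5 * P - 3 != 0 ->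
  pint c -> pint H -> pint K -> pint s ->
  pint y1 -> pint y2 -> pint y3 -> pint y4 -> pint y5 ->
  eqm 3 (9 * (3 * P - 1) * ((5 * P - 1) * (5 * P - 3)) * ((P - 1) * (15 * c
      - 10 * ((7 * P - 1) / (3 * (3 * P - 1))
                * (c * texp p (- 1 * K) ((1 / 2 + 5 / 2 * 1 ^+ 2) * s) + P ^+ 3 * y1)
            + 2 * (4 * P - 1) / (3 * (3 * P - 1))
                * (c * texp p (1 * (H - K)) (1 ^+ 2 / 2 * s) + P ^+ 3 * y2))
      + 3 * ((13 * P - 1) * (13 * P - 7) / (9 * (5 * P - 1) * (5 * P - 3))
                * (c * texp p (- 2%:R * K) ((2%:R / 2 + 5 / 2 * 2%:R ^+ 2) * s) + P ^+ 3 * y3)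
            + 4 * (7 * P - 1) * (4 * P - 1) / (9 * (5 * P - 1) * (5 * P - 3))
                * (c * texp p (H - 2 * K) (7 / 2 * s) + P ^+ 3 * y4)
            + 4 * (7 * P - 1) * (7 * P - 4) / (9 * (5 * P - 1) * (5 * P - 3))
                * (c * texp p (2%:R * (H - K)) (2%:R ^+ 2 / 2 * s) + P ^+ 3 * y5)))))
    (72 * (3 * P - 1) * ((5 * P - 1) * (5 * P - 3))
      * (- c * texp p (- (1 / 3) * H + K / 2) (s / 24))).
Proof.
move=> d3 d1 d5 hc hH hK hs hy1 hy2 hy3 hy4 hy5.
pose D := (5 * P - 1) * (5 * P - 3).
exists (c * (- 2016 - 1113 * s + 1080 * K - 405 * K ^+ 2 - 456 * H + 360 * H * K - 148 * H ^+ 2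
      + 3168 * P + 5067 * P * s - 3168 * P * K + 2295 * P * K ^+ 2 + 1536 * P * H - 2208 * P * H * K
      + 824 * P * H ^+ 2 - 8943 * P ^+ 2 * s + 2664 * P ^+ 2 * K - 4707 * P ^+ 2 * K ^+ 2
      - 1464 * P ^+ 2 * H + 4728 * P ^+ 2 * H * K - 1644 * P ^+ 2 * H ^+ 2 + 5037 * P ^+ 3 * s
      + 2961 * P ^+ 3 * K ^+ 2 - 3072 * P ^+ 3 * H * K + 1032 * P ^+ 3 * H ^+ 2)
  - 30 * (P - 1) * (7 * P - 1) * D * y1 - 60 * (P - 1) * (4 * P - 1) * D * y2
  + 3 * (P - 1) * (3 * P - 1) * ((13 * P - 1) * (13 * P - 7) * y3
     + 4 * (7 * P - 1) * (4 * P - 1) * y4 + 4 * (7 * P - 1) * (7 * P - 4) * y5)).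
  by rewrite /D; solve_pint.
rewrite /D /texp; move: (P) d3 d1 d5; clear => P d3 d1 d5.
by field; rewrite d3 d1 d5.
Qed.

Variable m : nat.
Hypothesis pm : p = (6 * m).+1.
Let m3p : (3 * m < p)%N. Proof. lia. Qed.
Let m2p : (2 * m < p)%N. Proof. lia. Qed.
Let m1p : (m < p)%N. Proof. lia. Qed.
Let m32 : (3 * m - m = 2 * m)%N. Proof. lia. Qed.
Let m_gt0 : (0 < m)%N. Proof. by case: m pm p_gt3 => // ->. Qed.

Lemma exp_form_conv c u v x c' u' v' x' : exp_form c u v x ->
  c = c' -> u = u' -> v = v' -> x = x' -> exp_form c' u' v' x'.
Proof. by move=> ? <- <- <- <-. Qed.

(** Normal form: [harm 1 m] is eliminated by [harm1_sixth], its correction going to the second slot,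
    and of the sums of inverse squares only the one up to 2m survives. *)
Lemma exp_form_reduce c a b d a' b' d' X : pint a -> pint b -> pint d ->
    pint a' -> pint b' -> pint d' ->
  exp_form c (a * harm 1 (3 * m) + b * harm 1 (2 * m) + d * harm 1 m)
    (a' * harm 2 (3 * m) + b' * harm 2 (2 * m) + d' * harm 2 m) X ->
  exp_form c ((a + d) * harm 1 (3 * m) + (b + d) * harm 1 (2 * m))
    ((b' + 5 * d' - d / 2) * harm 2 (2 * m)) X.
Proof.
move=> ha hb hd ha' hb' hd' R.
have pE : p = (2 * (3 * m)).+1 by lia.
have hE : (2 * m + (2 * m - m) = 3 * m)%N by lia.
have hk : (2 * m = 2 * m \/ 2 * m = (2 * m).+1)%N by left.
have h3 := pint_harm p_pr 1 m3p; have h2 := pint_harm p_pr 1 m2p.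
have s3 := pint_harm p_pr 2 m3p; have s2 := pint_harm p_pr 2 m2p.
rewrite (_ : _ * harm 2 (2 * m) = (b' + 5 * d') * harm 2 (2 * m) + - (d / 2 * harm 2 (2 * m))); last by ring.
apply: exp_form_shift => //; try solve_pint.
apply: (exp_form_eq p_pr p_gt3 R); try solve_pint.
  rewrite (_ : _ + P * _ = a * harm 1 (3 * m) + b * harm 1 (2 * m)
    + d * (harm 1 (2 * m) + harm 1 (3 * m) - P / 2 * harm 2 (2 * m))); last by field.
  apply: eqmD => //; first exact: eqm_refl.
  by apply: (eqm_mull p_pr hd); apply: harm1_sixth.
rewrite (_ : (b' + 5 * d') * harm 2 (2 * m) = a' * 0 + b' * harm 2 (2 * m) + d' * (5 * harm 2 (2 * m))); last by field.
apply: eqmD => //.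
  by apply: eqmD => //; [apply: (eqm_mull p_pr ha'); apply: harm2_half | exact: eqm_refl].
by apply: (eqm_mull p_pr hd'); apply: (harm2_sixth p_pr p_gt3 pE hE hk).
Qed.

Let H := harm 1 (3 * m).
Let K := harm 1 (2 * m).
Let s := harm 2 (2 * m).
Let c : rat := 'C(3 * m, m)%:R.

Let cE : c = (3 * m)`!%:R / (m`!%:R * (2 * m)`!%:R).
Proof. by rewrite /c bin_fact_rat; [congr (_ / (_ * _`!%:R)); lia | lia]. Qed.

Let f0 := factS_neq0 m.
Let f2 := factS_neq0 (2 * m).

(** For natural x = q, [ratio1] and [ratio2] are the binomial coefficients of q p + 3m over 2m and
    over m. *)
Definition ratio1 x := (2 * m)`!%:R^-1 * (shift_prod (3 * m) x / shift_prod m x).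
Definition ratio2 x := m`!%:R^-1 * (shift_prod (3 * m) x / shift_prod (2 * m) x).

Lemma exp_form_ratio1 x : pint x ->
  exp_form c (- x * K) ((x / 2 + 5 / 2 * x ^+ 2) * s) (ratio1 x).
Proof.
move=> hx; have ub := punitV (punit_fact p_pr p_gt3 m2p).
have R := exp_formZ p_pr ub (exp_formM p_pr p_gt3 (exp_form_shift_prod p_pr p_gt3 m3p hx)
  (exp_formV p_pr p_gt3 (exp_form_shift_prod p_pr p_gt3 m1p hx))).
apply: (exp_form_conv (exp_form_reduce (a := x) (b := 0) (d := - x) (a' := - (x ^+ 2 / 2)) (b' := 0)
  (d' := x ^+ 2 / 2) _ _ _ _ _ _ (exp_form_conv R erefl _ _ erefl))); try solve_pint.
- by ring.
- by field.
- by rewrite -/c cE; field; rewrite f0 f2.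
- by rewrite /K; ring.
- by rewrite /s; field.
- by [].
Qed.

Lemma exp_form_ratio2 x : pint x ->
  exp_form c (x * (H - K)) (x ^+ 2 / 2 * s) (ratio2 x).
Proof.
move=> hx; have ub := punitV (punit_fact p_pr p_gt3 m1p).
have R := exp_formZ p_pr ub (exp_formM p_pr p_gt3 (exp_form_shift_prod p_pr p_gt3 m3p hx)
  (exp_formV p_pr p_gt3 (exp_form_shift_prod p_pr p_gt3 m2p hx))).
apply: (exp_form_conv (exp_form_reduce (a := x) (b := - x) (d := 0) (a' := - (x ^+ 2 / 2))
  (b' := x ^+ 2 / 2) (d' := 0) _ _ _ _ _ _ (exp_form_conv R erefl _ _ erefl))); try solve_pint.
- by ring.
- by field.
- by rewrite -/c cE; field; rewrite f0 f2.
- by rewrite /H /K; ring.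
- by rewrite /s; field.
- by [].
Qed.

(** Half the binomial coefficient of 2p + 3m over p + m. *)
Definition ratio3 := (2 * p)`!%:R / p`!%:R ^+ 2 / 2 *
  (shift_prod (3 * m) 2 / (shift_prod (2 * m) 1 * shift_prod m 1)).

Lemma exp_form_ratio3 : exp_form c (H - 2 * K) (7 / 2 * s) ratio3.
Proof.
have pE : p = (2 * (3 * m)).+1 by lia.
have c1 := pint1 p_pr; have c2 := pint_nat p_pr 2.
have pp : (p.-1 < p)%N by lia.
have ub := punitV (punit_fact p_pr p_gt3 pp).
have B := exp_formZ p_pr ub (exp_form_shift_prod p_pr p_gt3 pp c1).
(* Wolstenholme: half the central binomial coefficient is the product of the 1 + p/i, 0 < i < p,
   hence 1 modulo p^3. *)
have {}B : exp_form 1 0 0 ((2 * p)`!%:R / p`!%:R ^+ 2 / 2).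
  have p1 : p.-1 = (2 * (3 * m))%N by lia.
  apply: (exp_form_conv (exp_form_eq p_pr p_gt3 B (pint0 p_pr) (pint0 p_pr) _ _)) => //.
  - by rewrite p1 mul1r; apply: harm1_full.
  - rewrite p1 -(mulr0 (- (1 ^+ 2 / 2))); apply: (eqm_mull p_pr); first by solve_pint.
    exact: harm2_full.
  - by rewrite mulVf // factS_neq0.
  have := fact_shift_prod 1 p; rewrite mul1n addnn -mul2n => <-.
  have SP n : (0 < n)%N -> shift_prod n 1 = shift_prod n.-1 1 * (n%:R + P * 1).
    by case: n => // n _; rewrite (shift_prodS p).
  have FP n : (0 < n)%N -> n`!%:R = n%:R * n.-1`!%:R :> rat.
    by case: n => // n _; rewrite factS natrM.
  rewrite (SP _ (prime_gt0 p_pr)) (FP _ (prime_gt0 p_pr)); have g0 := factS_neq0 p.-1; have P0 := pneq0 p_pr.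
  by field; rewrite g0 P0.
have R := exp_formM p_pr p_gt3 B (exp_formM p_pr p_gt3 (exp_form_shift_prod p_pr p_gt3 m3p c2)
  (exp_formV p_pr p_gt3 (exp_formM p_pr p_gt3 (exp_form_shift_prod p_pr p_gt3 m2p c1)
    (exp_form_shift_prod p_pr p_gt3 m1p c1)))).
apply: (exp_form_conv (exp_form_reduce (a := 2) (b := - 1) (d := - 1) (a' := - 2)
  (b' := 1 / 2) (d' := 1 / 2) _ _ _ _ _ _ (exp_form_conv R erefl _ _ erefl))); try solve_pint.
- by ring.
- by field.
- by rewrite -/c cE; field; rewrite f0 f2.
- by rewrite /H /K; ring.
- by rewrite /s; field.
- by [].
Qed.

Lemma affine_neq0 (a b : nat) : (0 < a)%N -> (b <= a * 3)%N -> a%:R * P - b%:R != 0.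
Proof.
move=> a0 ba; have h : (b < a * p)%N by apply: leq_ltn_trans ba _; rewrite ltn_pmul2l.
by rewrite -natrM -natrB ?(ltnW h) // pnatr_eq0 subn_eq0 -ltnNge.
Qed.

Lemma factor_values : [/\ (m%:R = (P - 1) / 6 :> rat), 3 * P - 1 != 0, 5 * P - 1 != 0 & 5 * P - 3 != 0].
Proof.
have E : P = 6 * m%:R + 1 by rewrite pm -natr1 natrM.
split; first by rewrite E; field.
- exact: (@affine_neq0 3 1 isT isT).
- exact: (@affine_neq0 5 1 isT isT).
exact: (@affine_neq0 5 3 isT isT).
Qed.

(** 9m = p + 3m - 1 and 15m = 2p + 3m - 2, and similarly for the other factorials; the one or two
    missing factors produce the rational prefactors. *)
Lemma binomial_values : [/\
  'C(9 * m, 2 * m)%:R = (7 * P - 1) / (3 * (3 * P - 1)) * ratio1 1,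
  'C(9 * m, 8 * m)%:R = 2 * (4 * P - 1) / (3 * (3 * P - 1)) * ratio2 1 &
  [/\ 'C(15 * m, 2 * m)%:R = (13 * P - 1) * (13 * P - 7) / (9 * (5 * P - 1) * (5 * P - 3)) * ratio1 2,
  'C(15 * m, 8 * m)%:R = 4 * (7 * P - 1) * (4 * P - 1) / (9 * (5 * P - 1) * (5 * P - 3)) * ratio3 &
  'C(15 * m, 14 * m)%:R = 4 * (7 * P - 1) * (7 * P - 4) / (9 * (5 * P - 1) * (5 * P - 3)) * ratio2 2]].
Proof.
have [mE d3 d1 d5] := factor_values.
have EP : P = 6 * m%:R + 1 by rewrite mE; field.
have FP n : n.+1`!%:R = (n%:R + 1) * n`!%:R :> rat by rewrite factS natrM natr1.
have S1 k : (k * m < p)%N -> ((6 + k) * m)`!%:R = p`!%:R * shift_prod (k * m) 1 / (P + k%:R * m%:R) :> rat.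
  move=> kp; have := fact_shift_prod 1 (k * m); rewrite mul1n => ->.
  have -> : (p + k * m = ((6 + k) * m).+1)%N by lia.
  rewrite FP natrM natrD EP.
  have n0 : 6 * m%:R + 1 + k%:R * m%:R != 0 :> rat.
    by rewrite -!natrM natr1 -natrD pnatr_eq0.
  by field; rewrite n0.
have S2 k : (k * m < p)%N -> ((12 + k) * m)`!%:R = (2 * p)`!%:R * shift_prod (k * m) 2
     / ((2 * P + k%:R * m%:R) * (2 * P + k%:R * m%:R - 1)) :> rat.
  move=> kp; have := fact_shift_prod 2 (k * m) => ->.
  have -> : (2 * p + k * m = ((12 + k) * m).+2)%N by lia.
  rewrite FP FP -[(_ * m).+1%:R]natr1 natrM natrD EP.
  have n0 : 12 * m%:R + 1 + k%:R * m%:R != 0 :> rat.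
    by rewrite -!natrM natr1 -natrD pnatr_eq0.
  have n1 : 12 * m%:R + 2 + k%:R * m%:R != 0 :> rat.
    by rewrite -!natrM -!natrD pnatr_eq0 addn2.
  have e1 : 2 * (6 * m%:R + 1) + k%:R * m%:R - 1 = 12 * m%:R + 1 + k%:R * m%:R :> rat by ring.
  have e2 : 2 * (6 * m%:R + 1) + k%:R * m%:R = 12 * m%:R + 2 + k%:R * m%:R :> rat by ring.
  by rewrite e1 e2; field; rewrite n0 n1.
have c1 := pint1 p_pr; have c2 := pint_nat p_pr 2.
have pE : p = (2 * (3 * m)).+1 by lia.
have u11 := punit_neq0 (punit_shift_prod p_pr p_gt3 pE m1p c1).
have u21 := punit_neq0 (punit_shift_prod p_pr p_gt3 pE m2p c1).
have u12 := punit_neq0 (punit_shift_prod p_pr p_gt3 pE m1p c2).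
have u22 := punit_neq0 (punit_shift_prod p_pr p_gt3 pE m2p c2).
have p0 := factS_neq0 p; have pp0 := factS_neq0 (2 * p).
have T9 := S1 3%N m3p; have T8 := S1 2%N m2p; have := S1 1%N; rewrite mul1n => /(_ m1p) T7.
have T15 := S2 3%N m3p; have T14 := S2 2%N m2p; have := S2 1%N; rewrite mul1n => /(_ m1p) T13.
rewrite !addnE /= in T9 T8 T7 T15 T14 T13.
have D9 : P + 3 * m%:R = (3 * P - 1) / 2 by rewrite mE; field.
have D8 : P + 2 * m%:R = (4 * P - 1) / 3 by rewrite mE; field.
have D7 : P + 1 * m%:R = (7 * P - 1) / 6 by rewrite mE; field.
have D15 : 2 * P + 3 * m%:R = (5 * P - 1) / 2 by rewrite mE; field.
have D15' : (5 * P - 1) / 2 - 1 = (5 * P - 3) / 2 by field.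
have D14 : 2 * P + 2 * m%:R = (7 * P - 1) / 3 by rewrite mE; field.
have D14' : (7 * P - 1) / 3 - 1 = (7 * P - 4) / 3 by field.
have D13 : 2 * P + 1 * m%:R = (13 * P - 1) / 6 by rewrite mE; field.
have D13' : (13 * P - 1) / 6 - 1 = (13 * P - 7) / 6 by field.
rewrite {}D9 in T9; rewrite {}D8 in T8; rewrite {}D7 in T7.
rewrite {}D15 {}D15' in T15; rewrite {}D14 {}D14' in T14; rewrite {}D13 {}D13' in T13.
have d7 : 7 * P - 1 != 0 by exact: (@affine_neq0 7 1 isT isT).
have d4 : 4 * P - 1 != 0 by exact: (@affine_neq0 4 1 isT isT).
have d13 : 13 * P - 1 != 0 by exact: (@affine_neq0 13 1 isT isT).
have d137 : 13 * P - 7 != 0 by exact: (@affine_neq0 13 7 isT isT).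
have d74 : 7 * P - 4 != 0 by exact: (@affine_neq0 7 4 isT isT).
have B a b k : (b <= a)%N -> (a - b = k)%N -> 'C(a * m, b * m)%:R
    = (a * m)`!%:R / ((b * m)`!%:R * (k * m)`!%:R) :> rat.
  by move=> ab <-; rewrite bin_fact_rat ?leq_mul2r ?ab ?orbT // mulnBl.
have -> := B 9%N 2%N 7%N isT erefl; have -> := B 9%N 8%N 1%N isT erefl.
have -> := B 15%N 2%N 13%N isT erefl; have -> := B 15%N 8%N 7%N isT erefl.
have -> := B 15%N 14%N 1%N isT erefl.
rewrite T9 T8 T7 T15 T14 T13 mul1n /ratio1 /ratio2 /ratio3.
move: d3 d1 d5 d7 d4 d13 d137 d74.
move: (3 * P - 1) (5 * P - 1) (5 * P - 3) (7 * P - 1) (4 * P - 1) (13 * P - 1) (13 * P - 7) (7 * P - 4).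
move=> e3 e51 e53 e7 e4 e13 e137 e74 d3 d1 d5 d7 d4 d13 d137 d74.
split; [by field; rewrite ?d3 ?d7 ?u11 ?f2 ?p0 | by field; rewrite ?d3 ?d4 ?u21 ?f0 ?p0 |].
split; first by field; rewrite ?d1 ?d5 ?d13 ?d137 ?u12 ?f2 ?pp0.
  by field; rewrite ?d1 ?d5 ?d4 ?d7 ?u11 ?u21 ?p0.
by field; rewrite ?d1 ?d5 ?d7 ?d74 ?u22 ?f0 ?pp0.
Qed.

Lemma punit_denominator : punit (72 * (3 * P - 1) * ((5 * P - 1) * (5 * P - 3))).
Proof.
have U (a b : nat) : punit b%:R -> punit (a%:R * P - b%:R).
  move=> ub; apply: (punit_eqm p_pr _ (punitN p_pr ub)).
  by exists a%:R; [exact: pint_nat | ring].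
have u1 := U _ 1%N (punit1 p_pr).
have u3 : punit 3%:R := punit_smooth p_pr p_gt3 (isT : (0 < 3)%N) isT.
have u72 : punit 72%:R := punit_smooth p_pr p_gt3 (isT : (0 < 72)%N) isT.
exact: (punitM p_pr (punitM p_pr u72 (u1 3%N)) (punitM p_pr (u1 5%N) (U 5%N 3%N u3))).
Qed.

(** All the binomial coefficients have the same leading constant [c], so they combine into one
    exponential; the cleared denominators a p - b are units because b is 1 or 3. *)
Lemma jacobi_value j :
    eqm 3 (8 * j%:R) (p.-1%:R * (15 * 'C(3 * m, 2 * m)%:R
      - 10 * ('C(9 * m, 2 * m)%:R + 'C(9 * m, 8 * m)%:R)
      + 3 * ('C(15 * m, 2 * m)%:R + 'C(15 * m, 8 * m)%:R + 'C(15 * m, 14 * m)%:R))) ->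
  exp_form (- c) (- (1 / 3) * H + K / 2) (s / 24) j%:R.
Proof.
have [E1 E2 [E3 E4 E5]] := binomial_values.
have [mE d3 d1 d5] := factor_values.
have c1 := pint1 p_pr; have c2 := pint_nat p_pr 2.
have [uc k1 s1 R1] := exp_form_ratio1 c1; have [_ _ _ R2] := exp_form_ratio2 c1.
have [_ _ _ R3] := exp_form_ratio1 c2; have [_ _ _ R5] := exp_form_ratio2 c2.
have [_ _ _ R4] := exp_form_ratio3.
have h1 : pint H := pint_harm p_pr 1 m3p.
have {}k1 : pint K := pint_harm p_pr 1 m2p.
have {}s1 : pint s := pint_harm p_pr 2 m2p.
have -> : 'C(3 * m, 2 * m)%:R = c.
  by rewrite /c -(@bin_sub (3 * m) m) ?leq_pmull // m32.
have p1 : p.-1%:R = P - 1 by rewrite -subn1 natrB // prime_gt0.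
rewrite p1 E1 E2 E3 E4 E5 => J.
split; [exact: punitN | by solve_pint | by solve_pint |].
have hc := punit_pint uc.
apply: (eqm_cancel p_pr punit_denominator).
have -> : 72 * (3 * P - 1) * ((5 * P - 1) * (5 * P - 3)) * j%:R
   = 9 * (3 * P - 1) * ((5 * P - 1) * (5 * P - 3)) * (8 * j%:R) by ring.
apply: (eqm_trans p_pr (eqm_mull p_pr _ J)); first by clear -p_pr; solve_pint.
case: R1 => y1 hy1 ->; case: R2 => y2 hy2 ->; case: R3 => y3 hy3 ->.
case: R4 => y4 hy4 ->; case: R5 => y5 hy5 ->.
exact: jacobi_combination.
Qed.

End JacobiValue.

(** * The two congruences *)

Section FinalCongruences.
Variables (p : nat) (p_pr : prime p) (p_gt3 : (3 < p)%N).
Local Notation P := (p%:R : rat).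
Local Notation pint := (pint p).
Local Notation punit := (punit p).
Local Notation eqm := (eqm p).
Local Notation S := (\sum_(0 <= k < p.-1)
  ('C(2 * k, k)%:R ^+ 2 * 'C(3 * k, k)%:R) / (108 ^+ k * (k + 1)%:R ^+ 3) : rat).

Lemma punit_divl x y : pint x -> pint y -> punit (x * y) -> punit x.
Proof.
move=> hx hy [xy0 _ hV]; have x0 : x != 0 by apply: contraNneq xy0 => ->; rewrite mul0r.
have y0 : y != 0 by apply: contraNneq xy0 => ->; rewrite mulr0.
split=> //; rewrite (_ : x^-1 = y * (x * y)^-1); last by field; rewrite x0 y0.
exact: pintM.
Qed.

Lemma eqm_sq_div k a b : pint k -> punit b -> eqm 1 a b ->
  eqm 3 (k * P ^+ 2 / a) (k * P ^+ 2 / b).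
Proof.
move=> hk ub ab; rewrite -!(mulrA k); apply: (eqm_mull p_pr hk).
have T := @eqm_mulp p 1 2 _ _ (eqmV p_pr (ltn0Sn 0) ub ab).
exact: T.
Qed.

(** Because of the factor p^2, the invertible value matters only modulo [p]. *)
Lemma eqm_product_quotient A A' b : eqm 3 (A * A') (- 2 * P ^+ 2) -> eqm 1 A b -> punit b ->
  eqm 3 A' (- 2 * P ^+ 2 / b).
Proof.
move=> AA Ab ub; have uA := punit_eqm p_pr Ab ub.
apply: (eqm_trans p_pr _ (eqm_sq_div _ ub Ab)); last by solve_pint.
apply: (eqm_cancel p_pr uA); rewrite [X in eqm _ _ X](_ : _ = - 2 * P ^+ 2) //.
by case: uA => A0 _ _; field.
Qed.

Lemma sqr_add1_texp_eqm1 u v : pint u -> pint v -> eqm 1 ((1 + P) ^+ 2 * texp p u v) 1.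
Proof.
move=> hu hv; exists ((2 + P) * texp p u v + u + P * (u ^+ 2 / 2 + v)).
  by rewrite /texp; solve_pint.
by rewrite /texp; ring.
Qed.

Lemma shifted_sum_1mod6 m (x y : int) : p = (6 * m).+1 -> p%:Z = x ^+ 2 + 3 * y ^+ 2 ->
  rat_congr p 3 S (9 - 2 * x%:~R ^+ 2 + P + 117 * P ^+ 2 / (16 * x%:~R ^+ 2)).
Proof.
move=> pm pxy; have pE : p = (2 * (3 * m)).+1 by lia.
have m_gt0 : (0 < m)%N by case: m pm p_gt3 {pE} => // ->.
have m2p : (2 * m < p)%N by lia.
have [j [/(jacobi_value p_pr p_gt3 pm) J X4]] := jacobi_link p_pr p_gt3 pm pxy.
have EA := even_value_1mod6 p_pr p_gt3 pm.
have S0 := shifted_sum_congr p_pr p_gt3 pE.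
have EP : P = 6 * m%:R + 1 by rewrite pm -natr1 natrM.
have e1 : - (P / 3) + (2 * m)%:R = - (1 / 3) by rewrite natrM EP; field.
have e2 : - (1 / 3) - 1 = -1 - 1 / 3 :> rat by field.
have := even_odd_product p_pr p_gt3 pE m_gt0 m2p.
rewrite {}e1 {}e2 hsum_sym sqrrN => /(_ erefl) AA.
have uj := exp_form_punit p_pr p_gt3 J.
set t := (j%:R : rat) ^+ 2 in X4.
have ut : punit t by apply: punitX.
have [t0 ht hV] := ut.
(* The squared Jacobi sum and the 3F2 value have the same constant and the same exponents. *)
have At : eqm 3 (hsum p (- (1 / 3))) t.
  have [_ _ _ Jt] := exp_formX p_pr p_gt3 2 J; have [_ _ _ At] := EA.
  apply: (eqm_trans p_pr At); apply: eqm_sym => //; rewrite /t.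
  rewrite sqrrN (_ : 2%:R * (_ + _) = - (2 / 3) * harm 1 (3 * m) + harm 1 (2 * m)) in Jt; last by field.
  by rewrite (_ : 2%:R * (_ / 24) = harm 2 (2 * m) / 12) in Jt; last by field.
have A't := eqm_product_quotient AA (eqm_weak p_pr (isT : (1 <= 3)%N) At) ut.
set X := (x%:~R : rat) ^+ 2 in X4 *.
have hX : pint X by rewrite /X; solve_pint.
(* The relation 4 x^2 t = (t + p)^2, divided by the unit [t]. *)
have E4 : eqm 3 (4 * X) (t + 2 * P + P ^+ 2 / t).
  apply: (eqm_cancel p_pr ut); rewrite mulrC (_ : t * _ = (t + P) ^+ 2) //.
  by field.
have E1 : eqm 1 (4 * X) t.
  apply: (eqm_trans p_pr (eqm_weak p_pr (isT : (1 <= 3)%N) E4)).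
  by exists (2 + P / t); [solve_pint | ring].
have uX : punit X.
  have := punit_eqm p_pr E1 ut; rewrite mulrC; apply: punit_divl => //; solve_pint.
have [X0 _ XV] := uX.
apply: (rat_congr_eqm p_pr); first by rewrite invfM; solve_pint.
apply: (eqm_trans p_pr S0).
apply: (@eqm_trans p p_pr 3 (9 - t / 2 - 115 / 8 * (- 2 * P ^+ 2 / t)) _ _ _ _).
  apply: eqmB => //.
    apply: eqmB => //; first exact: eqm_refl.
    by apply: (eqm_mulr p_pr) => //; solve_pint.
  by apply: (eqm_mull p_pr) => //; solve_pint.
apply: eqm_sym => //.
(* -t/2 becomes -2 x^2 + p + p^2/(2 t), and 1/2 + 115/4 = 117/4; in the p^2 term [t] is replaced by
   4 x^2. *)
have h : pint (- (1 / 2)) by solve_pint.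
have k : pint (117 / 4) by solve_pint.
have T := eqmD p_pr (eqmD p_pr (eqm_mull p_pr h E4) (eqm_sq_div k ut E1)) (eqm_refl p_pr 3 (9 + P)).
rewrite [X in eqm _ X _](_ : _ = - (1 / 2) * (4 * X) + 117 / 4 * P ^+ 2 / (4 * X) + (9 + P)); last by field.
by rewrite [X in eqm _ _ X](_ : _ = - (1 / 2) * (t + 2 * P + P ^+ 2 / t) + 117 / 4 * P ^+ 2 / t + (9 + P)); last by field.
Qed.

Definition shifted_sum_factor (q2 q3 u : rat) : rat :=
  1 + P * (2 + 4 / 3 * q2 - 3 / 2 * q3)
  + P ^+ 2 * (1 + 8 / 3 * q2 + 2 / 9 * q2 ^+ 2 - 3 * q3 - 2 * q2 * q3
    + 15 / 8 * q3 ^+ 2 + 3 / 4 * u).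

(** The hypotheses on [q2], [q3], [u] are [pow2_texp], [pow3_texp] and [U_congr] with remainders
    [z2], [z3], [z]; the witness is the exact difference of the two sides divided by [P ^+ 3]. *)
Lemma shifted_sum_factorE H K s z z2 z3 q2 q3 u : pint H -> pint K -> pint s ->
    pint z -> pint z2 -> pint z3 ->
    q2 = - (1 / 2) * H + P * (H ^+ 2 / 8) + P ^+ 2 * z2 ->
    q3 = - (2 / 3) * K + P * (2 / 9 * K ^+ 2 - 2 / 9 * s) + P ^+ 2 * z3 ->
    u = - (s / 3) + P * z ->
  eqm 3 ((1 + P) ^+ 2 * texp p (- (2 / 3) * H + K) (s / 12))
    (shifted_sum_factor q2 q3 u).
Proof.
move=> hH hK hs hz hz2 hz3 E2 E3 Eu.
exists (
     (- 648 * z + 1296 * z3 - 1152 * z2 - 432 * s + 864 * K - 480 * K * s + 1440 * K ^+ 2 + 480 * K ^+ 3 - 576 * H + 192 * H * s - 1152 * H * K - 192 * H * K ^+ 2 + 96 * H ^+ 2 - 144 * H ^+ 2 * K + 24 * H ^+ 3 + 2592 * P * z3 - 2304 * P * z2 + 72 * P * s - 80 * P * s ^+ 2 + 2160 * P * K * z3 - 1152 * P * K * z2 + 432 * P * K ^+ 2 + 160 * P * K ^+ 2 * s - 80 * P * K ^+ 4 - 864 * P * H * z3 + 192 * P * H * z2 - 576 * P * H * K + 192 * P * H ^+ 2 - 48 * P * H ^+ 2 * s + 48 * P * H ^+ 2 * K ^+ 2 - 3 * P * H ^+ 4 + 720 * P ^+ 2 * s * z3 - 384 * P ^+ 2 *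 s * z2 - 720 * P ^+ 2 * K ^+ 2 * z3 + 384 * P ^+ 2 * K ^+ 2 * z2 + 216 * P ^+ 2 * H ^+ 2 * z3 - 48 * P ^+ 2 * H ^+ 2 * z2 - 1620 * P ^+ 3 * z3 ^+ 2 + 1728 * P ^+ 3 * z2 * z3 - 192 * P ^+ 3 * z2 ^+ 2) / 864).
  by solve_pint.
by rewrite E2 E3 Eu /shifted_sum_factor /texp; move: (P) => P'; clear; field.
Qed.

Lemma shifted_sum_5mod6 m : p = (6 * m + 5)%N ->
  let B : rat := 'C(3 * m + 2, m)%:R in
  let q2 := fermat_quotient p 2 in
  let q3 := fermat_quotient p 3 in
  rat_congr p 3 S (9 - 115 / 2 * B ^+ 2 *
    shifted_sum_factor q2 q3 (U (p - 3))%:~R + 1 / 4 * P ^+ 2 * B ^- 2).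
Proof.
move=> pm B q2 q3; have pE : p = (2 * (3 * m + 2)).+1 by lia.
have EA := even_value_5mod6 p_pr p_gt3 pm.
have S0 := shifted_sum_congr p_pr p_gt3 pE.
have EP : P = 6 * m%:R + 5 by rewrite pm natrD natrM.
have m1p : (2 * m.+1 < p)%N by lia.
have := even_odd_product p_pr p_gt3 pE (ltn0Sn m) m1p.
have e1 : - (P / 3) + (2 * m.+1)%:R = 1 / 3 by rewrite natrM -natr1 EP; field.
have e2 : 1 / 3 - 1 = -1 - - (1 / 3) :> rat by field.
rewrite {}e1 {}e2 hsum_sym => /(_ erefl) AA.
have [uc hu hv At] := EA.
have hB : pint B by apply: pint_nat.
have uB2 : punit (B ^+ 2).
  move: uc; rewrite -/B mulrC mulrA mulrC; apply: punit_divl; solve_pint.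
have [B0 _ BV] := uB2.
have h1p : (3 * m + 2 < p)%N by lia.
have k1p : (2 * m + 1 < p)%N by lia.
have pH := pint_harm p_pr 1 h1p; have pK := pint_harm p_pr 1 k1p; have ps := pint_harm p_pr 2 k1p.
have u4 : punit 4 by apply: (punit_smooth p_pr p_gt3).
have u4B : punit (4 * B ^+ 2) by apply: punitM.
have A1 : eqm 1 (hsum p (1 / 3)) (4 * B ^+ 2).
  apply: (eqm_trans p_pr (eqm_weak p_pr (isT : (1 <= 3)%N) At)).
  rewrite -/B -mulrA -[X in eqm _ _ X]mulr1; apply: (eqm_mull p_pr); first exact: punit_pint.
  exact: sqr_add1_texp_eqm1.
have A't := eqm_product_quotient AA A1 u4B.
have [z2 hz2 E2] := pow2_texp p_pr p_gt3 pE.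
have [|z3 hz3 E3] := pow3_texp p_pr p_gt3 pE (k := (2 * m + 1)%N); first by lia.
have [z hz EU] := U_congr p_pr p_gt3 pm.
have P0 := pneq0 p_pr; have pm1 : p.-1 = (2 * (3 * m + 2))%N by lia.
have := shifted_sum_factorE pH pK ps hz hz2 hz3 (q2 := q2) (q3 := q3) (u := (U (p - 3))%:~R).
set b := shifted_sum_factor _ _ _ => E.
have {}E : eqm 3 ((1 + P) ^+ 2 * texp p (- (2 / 3) * harm 1 (3 * m + 2) + harm 1 (2 * m + 1))
    (harm 2 (2 * m + 1) / 12)) b.
  apply: E.
  - by rewrite /q2 /fermat_quotient pm1 E2 /texp; field.
  - by rewrite /q3 /fermat_quotient pm1 E3 /texp; field.
  by rewrite EU; field.
clear EU E2 E3 pE EP pm1 h1p k1p m1p.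
move: b E => b E.
have hb : pint b.
  apply: (eqm_pint p_pr (eqm_sym p_pr E)).
  by have T := pint_texp p_pr p_gt3 hu hv; solve_pint.
apply: (rat_congr_eqm p_pr); first by solve_pint.
apply: (eqm_trans p_pr S0).
(* 115/2 is 4 times 115/8, and the last term p^2 / (4 B^2) is minus half the companion value -2 p^2
   / (4 B^2). *)
rewrite [X in eqm _ _ X](_ : _ = 9 - (- 2 * P ^+ 2 / (4 * B ^+ 2)) / 2 - 115 / 8 * (4 * B ^+ 2 * b)); last by field; move: B0; rewrite expf_eq0.
apply: eqmB => //.
  apply: eqmB => //; first exact: eqm_refl.
  by apply: (eqm_mulr p_pr) => //; solve_pint.
apply: (eqm_mull p_pr); first by solve_pint.
apply: (eqm_trans p_pr At); rewrite -mulrA; apply: (eqm_mull p_pr) => //.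
exact: punit_pint.
Qed.

End FinalCongruences.

Theorem theorem10p2 (p : nat) (p_prime : prime p) (p_gt3 : (3 < p)%N) :
  let S : rat := \sum_(0 <= k < p.-1)
    ('C(2 * k, k)%:R ^+ 2 * 'C(3 * k, k)%:R) / (108 ^+ k * (k + 1)%:R ^+ 3) in
  (p = 1 %[mod 3] ->
   forall x y : int, p%:Z = x ^+ 2 + 3 * y ^+ 2 ->
   rat_congr p 3 S
     (9 - 2 * x%:~R ^+ 2 + p%:R + 117 * p%:R ^+ 2 / (16 * x%:~R ^+ 2)))
  /\
  (p = 2 %[mod 3] ->
   let B : rat := 'C((p - 1) %/ 2, (p - 5) %/ 6)%:R in
   let q2 := fermat_quotient p 2 in
   let q3 := fermat_quotient p 3 in
   rat_congr p 3 S
     (9 - 115 / 2 * B ^+ 2 *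
        (1 + p%:R * (2 + 4 / 3 * q2 - 3 / 2 * q3)
         + p%:R ^+ 2 *
           (1 + 8 / 3 * q2 + 2 / 9 * q2 ^+ 2 - 3 * q3 - 2 * q2 * q3
            + 15 / 8 * q3 ^+ 2 + 3 / 4 * (U (p - 3))%:~R))
      + 1 / 4 * p%:R ^+ 2 * B ^- 2)).
Proof.
have [p2|p_odd] := even_prime p_prime; first by rewrite p2 in p_gt3.
move=> S; split=> [p1 x y pxy | p2].
  apply: (shifted_sum_1mod6 p_prime p_gt3 (m := (p %/ 6)%N) _ pxy); lia.
have pm : p = (6 * (p %/ 6) + 5)%N by lia.
have -> : ((p - 1) %/ 2 = 3 * (p %/ 6) + 2)%N by lia.
have -> : ((p - 5) %/ 6 = p %/ 6)%N by lia.
exact (shifted_sum_5mod6 p_prime p_gt3 pm).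
Qed.
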